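(* Let $\mathbb{P}_{\mathbf{\Sigma}}$ be the proper smooth toric Deligne–Mumford stack of dimension $3$ associated to a complete stacky fan $\mathbf{\Sigma}=(\Sigma,\{v_i\}_{i=1}^n)$ in a lattice $N$ of rank $3$. Assume there is at most one pair $\{i,j\}$, $i\ne j$, such that $v_i$ and $v_j$ are collinear. Then there are infinitely many pairwise non-isomorphic $\mathrm{H}$-trivial line bundles on $\mathbb{P}_{\mathbf{\Sigma}}$ if and only if there exists a $\mathbf{\Sigma}$-piecewise linear function $\psi$ with $\dim(\Lambda_\psi)<3$.
   Context: Let $N$ be a free abelian group of rank $m$, $M=\mathrm{Hom}(N,\mathbb{Z})$, $N_{\mathbb{R}}=N\otimes\mathbb{R}$, $M_{\mathbb{R}}=M\otimes\mathbb{R}$. Let $\Sigma$ be a complete simplicial fan in $N_{\mathbb{R}}$ with $n$ rays, and for each $i$ let $v_i\in N$ be a nonzero lattice point on the $i$-th ray; $\mathbf{\Sigma}=(\Sigma,\{v_i\}_{i=1}^n)$ is a complete stacky fan and $\mathbb{P}_{\mathbf{\Sigma}}$ is the associated toric DM stack (Borisov–Chen–Smith). Its Picard group is $\mathbb{Z}^n/\{\sum_i (w\cdot v_i)E_i : w\in M\}$, where $E_1,\dots,E_n$ is the standard basis of $\mathbb{Z}^n$; $\mathcal{O}(\sum r_iE_i)$ denotes the class of $\sum r_iE_i$. For $\mathbf r\in\mathbb{Z}^n$, $Supp(\mathbf r)$ is the simplicial complex on $\{1,\dots,n\}$ whose faces are the subsets $J$ (including $\emptyset$) with $r_i\ge0$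 for all $i\in J$ and $\{v_i:i\in J\}$ contained in a single cone of $\Sigma$. Then $H^j(\mathbb{P}_{\mathbf{\Sigma}},\mathcal L)=\bigoplus \tilde H_{m-j-1}(Supp(\mathbf r))$, summed over all $\mathbf r\in\mathbb{Z}^n$ with $\mathcal O(\sum r_iE_i)\cong\mathcal L$ (reduced simplicial homology with $\mathbb{C}$-coefficients; the complex $\{\emptyset\}$ has $\tilde H_{-1}=\mathbb{C}$). A line bundle $\mathcal L$ is $\mathrm{H}$-trivial if $H^j(\mathbb{P}_{\mathbf{\Sigma}},\mathcal L)=0$ for all $j\ge0$. A $\mathbf{\Sigma}$-piecewise linear function is a continuous $\psi:N_{\mathbb{R}}\to\mathbb{R}$ whose restriction to each cone of $\Sigma$ is linear; for each maximal cone $\sigma$, $\psi_\sigma\in M_{\mathbb{R}}$ denotes the linear function agreeing with $\psi$ on $\sigma$. $\Lambda_\psi\subset M_{\mathbb{R}}$ is the convex hull of $\{\psi_\sigma:\sigma \text{ a maximal cone of }\Sigma\}$.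
   Formalization: The piecewise linear function ψ is required to be non-linear; otherwise ψ = 0, with Λ_ψ a point, would always satisfy dim(Λ_ψ) < 3 and the claim would fail for P^3, which has only three H-trivial line bundles. *)

(* Defs.v *)
From HB Require Import structures.
From mathcomp Require Import all_boot all_order all_algebra all_field.
Set Implicit Arguments. Unset Strict Implicit. Unset Printing Implicit Defensive.
Import Order.TTheory GRing.Theory Num.Theory.
Local Open Scope ring_scope.

(* The lattice N is identified with Z^3 (rank 3, a basis fixed); M = Hom(N,Z)
   is identified with Z^3 via the standard pairing.  N_R = R^3 for a real
   closed field R. Lattice points are row vectors 'rV[int]_3. *)

Definition dotp (R : pzRingType) (x y : 'rV[R]_3) : R := \sum_(k < 3) x 0 k * y 0 k.

Definition realize (R : pzRingType) (u : 'rV[int]_3) : 'rV[R]_3 :=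
  map_mx (fun z : int => z%:~R) u.

Definition in_cone (R : realFieldType) (n : nat) (v : 'I_n -> 'rV[int]_3)
  (J : {set 'I_n}) (x : 'rV[R]_3) : Prop :=
  exists c : 'I_n -> R, [/\ forall i, 0 <= c i,
                            forall i, i \notin J -> c i = 0 &
                            x = \sum_i c i *: realize R (v i)].

Definition lin_indep (R : realFieldType) (n : nat) (v : 'I_n -> 'rV[int]_3)
  (J : {set 'I_n}) : Prop :=
  forall c : 'I_n -> R, (forall i, i \notin J -> c i = 0) ->
    \sum_i c i *: realize R (v i) = 0 -> forall i, c i = 0.

(* (Sigma, {v_i}) is a complete simplicial stacky fan in N_R = R^3, given by
   its set of maximal cones [cones] (each the cone on {v_i : i in sigma}); the
   cones of Sigma are the faces of maximal cones, i.e. the subsets of the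
   sigma's; the rays of Sigma are exactly the rays through the v_i. *)
Definition complete_simplicial_stacky_fan (R : realFieldType) (n : nat)
  (v : 'I_n -> 'rV[int]_3) (cones : {set {set 'I_n}}) : Prop :=
  [/\ forall s, s \in cones -> #|s| = 3 /\ lin_indep R v s,
      forall s t, s \in cones -> t \in cones -> forall x : 'rV[R]_3,
         in_cone v s x -> in_cone v t x -> in_cone v (s :&: t) x,
      forall x : 'rV[R]_3, exists2 s, s \in cones & in_cone v s x &
      forall i, exists2 s, s \in cones & i \in s].

Definition collinear (u w : 'rV[int]_3) : Prop :=
  exists a b : int, (a != 0 \/ b != 0) /\ a *: u + b *: w = 0.

Definition at_most_one_collinear_pair (n : nat) (v : 'I_n -> 'rV[int]_3) : Prop :=
  forall i j k l : 'I_n, i != j -> k != l ->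
    collinear (v i) (v j) -> collinear (v k) (v l) -> [set i; j] = [set k; l].

(* O(sum r_i E_i) ~= O(sum r'_i E_i) iff r' - r = (w . v_i)_i for some w in M. *)
Definition lb_iso (n : nat) (v : 'I_n -> 'rV[int]_3) (r r' : 'I_n -> int) : Prop :=
  exists w : 'rV[int]_3, forall i, r' i - r i = dotp w (v i).

Definition Supp (n : nat) (cones : {set {set 'I_n}}) (r : 'I_n -> int)
  : {set {set 'I_n}} :=
  [set J : {set 'I_n} | [forall i in J, 0 <= r i] && [exists s in cones, J \subset s]].

Definition faces (n : nat) (K : {set {set 'I_n}}) (s : nat) : seq {set 'I_n} :=
  filter (fun J : {set 'I_n} => #|J| == s) (enum K).

Definition bcoef (F : pzRingType) (n : nat) (J I : {set 'I_n}) : F :=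
  if (I \subset J) && (#|J| == #|I|.+1) then
    \sum_(x in J :\: I) (-1) ^+ #|[set y in J | (nat_of_ord y < nat_of_ord x)%N]|
  else 0.

(* boundary map from s-vertex faces to (s-1)-vertex faces (zero for s = 0) *)
Definition bdry (F : pzRingType) (n : nat) (K : {set {set 'I_n}}) (s : nat) :
  'M[F]_(size (faces K s), size (faces K s.-1)) :=
  \matrix_(i, j) bcoef F (nth set0 (faces K s) i) (nth set0 (faces K s.-1) j).

(* dimension of reduced homology in degree s-1 *)
Definition rbetti_s (F : fieldType) (n : nat) (K : {set {set 'I_n}}) (s : nat) : nat :=
  (size (faces K s) - \rank (bdry F K s) - \rank (bdry F K s.+1))%N.

Definition rbetti (F : fieldType) (n : nat) (K : {set {set 'I_n}}) (d : int) : nat :=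
  if (-1 <= d) then rbetti_s F K (absz (d + 1)) else 0%N.

(* H^j(P_Sigma, O(sum r_i E_i)) = 0, where m = 3, coefficients C
   (realized by the algebraic closure algC of Q) *)
Definition Hj_vanishes (n : nat) (v : 'I_n -> 'rV[int]_3) (cones : {set {set 'I_n}})
  (j : nat) (r : 'I_n -> int) : Prop :=
  forall r', lb_iso v r r' -> rbetti algC (Supp cones r') (3%:Z - j%:Z - 1) = 0%N.

Definition Htrivial (n : nat) (v : 'I_n -> 'rV[int]_3) (cones : {set {set 'I_n}})
  (r : 'I_n -> int) : Prop :=
  forall j : nat, Hj_vanishes v cones j r.

Definition infinitely_many_Htrivial (n : nat) (v : 'I_n -> 'rV[int]_3)
  (cones : {set {set 'I_n}}) : Prop :=
  forall k : nat, exists rs : 'I_k -> ('I_n -> int),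
    (forall a, Htrivial v cones (rs a)) /\
    (forall a b, a != b -> ~ lb_iso v (rs a) (rs b)).

(* psi is Sigma-piecewise linear with psi_sigma = l sigma on each maximal cone
   (continuity is automatic for a function linear on each closed cone of a
   complete fan). *)
Definition PL_with (R : realFieldType) (n : nat) (v : 'I_n -> 'rV[int]_3)
  (cones : {set {set 'I_n}}) (psi : 'rV[R]_3 -> R) (l : {set 'I_n} -> 'rV[R]_3) : Prop :=
  forall s, s \in cones -> forall x, in_cone v s x -> psi x = dotp x (l s).

Definition is_linear_fun (R : pzRingType) (psi : 'rV[R]_3 -> R) : Prop :=
  exists u : 'rV[R]_3, forall x, psi x = dotp x u.

Definition hull_dim (R : fieldType) (S : seq 'rV[R]_3) : nat :=
  \rank (\matrix_(i < size S) (S`_i - S`_0)).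

Definition Lambda_points (R : realFieldType) (n : nat) (cones : {set {set 'I_n}})
  (l : {set 'I_n} -> 'rV[R]_3) : seq 'rV[R]_3 :=
  [seq l s | s <- enum cones].

(* Main.v *)
(* The bundle of [r] is H-trivial iff every induced subcomplex on
   {k : r_k + w.v_k >= 0}, w in M, of the triangulated sphere is acyclic.

   If all gradients of a nonlinear [psi] agree on some [u <> 0], they also agree on some ray
   generator [v_i], and the values of [psi] may be taken integral.  Put
   [r = a psi + floor eta], [eta] linear with [eta(v_i) = 1/2].  The sign sets are then those of
   piecewise linear functions [f] that are affine with nonzero slope along [v_i]: the vertices
   with [f >= 0] are connected, no 2-cycle exists, and the Euler characteristic vanishes since a
   face can be charged to the maximal cone entered from it in a direction close to [v_i].

   Conversely, normalized H-trivial bundles that tend to infinity accumulate at a nonlinear real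
   [psi] such that, for generic linear [w], the set {psi > w} has the Euler characteristic of a
   point.  Moving [w] across the value at a vertex [v_i] not collinear with another one shows
   that the link of [v_i] changes sign exactly twice; hence the walls at [v_i] across which
   [psi] is not linear are either absent or exactly two, opposite in one plane.  Such walls
   propagate along great circles, as far as the exceptional collinear pair.  Two of these arcs
   in different planes cannot cross elsewhere, so the planes of all broken walls contain a
   common line [u], and the gradients of [psi] agree on [u].  That is a linear system over the
   rationals, which transfers the solution to any real closed field. *)
Require Import Defs.
From HB Require Import structures.
From mathcomp Require Import all_boot all_order all_algebra all_field.
From mathcomp Require boolp classical_sets filter reals topology normedtype Rstruct.
From mathcomp Require Import ring lra zify.
Import Order.TTheory GRing.Theory Num.Theory.
Set Implicit Arguments. Unset Strict Implicit. Unset Printing Implicit Defensive.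
Local Open Scope ring_scope.

(** * Dot products and covers by polyhedral cones *)

(** Three ordered fields are in play. The fan, its dual bases and the planes of its walls are
    rational, so incidence arguments run over [rat]. The limit function needs compactness of a cube
    and lives over an archimedean field [K], whereas [R] may be non-archimedean; hence the detour
    through [rat] at both ends. Connectedness is never taken from topology: it is always obtained by
    following a segment through finitely many closed polyhedral pieces. The collinear pair is the
    obstacle. The argument at a vertex changes the sign of that vertex alone, which requires a
    linear function vanishing on [v_i] and on no other generator. None exists if a second generator
    lies on the line of [v_i], so a broken wall cannot be continued past such a ray. One exceptional
    line is harmless: two planes of broken walls either both contain it, or one of them avoids it.
    In the latter case the circle of that plane is traced completely and meets whichever half of the
    other circle is available. *)

Section Dotp.
Variable F : comPzRingType.
Implicit Types x y z : 'rV[F]_3.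

Lemma dotpC x y : dotp x y = dotp y x.
Proof. by apply: eq_bigr => k _; rewrite mulrC. Qed.

Lemma dotpDl x y z : dotp (x + y) z = dotp x z + dotp y z.
Proof. by rewrite /dotp -big_split; apply: eq_bigr => k _; rewrite mxE mulrDl. Qed.

Lemma dotpZl a x z : dotp (a *: x) z = a * dotp x z.
Proof. by rewrite /dotp mulr_sumr; apply: eq_bigr => k _; rewrite mxE mulrA. Qed.

Lemma dotpDr x y z : dotp z (x + y) = dotp z x + dotp z y.
Proof. by rewrite !(dotpC z) dotpDl. Qed.

Lemma dotpZr a x z : dotp z (a *: x) = a * dotp z x.
Proof. by rewrite !(dotpC z) dotpZl. Qed.

Lemma dotp0l z : dotp 0 z = 0.
Proof. by rewrite -(scale0r 0) dotpZl mul0r. Qed.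

Lemma dotp0r z : dotp z 0 = 0.
Proof. by rewrite dotpC dotp0l. Qed.

Lemma dotp_suml (I : Type) (r : seq I) (P : pred I) (f : I -> 'rV[F]_3) z :
  dotp (\sum_(i <- r | P i) f i) z = \sum_(i <- r | P i) dotp (f i) z.
Proof. by elim/big_rec2: _ => [|i _ x _ <-]; rewrite ?dotp0l ?dotpDl. Qed.

Lemma dotp_sumr (I : Type) (r : seq I) (P : pred I) (f : I -> 'rV[F]_3) z :
  dotp z (\sum_(i <- r | P i) f i) = \sum_(i <- r | P i) dotp z (f i).
Proof. by rewrite dotpC dotp_suml; apply: eq_bigr => i _; rewrite dotpC. Qed.

Lemma dotpNl x z : dotp (- x) z = - dotp x z.
Proof. by rewrite -scaleN1r dotpZl mulN1r. Qed.

Lemma dotpNr x z : dotp z (- x) = - dotp z x.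
Proof. by rewrite !(dotpC z) dotpNl. Qed.

Definition dotpE := (dotpDl, dotpDr, dotpZl, dotpZr, dotpNl, dotpNr, dotp0l, dotp0r).

Lemma dotp_eq0 z : (forall x, dotp x z = 0) -> z = 0.
Proof.
move=> z0; apply/rowP => k; rewrite mxE -[RHS](z0 (delta_mx 0 k)).
rewrite /dotp (bigD1 k) //= big1 ?addr0 => [|j /negbTE jk]; rewrite mxE eqxx.
  by rewrite eqxx mul1r.
by rewrite jk mul0r.
Qed.

End Dotp.

Lemma dotp_mul (F : comPzRingType) (x y : 'rV[F]_3) : dotp x y = (x *m y^T) 0 0.
Proof. by rewrite mxE; apply: eq_bigr => k _; rewrite mxE. Qed.

Lemma dotp_map (F K : comPzRingType) (f : {rmorphism F -> K}) (x y : 'rV[F]_3) :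
  dotp (map_mx f x) (map_mx f y) = f (dotp x y).
Proof. by rewrite rmorph_sum; apply: eq_bigr => k _; rewrite !mxE rmorphM. Qed.

(** Replaces the cross product, and stays nonzero for dependent [x], [y]: two rows have rank at most
    2 in dimension 3. *)
Lemma perp2 (F : fieldType) (x y : 'rV[F]_3) :
  exists h, [/\ h != 0, dotp x h = 0 & dotp y h = 0].
Proof.
pose A := col_mx x y.
have /rowV0Pn[h /sub_kermxP hA h0] : kermx A^T != 0.
  rewrite -mxrank_eq0 mxrank_ker mxrank_tr -lt0n subn_gt0.
  exact: leq_ltn_trans (rank_leq_row A) _.
exists h; split => //.
  rewrite dotpC dotp_mul; move/(congr1 (fun M => lsubmx M 0 0)): hA.
  by rewrite /A tr_col_mx mul_mx_row row_mxKl => ->; rewrite !mxE.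
rewrite dotpC dotp_mul; move/(congr1 (fun M => rsubmx M 0 0)): hA.
by rewrite /A tr_col_mx mul_mx_row row_mxKr => ->; rewrite !mxE.
Qed.


(** * Small perturbations, and segments covered by finitely many polyhedral cones *)

Section Small.
Variable F : realFieldType.

(** With [S] the sum of all [|b i / a i|], the step [1 / (1 + S)] serves every index at once.
    Indices with [a i = 0] add nothing to [S], as division by zero gives zero. *)
Lemma small_step (I : finType) (a b : I -> F) :
  exists2 e : F, 0 < e & forall t, 0 <= t -> t <= e ->
    forall i, a i != 0 -> Num.sg (a i + t * b i) = Num.sg (a i).
Proof.
pose S := \sum_i `|b i / a i|.
have S0 : 0 <= S by apply: sumr_ge0.
have S1 : 0 < 1 + S by rewrite ltr_pwDl.
exists (1 + S)^-1; first by rewrite invr_gt0.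
move=> t t0 te i ai.
have bS : `|b i / a i| <= S.
  by rewrite /S (bigD1 i) //= lerDl sumr_ge0.
have : `|t * (b i / a i)| < 1.
  rewrite normrM (ger0_norm t0).
  apply: le_lt_trans (ler_pM t0 (normr_ge0 _) te bS) _.
  by rewrite mulrC ltr_pdivrMr // mul1r ltrDr.
rewrite ltr_norml => /andP[h _].
have -> : a i + t * b i = a i * (1 + t * (b i / a i)).
  by rewrite mulrDr mulr1 mulrCA [a i * _]mulrC divfK.
by rewrite sgrM [X in _ * X]gtr0_sg ?mulr1 //; lra.
Qed.

(* Each index carries the closed interval of those [t] meeting its constraints;
   the largest right end point of an interval meeting [0, 1] has to be [1]. *)
Lemma last_point (I K : finType) (B : pred I) (a b : I -> K -> F) :
  let covers t := exists2 i, B i & forall k, 0 <= a i k + t * b i k in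
  covers 0 ->
  (forall t, 0 <= t -> t < 1 -> covers t -> exists t', [/\ t < t', t' <= 1 & covers t']) ->
  covers 1.
Proof.
move=> covers [i0 Bi0 ci0] step.
pose m i := \big[Order.min/1]_(k | b i k < 0) (a i k / - b i k).
have m1 i : m i <= 1 by exact: bigmin_le_id.
have lem i t : t <= 1 -> (forall k, 0 <= a i k + t * b i k) -> t <= m i.
  move=> t1 h; apply: le_bigmin => // k bk.
  by rewrite ler_pdivlMr ?oppr_gt0 // mulrN; have := h k; lra.
have mem i t : t <= 1 -> (forall k, 0 <= a i k + t * b i k) ->
    forall k, 0 <= a i k + m i * b i k.
  move=> t1 h k; have [bk|bk] := ltP (b i k) 0.
    have : m i <= a i k / - b i k by rewrite /m (bigD1 k) //= ge_min lexx.
    by rewrite ler_pdivlMr ?oppr_gt0 // mulrN; lra.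
  apply: le_trans (h k) _; rewrite lerD2l ler_wpM2r //; exact: lem.
pose B' := [pred i | B i & [forall k, 0 <= a i k + m i * b i k] && (0 <= m i)].
have B'i0 : B' i0.
  have h0 k : 0 <= a i0 k + 0 * b i0 k by apply: ci0.
  by rewrite /= Bi0 (lem i0 0) // andbT; apply/forallP; apply: (mem i0 0).
case: (@Order.TotalTheory.arg_maxP _ F I i0 B' m B'i0) => i /= /andP[Bi /andP[/forallP hi mi0]] maxi.
have [mi1|mi1] := eqVneq (m i) 1; first by exists i => // k; rewrite -{1}mi1.
have [||t' [tt' t'1 [j Bj hj]]] := step (m i) mi0; first by rewrite lt_neqAle mi1 m1.
  by exists i.
have jt := lem j t' t'1 hj.
have : B' j by rewrite /= Bj (le_trans mi0 (le_trans (ltW tt') jt)) andbT; apply/forallP; apply: mem t'1 hj.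
move=> /maxi; rewrite leNgt; rewrite (lt_le_trans tt' jt) //.
Qed.

End Small.

Section Cover.
Variables (F : realFieldType) (I : finType) (C : pred I) (n : nat).
Variable H : I -> 'I_n -> 'rV[F]_3.
Hypothesis cov : forall x, exists2 s, C s & forall k, 0 <= dotp x (H s k).

(** A piece containing [x + e d], for [e] too small to change the sign of any nonzero constraint at
    [x], already contains the whole initial segment. *)
Lemma eventual_cover x d : exists2 s, C s & exists2 e, 0 < e &
  forall t, 0 <= t -> t <= e -> forall k, 0 <= dotp (x + t *: d) (H s k).
Proof.
have [e e0 he] := @small_step F (I * 'I_n)%type (fun p => dotp x (H p.1 p.2)) (fun p => dotp d (H p.1 p.2)).
have [s Cs hs] := cov (x + e *: d); exists s => //; exists e => // t t0 te k.
have := hs k; rewrite !dotpDl !dotpZl => hk.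
have [x0|x0] := eqVneq (dotp x (H s k)) 0.
  move: hk; rewrite x0 !add0r pmulr_rge0 // => hk; exact: mulr_ge0.
have /= s1 := he _ (ltW e0) (lexx e) (s, k) x0.
have /= s2 := he _ t0 te (s, k) x0.
by rewrite -sgr_ge0 s2 -s1 sgr_ge0.
Qed.

(** Discrete form of the connectedness of a segment: [last_point] is applied to the pieces
    satisfying [Q], and [eventual_cover] supplies the piece entered next. *)
Lemma path_cover (Q : pred I) x d :
  (forall t s s', 0 <= t -> t <= 1 -> C s -> C s' ->
     (forall k, 0 <= dotp (x + t *: d) (H s k)) ->
     (forall k, 0 <= dotp (x + t *: d) (H s' k)) -> Q s -> Q s') ->
  forall s, C s -> Q s -> (forall k, 0 <= dotp x (H s k)) ->
  forall s', C s' -> (forall k, 0 <= dotp (x + d) (H s' k)) -> Q s'.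
Proof.
move=> tr s Cs Qs hs s' Cs' hs'.
have /= := @last_point F I 'I_n [pred i | C i & Q i]
  (fun i k => dotp x (H i k)) (fun i k => dotp d (H i k)).
case.
- by exists s; rewrite /= ?Cs // => k; rewrite mul0r addr0.
- move=> t t0 t1 [i /andP[Ci Qi] hi].
  have [i' Ci' [e e0 he]] := eventual_cover (x + t *: d) d.
  pose e' := Order.min e (1 - t).
  have e'0 : 0 < e' by rewrite lt_min e0 subr_gt0.
  exists (t + e'); split; first by rewrite ltrDl.
    by have : e' <= 1 - t; [rewrite ge_min lexx orbT|lra].
  exists i'; last first.
    move=> k; have := he e' (ltW e'0); rewrite ge_min lexx => /(_ isT k).
    by rewrite !dotpE mulrDl addrA.
  rewrite /= Ci'; apply: (tr t i i' t0 (ltW t1)) => // k.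
    by rewrite !dotpE hi.
  by have := he 0 (lexx 0) (ltW e0) k; rewrite scale0r addr0.
- move=> i /andP[Ci Qi] hi; apply: (tr 1 i s') => // k.
    by rewrite !dotpE hi.
  by rewrite scale1r.
Qed.

End Cover.

(** * Complete simplicial fans *)

(** The numbers [dotp x (b s k)] are the coordinates of [x] in the generators of [s]. Extending
    [b s] by zero outside [s] lets membership in the cone be tested over all indices. *)
Definition dual_basis (F : realFieldType) (n : nat) (v : 'I_n -> 'rV[int]_3)
    (cones : {set {set 'I_n}}) (b : {set 'I_n} -> 'I_n -> 'rV[F]_3) :=
  forall s, s \in cones ->
  [/\ forall k m, k \in s -> m \in s -> dotp (realize F (v k)) (b s m) = (k == m)%:R,
      forall m, m \notin s -> b s m = 0 &
      forall x, x = \sum_(k in s) dotp x (b s k) *: realize F (v k)].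

Lemma sum_supp (V : zmodType) (n : nat) (s : {set 'I_n}) (f : 'I_n -> V) :
  (forall i, i \notin s -> f i = 0) -> \sum_i f i = \sum_(i in s) f i.
Proof. by move=> f0; rewrite (bigID (mem s)) /= [X in _ + X]big1 ?addr0. Qed.

Lemma dual_basis_cone (F : realFieldType) (n : nat) (v : 'I_n -> 'rV[int]_3) (s : {set 'I_n}) :
  #|s| = 3 -> lin_indep F v s -> exists b : 'I_n -> 'rV[F]_3,
  [/\ forall k m, k \in s -> m \in s -> dotp (realize F (v k)) (b m) = (k == m)%:R,
      forall m, m \notin s -> b m = 0 &
      forall x, x = \sum_(k in s) dotp x (b k) *: realize F (v k)].
Proof.
move=> s3 indep.
pose e (a : 'I_3) : 'I_n := enum_val (cast_ord (esym s3) a).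
have es a : e a \in s by exact: enum_valP.
have e_inj : injective e by move=> a a' /enum_val_inj /cast_ord_inj.
have ek k : k \in s -> exists a, e a = k.
  move=> ks; exists (cast_ord s3 (enum_rank_in ks k)).
  by rewrite /e cast_ordK enum_rankK_in.
pose M := \matrix_(a < 3) realize F (v (e a)).
have sumM (z : 'rV_3) : z *m M = \sum_a z 0 a *: realize F (v (e a)).
  by rewrite mulmx_sum_row; apply: eq_bigr => a _; rewrite rowK.
have sume (f : 'I_n -> 'rV[F]_3) : \sum_(k in s) f k = \sum_a f (e a).
  rewrite (reindex_onto e (fun k => odflt ord0 [pick a | e a == k])) /=.
    apply: eq_bigl => a; rewrite es /=.
    by case: pickP => [a' /eqP/e_inj->|/(_ a)]; rewrite ?eqxx.
  move=> k /ek[a <-]; case: pickP => [a' /eqP //|/(_ a)]; by rewrite eqxx.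
have Mu : M \in unitmx.
  rewrite -row_free_unit -kermx_eq0; apply/rowV0P => z /sub_kermxP; rewrite sumM => z0.
  pose c k := \sum_a z 0 a *+ (e a == k).
  have cE a : c (e a) = z 0 a.
    rewrite /c (bigD1 a) //= eqxx big1 ?addr0 // => a' aa'.
    by rewrite (inj_eq e_inj) (negbTE aa').
  have c0 : forall k, c k = 0.
    apply: indep => [k ks|].
      by rewrite /c big1 // => a _; case: eqP => // ak; rewrite -ak es in ks.
    rewrite (sum_supp (s := s)); last first.
      move=> k ks; rewrite [c k]big1 ?scale0r // => a _.
      by case: eqP => // ak; rewrite -ak es in ks.
    rewrite sume -[RHS]z0; apply: eq_bigr => a _; by rewrite cE.
  by apply/rowP => a; rewrite -cE c0 mxE.
pose b k := \sum_a (col a (invmx M))^T *+ (e a == k).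
have bE a : b (e a) = (col a (invmx M))^T.
  rewrite /b (bigD1 a) //= eqxx big1 ?addr0 // => a' aa'.
  by rewrite (inj_eq e_inj) (negbTE aa').
have dotb x a : dotp x (b (e a)) = (x *m invmx M) 0 a.
  by rewrite bE dotp_mul trmxK !mxE; apply: eq_bigr => c _; rewrite !mxE.
exists b; split.
- move=> k m /ek[a <-] /ek[a' <-]; rewrite dotb.
  have -> : realize F (v (e a)) = row a M by rewrite rowK.
  by rewrite -row_mul mulmxV // !mxE (inj_eq e_inj).
- move=> m ms; rewrite /b big1 // => a _.
  by case: eqP => // am; rewrite -am es in ms.
- move=> x; rewrite sume -{1}[x](mulmxKV Mu) sumM.
  by apply: eq_bigr => a _; rewrite dotb.
Qed.

Lemma exists_dual_basis (F : realFieldType) (n : nat) (v : 'I_n -> 'rV[int]_3)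
    (cones : {set {set 'I_n}}) :
  complete_simplicial_stacky_fan F v cones -> exists b, @dual_basis F n v cones b.
Proof.
case=> [h _ _ _].
have /fin_all_exists[b hb] : forall s : {set 'I_n}, exists b : 'I_n -> 'rV[F]_3, s \in cones ->
  [/\ forall k m, k \in s -> m \in s -> dotp (realize F (v k)) (b m) = (k == m)%:R,
      forall m, m \notin s -> b m = 0 &
      forall x, x = \sum_(k in s) dotp x (b k) *: realize F (v k)].
  move=> s; have [sc|] := boolP (s \in cones); last by exists (fun=> 0).
  by have [s3 ind] := h s sc; have [b hb] := dual_basis_cone s3 ind; exists b.
by exists b => s; exact: hb.
Qed.

Section Fan.
Variables (F : realFieldType) (n : nat) (v : 'I_n -> 'rV[int]_3) (cones : {set {set 'I_n}}).
Hypothesis fan : complete_simplicial_stacky_fan F v cones.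
Variable b : {set 'I_n} -> 'I_n -> 'rV[F]_3.
Hypothesis bP : dual_basis v cones b.

Local Notation vF k := (realize F (v k)).
Local Notation "x \inC s" := (forall k, 0 <= dotp x (b s k)) (at level 70).

Lemma card_cone s : s \in cones -> #|s| = 3.
Proof. by case: fan => h _ _ _ /h[]. Qed.

Lemma dual_in s k m : s \in cones -> k \in s -> dotp (vF k) (b s m) = (k == m)%:R.
Proof.
move=> /bP[h1 h2 _] ks; have [ms|ms] := boolP (m \in s); first exact: h1.
by rewrite h2 // dotp0r; case: eqP => // km; rewrite -km ks in ms.
Qed.

Lemma dual_out s m : s \in cones -> m \notin s -> b s m = 0.
Proof. by move=> /bP[_ h _] /h. Qed.

Lemma decomp s x : s \in cones -> x = \sum_(k in s) dotp x (b s k) *: vF k.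
Proof. by move=> /bP[_ _ h]. Qed.

Lemma dotp_decomp s x y : s \in cones ->
  dotp x y = \sum_(k in s) dotp x (b s k) * dotp (vF k) y.
Proof.
move=> sc; rewrite {1}(decomp x sc) dotp_suml.
by apply: eq_bigr => k _; rewrite dotpZl.
Qed.

Lemma dotp_sum_dual s (c : 'I_n -> F) m : s \in cones ->
  dotp (\sum_(k in s) c k *: vF k) (b s m) = if m \in s then c m else 0.
Proof.
move=> sc; rewrite dotp_suml; have [ms|ms] := ifPn.
  rewrite (bigD1 m) //= big1 ?addr0 => [|k /andP[ks km]]; rewrite dotpZl dual_in //.
    by rewrite eqxx mulr1.
  by rewrite (negbTE km) mulr0.
by rewrite big1 // => k ks; rewrite dual_out // dotp0r.
Qed.

Lemma dotp_sum_sub s (t : {set 'I_n}) m : s \in cones -> t \subset s ->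
  dotp (\sum_(k in t) vF k) (b s m) = (m \in t)%:R.
Proof.
move=> sc ts.
have -> : \sum_(k in t) vF k = \sum_(k in s) (k \in t)%:R *: vF k.
  rewrite [RHS](big_setID t) /= (setIidPr ts) [X in _ = _ + X]big1 ?addr0.
    by apply: eq_bigr => k kt; rewrite kt scale1r.
  by move=> k; rewrite inE => /andP[/negbTE-> _]; rewrite scale0r.
rewrite dotp_sum_dual //; case: ifP => // ms.
by case: (boolP (m \in t)) => // mt; move/subsetP/(_ m mt): ts; rewrite ms.
Qed.

Lemma in_cone_dual s x : s \in cones -> in_cone v s x <-> x \inC s.
Proof.
move=> sc; split=> [[c [c0 c1 ->]] m|h].
  rewrite (sum_supp (s := s)) => [|i /c1->]; last by rewrite scale0r.
  by rewrite dotp_sum_dual //; case: ifP.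
exists (fun k => dotp x (b s k)); split=> // [k ks|]; first by rewrite dual_out // dotp0r.
rewrite {1}(decomp x sc) (sum_supp (s := s)) // => k ks.
by rewrite dual_out // dotp0r scale0r.
Qed.

(** Coordinates with respect to [s] are unique, and the fan axiom provides some that are supported
    on the common face. *)
Lemma in_cone_inter s t x m : s \in cones -> t \in cones -> x \inC s -> x \inC t ->
  m \notin t -> dotp x (b s m) = 0.
Proof.
move=> sc tc /(in_cone_dual _ sc) xs /(in_cone_dual _ tc) xt mt.
case: fan => _ /(_ s t sc tc x xs xt) [c [c0 c1 ->]] _ _.
rewrite (sum_supp (s := s)) => [|i is_]; last by rewrite c1 ?scale0r // inE (negbTE is_).
by rewrite dotp_sum_dual //; case: ifP => // _; rewrite c1 // inE (negbTE mt) andbF.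
Qed.

Lemma cones_cover x : exists2 s, s \in cones & x \inC s.
Proof.
case: fan => _ _ /(_ x)[s sc xs] _; exists s => //; exact/in_cone_dual.
Qed.

Lemma cone_at i : exists2 s, s \in cones & i \in s.
Proof. by case: fan. Qed.

Lemma vF_neq0 i : vF i != 0.
Proof.
have [s sc is_] := cone_at i; apply/eqP => v0.
have := dual_in i sc is_; rewrite v0 dotp0l eqxx => /eqP; by rewrite eq_sym oner_eq0.
Qed.

Lemma eventual_cone x d : exists2 s, s \in cones & exists2 e, 0 < e &
  forall t, 0 <= t -> t <= e -> (x + t *: d) \inC s.
Proof. exact: (eventual_cover (C := mem cones) cones_cover). Qed.

Lemma cone_in s x : s \in cones -> x \inC s -> x != 0 -> exists2 k, k \in s & 0 < dotp x (b s k).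
Proof.
move=> sc xs x0; have [k /andP[ks k0]|h] := pickP (fun k => (k \in s) && (dotp x (b s k) != 0)).
  by exists k => //; rewrite lt_neqAle eq_sym k0 xs.
case/eqP: x0; rewrite (decomp x sc) big1 // => k ks.
by have := h k; rewrite ks /= => /negbFE/eqP->; rewrite scale0r.
Qed.

Lemma cone_supp s t x k : s \in cones -> t \in cones -> x \inC s -> x \inC t ->
  dotp x (b s k) != 0 -> k \in t.
Proof.
move=> sc tc xs xt; apply: contraR => kt; apply/eqP; exact: in_cone_inter xt _.
Qed.

Lemma sum_in_cone s (J : {set 'I_n}) : s \in cones -> J \subset s -> (\sum_(k in J) vF k) \inC s.
Proof. by move=> sc Js k; rewrite dotp_sum_sub. Qed.

Lemma vF_inC s i : s \in cones -> i \in s -> vF i \inC s.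
Proof. by move=> sc is_ k; rewrite dual_in. Qed.

Lemma eventual_at x s d : s \in cones -> x \inC s ->
  exists2 t, t \in cones &
  exists2 e, 0 < e & (forall k, dotp x (b s k) != 0 -> k \in t) /\
  forall r, 0 <= r -> r <= e -> (x + r *: d) \inC t.
Proof.
move=> sc xs; have [t tc [e e0 he]] := eventual_cone x d; exists t => //; exists e => //.
split=> // k k0; apply: cone_supp k0 => //.
by have := he 0 (lexx 0) (ltW e0); rewrite scale0r addr0.
Qed.

(** Otherwise [v_m] plus a large multiple of the sum over the wall would lie in both cones, although
    its coordinate at [m] is 1 in [t] and [m] is not in [s]. *)
Lemma side s t k m : s \in cones -> t \in cones -> k \in s -> k \notin t ->
  s :\ k \subset t -> m \in t -> m \notin s -> dotp (vF m) (b s k) < 0.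
Proof.
move=> sc tc ks kt st mt ms; rewrite ltNge; apply/negP => h.
pose S := \sum_(p in s) `|dotp (vF m) (b s p)|.
pose x := vF m + S *: \sum_(p in s :\ k) vF p.
have S0 : 0 <= S by apply: sumr_ge0.
have dx p : dotp x (b s p) = dotp (vF m) (b s p) + S * (p \in s :\ k)%:R.
  by rewrite !dotpE dotp_sum_sub ?subsetDl.
have xs : x \inC s.
  move=> p; rewrite dx; have [pk|pk] := boolP (p \in s :\ k).
    rewrite mulr1 addrC -[X in _ + X]opprK subr_ge0.
    have ps : p \in s by case/setD1P: pk.
    apply: le_trans (_ : `|dotp (vF m) (b s p)| <= _); last by rewrite /S (bigD1 p) //= lerDl sumr_ge0.
    by rewrite -normrN ler_norm.
  rewrite mulr0 addr0; move: pk; rewrite !inE negb_and negbK => /orP[/eqP->//|ps].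
  by rewrite dual_out // dotp0r.
have xt : x \inC t.
  by move=> p; rewrite !dotpE dotp_sum_sub // dual_in // addr_ge0 // mulr_ge0.
have := in_cone_inter tc sc xt xs ms.
rewrite !dotpE dotp_sum_sub // dual_in // eqxx.
have -> : (m \in s :\ k) = false by rewrite !inE (negbTE ms) andbF.
by rewrite mulr0 addr0 => /eqP; rewrite oner_eq0.
Qed.

Lemma wall_third s t k : s \in cones -> t \in cones -> t != s -> k \in s -> s :\ k \subset t ->
  [/\ k \notin t & exists m, [/\ m \in t, m \notin s, t :\ m = s :\ k & forall p, p \in t -> p \notin s -> p = m]].
Proof.
move=> sc tc ts ks st.
have s3 := card_cone sc; have t3 := card_cone tc.
have kt : k \notin t.
  apply/negP => kt; case/eqP: ts; apply/eqP; rewrite eq_sym eqEcard s3 t3 leqnn andbT.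
  by rewrite -(setD1K ks) subUset sub1set kt.
have cD : #|s :\ k| = 2 by have := cardsD1 k s; rewrite ks s3; case.
have : #|t :\: (s :\ k)| == 1%N by rewrite cardsD (setIidPr st) t3 cD.
case/cards1P => m hm.
have mt : m \in t /\ m \notin s :\ k by apply/setDP; rewrite hm set11.
have ms : m \notin s.
  by apply/negP => ms; case: mt => mt; rewrite !inE ms andbT negbK => /eqP mk; rewrite -mk mt in kt.
split=> //; exists m; split; [by case: mt|by []| |].
  have : [set m] = t :\: (s :\ k) by [].
  move=> /setP e; apply/setP => p; have := e p; rewrite !inE.
  have [->|pm] := eqVneq p m; first by rewrite (negbTE ms) andbF.
  move=> /esym; have [pk|/= pk] := boolP ((p != k) && (p \in s)).
    by move/subsetP/(_ p): st; rewrite !inE pk => ->.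
  by [].
move=> p pt ps; apply/set1P; by rewrite -hm !inE pt (negbTE ps) andbF.
Qed.

(** Leaving the middle of the wall in direction [- v_k] gives [t]. If there were a third cone, its
    extra generator would be negative with respect to [s] at [k] and with respect to [t] at [m]; but
    the latter coordinate is the product of the former with that of [v_k] in [t], and a product of
    two negatives is positive. *)
Lemma opposite s k : s \in cones -> k \in s -> exists t,
  [/\ t \in cones, t != s, s :\ k \subset t &
      forall t', t' \in cones -> s :\ k \subset t' -> t' = s \/ t' = t].
Proof.
move=> sc ks.
have [t tc [e e0 [hk he]]] := eventual_at (- vF k) sc (sum_in_cone sc (subsetDl s [set k])).
have st : s :\ k \subset t.
  by apply/subsetP => p pk; apply: hk; rewrite dotp_sum_sub ?subsetDl // pk oner_eq0.
have ts : t != s.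
  apply/eqP => ts; have := he e (ltW e0) (lexx e) k.
  rewrite ts !dotpE dotp_sum_sub ?subsetDl // dual_in // setD11 eqxx mulrN1 add0r oppr_ge0.
  by rewrite leNgt e0.
exists t; split=> // t' t'c st'.
have [|t's] := eqVneq t' s; first by left.
have [|t't] := eqVneq t' t; [by right|exfalso].
have [kt [m [mt ms tm _]]] := wall_third sc tc ts ks st.
have [kt' [m' [m't' m's tm' _]]] := wall_third sc t'c t's ks st'.
have s1 := side sc tc ks kt st mt ms.
have s2 := side sc t'c ks kt' st' m't' m's.
have stm : t :\ m \subset t' by rewrite tm.
have [mt' [q [qt' qt qm _]]] := wall_third tc t'c t't mt stm.
have qm' : q = m'.
  apply/eqP; move: qt'; rewrite -(setD1K m't') tm' !inE => /orP[//|qk].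
  by move/subsetP/(_ q): st; rewrite !inE qk (negbTE qt) => /(_ isT).
have s3 : dotp (vF q) (b t m) < 0.
  by apply: side tc t'c mt mt' _ qt' qt; rewrite tm.
have s4 : dotp (vF k) (b t m) < 0.
  by apply: side tc sc mt ms _ ks kt; rewrite tm subsetDl.
have := dotp_decomp (vF q) (b t m) sc; rewrite (bigD1 k) //= big1 => [|p /andP[ps pk]].
  by rewrite addr0 => e1; have := nmulr_rgt0 (dotp (vF k) (b t m)) s2; rewrite -qm' -e1 s4 ltNge (ltW s3).
have : p \in t :\ m by rewrite tm !inE pk.
by case/setD1P => pm pt; rewrite (dual_in _ tc pt) (negbTE pm) mulr0.
Qed.

End Fan.

Section Fan2.
Variables (F : realFieldType) (n : nat) (v : 'I_n -> 'rV[int]_3) (cones : {set {set 'I_n}}).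
Hypothesis fan : complete_simplicial_stacky_fan F v cones.
Variable b : {set 'I_n} -> 'I_n -> 'rV[F]_3.
Hypothesis bP : dual_basis v cones b.

Local Notation vF k := (realize F (v k)).
Local Notation "x \inC s" := (forall k, 0 <= dotp x (b s k)) (at level 70).

Lemma cone_thirds s k p : s \in cones -> k \in s -> p \in s -> k != p ->
  exists i, [/\ i \in s, i != k, i != p & s = [set i; k; p]].
Proof.
move=> sc ks ps kp; have s3 := card_cone fan sc.
have : #|s :\: [set k; p]| == 1%N.
  rewrite cardsD (setIidPr _) ?s3 ?cards2 ?kp //.
  by apply/subsetP => q; rewrite !inE => /orP[]/eqP->.
case/cards1P => i hi.
have : i \in s :\: [set k; p] by rewrite hi set11.
rewrite !inE negb_or -andbA => /and3P[ik ip is_]; exists i; split=> //.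
apply/setP => q; move/setP/(_ q): hi; rewrite !inE.
case: (eqVneq q k) => [->|_] /=; first by rewrite ks orbT.
case: (eqVneq q p) => [->|_] /=; first by rewrite ps orbT.
by rewrite !orbF.
Qed.

Lemma cone_ray s k p z : s \in cones -> k \in s -> p \in s -> k != p ->
  dotp z (b s k) = 0 -> dotp z (b s p) = 0 ->
  exists i, [/\ i \in s, i != k, i != p & z = dotp z (b s i) *: vF i].
Proof.
move=> sc ks ps kp zk zp; have [i [is_ ik ip se]] := cone_thirds sc ks ps kp.
exists i; split=> //; rewrite {1}(decomp bP z sc) (bigD1 i) //= big1 ?addr0 // => q.
by rewrite se !inE => /andP[/orP[/orP[->|/eqP->]|/eqP->] //]; rewrite -?se ?zk ?zp ?scale0r.
Qed.

(** The planes are avoided one at a time: a point lying on the next plane is pushed off along a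
    generator of [s] outside this plane, too little to return to an earlier one. *)
Lemma generic_point (I : finType) (h : I -> 'rV[F]_3) s : s \in cones -> (forall i, h i != 0) ->
  exists x, (forall k, k \in s -> 0 < dotp x (b s k)) /\ forall i, dotp x (h i) != 0.
Proof.
move=> sc h0.
suff [x [xs xr]] : exists x, (forall k, k \in s -> 0 < dotp x (b s k)) /\
    forall i, i \in enum I -> dotp x (h i) != 0.
  by exists x; split=> // i; apply: xr; rewrite mem_enum.
elim: (enum I) => [|i r [x [xs xr]]].
  exists (\sum_(k in s) vF k); split=> // k ks.
  by rewrite (dotp_sum_sub bP) // ks ltr01.
have [xi|xi] := eqVneq (dotp x (h i)) 0; last first.
  by exists x; split=> // j; rewrite inE => /orP[/eqP->//|/xr].
have [k /andP[ks kh]|kh] := pickP (fun k => (k \in s) && (dotp (vF k) (h i) != 0)); last first.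
  case/eqP: (h0 i); apply: dotp_eq0 => y; rewrite (dotp_decomp bP _ _ sc) big1 // => k ks.
  by have := kh k; rewrite ks /= => /negbFE/eqP->; rewrite mulr0.
have [e e0 he] := small_step (fun j => dotp x (h j)) (fun j => dotp (vF k) (h j)).
exists (x + e *: vF k); split=> [q qs|j].
  by rewrite !dotpE ltr_pwDl ?xs // mulr_ge0 ?(ltW e0) // (vF_inC bP).
rewrite inE dotpDl dotpZl => /orP[/eqP->|jr]; first by rewrite xi add0r mulf_neq0 // gt_eqF.
by rewrite -sgr_eq0 he ?sgr_eq0 ?xr // ltW.
Qed.

(** The point [x] is chosen off every ray, then [y] off planes containing [x] and each ray. The
    segment between them misses all rays, so consecutive cones along it share a wall. *)
Lemma dual_connected (Q : pred {set 'I_n}) :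
  (forall s t k, s \in cones -> t \in cones -> t != s -> k \in s -> s :\ k \subset t -> Q s -> Q t) ->
  forall s t, s \in cones -> t \in cones -> Q s -> Q t.
Proof.
move=> tr s t sc tc Qs.
have /fin_all_exists[g hg] : forall i, exists g : 'rV[F]_3, g != 0 /\ dotp (vF i) g = 0.
  by move=> i; have [g [g0 gi _]] := perp2 (vF i) 0; exists g.
have [x [xs xg]] := generic_point sc (fun i => proj1 (hg i)).
have /fin_all_exists[h hh] : forall i, exists h : 'rV[F]_3, [/\ h != 0, dotp x h = 0 & dotp (vF i) h = 0].
  by move=> i; apply: perp2.
have h0 i : h i != 0 by case: (hh i).
have [y [yt yh]] := generic_point tc h0.
apply: (path_cover (cones_cover fan bP) (Q := Q) (x := x) (d := y - x) _ sc Qs _ tc); last first.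
- move=> k; rewrite addrC subrK; have [/yt/ltW//|kt] := boolP (k \in t).
  by rewrite (dual_out bP) // dotp0r.
- move=> k; have [/xs/ltW//|ks] := boolP (k \in s).
  by rewrite (dual_out bP) // dotp0r.
move=> r u u' r0 r1 uc u'c zu zu' Qu.
have [<- //|uu'] := eqVneq u u'.
have /subsetPn[k ku ku'] : ~~ (u \subset u').
  apply: contra uu' => uu'; by rewrite eqEcard uu' !(card_cone fan).
have [sub|/subsetPn[p]] := boolP (u :\ k \subset u').
  by apply: tr sub Qu => //; rewrite eq_sym.
case/setD1P => pk pu pu'.
have zk := in_cone_inter fan bP uc u'c zu zu' ku'.
have zp := in_cone_inter fan bP uc u'c zu zu' pu'.
have kp : k != p by rewrite eq_sym.
have [i [iu _ _ zi]] := cone_ray uc ku pu kp zk zp.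
have [_ hx hi] := hh i.
have : dotp (x + r *: (y - x)) (h i) = 0 by rewrite zi dotpZl hi mulr0.
rewrite !dotpE hx oppr0 addr0 add0r => /eqP; rewrite mulf_eq0 (negbTE (yh i)) orbF => /eqP r00.
have := xg i; move: zi; rewrite r00 scale0r addr0 => ->.
by rewrite dotpZl (proj2 (hg i)) mulr0 eqxx.
Qed.

(** * The link of a vertex as a fan modulo the line of [v_i] *)

Section Link.
Variable i : 'I_n.

(** A large multiple of [v_i] added to [v_m] moves it into both cones, so [m] belongs to [s]; its
    coordinates there leave only [j]. *)
Lemma link_ray_inj s t j m (al be : F) : s \in cones -> t \in cones ->
  i \in s -> i \in t -> j \in s -> m \in t -> m != i ->
  vF m = al *: vF i + be *: vF j -> 0 < be -> m = j.
Proof.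
move=> sc tc is_ it js mt mi e be0.
pose S := `|al|.
pose x := vF m + S *: vF i.
have S0 : 0 <= S by apply: normr_ge0.
have alS : 0 <= al + S.
  by rewrite addrC -[X in _ + X]opprK subr_ge0 /S -normrN ler_norm.
have xt : x \inC t.
  by move=> p; rewrite !dotpE addr_ge0 ?mulr_ge0 ?(vF_inC bP).
have xs : x \inC s.
  move=> p; rewrite /x e !dotpE addrAC -mulrDl.
  by rewrite addr_ge0 ?mulr_ge0 ?(vF_inC bP) // ltW.
have ms : m \in s.
  apply: (cone_supp fan bP tc sc xt xs).
  by rewrite !dotpE !(dual_in bP) // eqxx [i == m]eq_sym (negbTE mi) mulr0 addr0 oner_eq0.
have := dual_in bP m sc ms; rewrite {1}e !dotpE !(dual_in bP) // eqxx [i == m]eq_sym (negbTE mi) mulr0 add0r.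
by case: eqP => [//|_] /eqP; rewrite mulr0 eq_sym oner_eq0.
Qed.

(** Dropping the coordinate at [i] describes the image of the cone modulo [v_i]; these images form
    the complete fan of the star of [i]. *)
Definition link_dual (s : {set 'I_n}) k : 'rV[F]_3 := if k == i then 0 else b s k.

Lemma link_cover x : exists2 s, (s \in cones) && (i \in s) & forall k, 0 <= dotp x (link_dual s k).
Proof.
have [s sc is_] := cone_at fan i.
have [t tc [e e0 [hk he]]] := eventual_at fan bP x sc (vF_inC bP sc is_).
have it : i \in t by apply: hk; rewrite (dual_in bP) // eqxx oner_eq0.
exists t; rewrite ?tc // /link_dual => k; case: eqP => [_|/eqP ki]; first by rewrite dotp0r.
have := he e (ltW e0) (lexx e) k.
by rewrite !dotpE (dual_in bP) // eq_sym (negbTE ki) add0r pmulr_rge0.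
Qed.

Lemma link_inter s t z p : s \in cones -> t \in cones -> i \in s -> i \in t ->
  (forall k, 0 <= dotp z (link_dual s k)) -> (forall k, 0 <= dotp z (link_dual t k)) ->
  p \notin t -> dotp z (b s p) = 0.
Proof.
move=> sc tc is_ it zs zt pt.
pose S := `|dotp z (b s i)| + `|dotp z (b t i)|.
have key u : u \in cones -> i \in u -> (forall k, 0 <= dotp z (link_dual u k)) ->
    `|dotp z (b u i)| <= S -> (z + S *: vF i) \inC u.
  move=> uc iu zu iS k; rewrite !dotpE (dual_in bP) // eq_sym; have [->|ki] := eqVneq k i.
    rewrite mulr1 addrC -[X in _ + X]opprK subr_ge0.
    by apply: le_trans iS; rewrite -normrN ler_norm.
  by rewrite mulr0 addr0; have := zu k; rewrite /link_dual (negbTE ki).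
have xs : (z + S *: vF i) \inC s by apply: key => //; rewrite /S lerDl.
have xt : (z + S *: vF i) \inC t by apply: key => //; rewrite /S lerDr.
have := in_cone_inter fan bP sc tc xs xt pt.
rewrite !dotpE (dual_in bP) //; case: eqP => [ip|_]; first by rewrite -ip it in pt.
by rewrite mulr0 addr0.
Qed.

Lemma link_connected (Q : pred {set 'I_n}) :
  (forall s t k, s \in cones -> t \in cones -> i \in s -> i \in t -> t != s ->
     k \in s -> k != i -> s :\ k \subset t -> Q s -> Q t) ->
  forall s t, s \in cones -> t \in cones -> i \in s -> i \in t -> Q s -> Q t.
Proof.
move=> tr s t sc tc is_ it Qs.
have [m mt mi] : exists2 m, m \in t & m != i.
  have : (0 < #|t :\ i|)%N by have := cardsD1 i t; rewrite it (card_cone fan tc); case: #|t :\ i|.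
  by case/card_gt0P => m /setD1P[]; exists m.
have vmi c : vF m <> c *: vF i.
  move=> e; have := dual_in bP m tc mt; rewrite e dotpZl (dual_in bP) // eqxx eq_sym (negbTE mi) mulr0.
  by move=> /eqP; rewrite eq_sym oner_eq0.
(* The path from [v_j] to [v_m] has to miss the line of [v_i]. With [j] the generator of [s] other
   than [i] and [k], its coordinate at [k] vanishes at the start only, where the point is [v_j]. *)
have [k [ks ki mk]] : exists k, [/\ k \in s, k != i & dotp (vF m) (b s k) != 0].
  have [k /and3P[ks ki kh]|kh] := pickP (fun k => [&& k \in s, k != i & dotp (vF m) (b s k) != 0]).
    by exists k.
  case: (vmi (dotp (vF m) (b s i))); rewrite {1}(decomp bP (vF m) sc) (bigD1 i) //= big1 ?addr0 // => k /andP[ks ki].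
  by have := kh k; rewrite ks ki /= => /negbFE/eqP->; rewrite scale0r.
have [j [js jk ji se]] := cone_thirds sc ks is_ ki.
have cs : (s \in cones) && (i \in s) by rewrite sc.
have ct : (t \in cones) && (i \in t) by rewrite tc.
apply: (path_cover link_cover (Q := Q) (x := vF j) (d := vF m - vF j) _ cs Qs _ ct); last first.
- move=> q; rewrite addrC subrK /link_dual; case: eqP => _; rewrite ?dotp0r //.
  exact: (vF_inC bP).
- move=> q; rewrite /link_dual; case: eqP => _; rewrite ?dotp0r //; exact: (vF_inC bP).
move=> r u u' r0 r1 /andP[uc iu] /andP[u'c iu'] zu zu' Qu.
have [<- //|uu'] := eqVneq u u'.
have /subsetPn[q qu qu'] : ~~ (u \subset u').
  apply: contra uu' => uu'; by rewrite eqEcard uu' !(card_cone fan).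
have qi : q != i by apply: contra qu' => /eqP->.
have [sub|/subsetPn[p]] := boolP (u :\ q \subset u').
  by apply: tr sub Qu => //; rewrite eq_sym.
case/setD1P => pq pu pu'.
have zq := link_inter uc u'c iu iu' zu zu' qu'.
have zp := link_inter uc u'c iu iu' zu zu' pu'.
have qp : q != p by rewrite eq_sym.
have [i' [i'u i'q i'p zi]] := cone_ray uc qu pu qp zq zp.
have ii' : i' = i.
  have [i2 [_ _ _ ue]] := cone_thirds uc qu pu qp.
  have pi : p != i by apply: contra pu' => /eqP->.
  move: i'u iu; rewrite ue !inE (negbTE i'q) (negbTE i'p) ![i == _]eq_sym (negbTE qi) (negbTE pi) !orbF.
  by move=> /eqP-> /eqP->.
move: zi; rewrite ii' => zi.
have : dotp (vF j + r *: (vF m - vF j)) (b s k) = 0.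
  by rewrite zi dotpZl (dual_in bP) // eq_sym (negbTE ki) mulr0.
rewrite !dotpE (dual_in bP) // (negbTE jk) subr0 add0r => /eqP; rewrite mulf_eq0 (negbTE mk) orbF => /eqP r00.
have := dual_in bP j sc js; move: zi; rewrite r00 scale0r addr0 => ->.
rewrite dotpZl (dual_in bP j sc is_) eqxx eq_sym (negbTE ji) mulr0 => /eqP; by rewrite eq_sym oner_eq0.
Qed.

End Link.

End Fan2.

(** * Euler characteristics of induced subcomplexes *)

Definition faceset (n : nat) (cones : {set {set 'I_n}}) : {set {set 'I_n}} :=
  [set J : {set 'I_n} | [exists s in cones, J \subset s]].

(** Minus the reduced Euler characteristic of the subcomplex induced on [X], since the empty face
    contributes 1. *)
Definition echi (n : nat) (cones : {set {set 'I_n}}) (X : {set 'I_n}) : int :=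
  \sum_(J in faceset cones | J \subset X) (-1) ^+ #|J|.

(** The number of sign changes met when going once around the link of [i]: each cone at [i] is one
    edge of the link. *)
Definition mixed (n : nat) (cones : {set {set 'I_n}}) (i : 'I_n) (A : {set 'I_n}) : nat :=
  (\sum_(s in cones | i \in s) (#|(s :\ i) :&: A| == 1))%N.

Lemma card_pairs (T : finType) (i : T) (B : {set T}) : i \notin B ->
  #|[set J : {set T} | [&& #|J| == 2, i \in J & J \subset i |: B]]| = #|B|.
Proof.
move=> iB; rewrite -(card_in_imset (f := fun j => [set i; j]) (D := B)) => [|j k jB kB /setP e].
  apply: eq_card => J; rewrite inE; apply/and3P/imsetP => [[/cards2P[x [y [xy ->]]]]|[j jB ->]].
    rewrite !inE => /orP[]/eqP ei; rewrite -{}ei subUset !sub1set !inE in xy *.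
      rewrite [y == i]eq_sym (negbTE xy) => /andP[_ yB]; by exists y.
    by rewrite (negbTE xy) => /andP[/= xB _]; exists x => //; rewrite setUC.
  have ij : i != j by apply: contra iB => /eqP->.
  by rewrite cards2 ij !inE eqxx setUS // sub1set.
have := e j; rewrite !inE eqxx orbT => /esym/orP[]/eqP // ji; by rewrite -ji jB in iB.
Qed.

Section Fan3.
Variables (F : realFieldType) (n : nat) (v : 'I_n -> 'rV[int]_3) (cones : {set {set 'I_n}}).
Hypothesis fan : complete_simplicial_stacky_fan F v cones.
Variable b : {set 'I_n} -> 'I_n -> 'rV[F]_3.
Hypothesis bP : dual_basis v cones b.

Lemma facesetP (J : {set 'I_n}) : reflect (exists2 s, s \in cones & J \subset s) (J \in faceset cones).
Proof. by rewrite inE; apply: (iffP exists_inP). Qed.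

Lemma faceset3 (J : {set 'I_n}) : (J \in faceset cones) && (#|J| == 3) = (J \in cones).
Proof.
apply/andP/idP => [[/facesetP[s sc Js] /eqP J3]|Jc].
  by have -> : J = s by apply/eqP; rewrite eqEcard Js J3 (card_cone fan).
split; last by rewrite (card_cone fan).
by apply/facesetP; exists J.
Qed.

Lemma card_face_le (J : {set 'I_n}) : J \in faceset cones -> (#|J| <= 3)%N.
Proof. by case/facesetP => s sc /subset_leq_card; rewrite (card_cone fan sc). Qed.

Lemma wall_two (J : {set 'I_n}) : J \in faceset cones -> #|J| = 2 ->
  (\sum_(s in cones | J \subset s) 1 = 2)%N.
Proof.
case/facesetP => s sc Js J2.
have : #|s :\: J| == 1%N by rewrite cardsD (setIidPr Js) (card_cone fan sc) J2.
case/cards1P => k hk.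
have [ks kJ] : k \in s /\ k \notin J by apply/setDP; rewrite hk set11.
have sk : s :\ k = J.
  apply/setP => p; move/setP/(_ p): hk; rewrite !inE.
  have [->|pk] := eqVneq p k; first by rewrite ?(negbTE kJ).
  have [pJ|pJ] /= := boolP (p \in J); first by rewrite (subsetP Js).
  by [].
have [t [tc ts st ut]] := opposite fan bP sc ks.
rewrite sk in st ut.
rewrite (bigD1 s) ?sc //= (bigD1 t) ?tc ?st ?ts //= big1 // => u.
by case/andP => /andP[/andP[uc Ju] us] ut'; case: (ut u uc Ju) => e; rewrite e eqxx in us ut'.
Qed.

Lemma mixedE i (A : {set 'I_n}) : i \notin A -> (\sum_(s in cones | i \in s) #|(s :\ i) :&: A| =
  mixed cones i A + 2 * \sum_(s in cones | i \in s) (s :\ i \subset A))%N.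
Proof.
move=> iA; rewrite /mixed big_distrr /= -big_split /=; apply: eq_bigr => s /andP[sc is_].
have s2 : #|s :\ i| = 2.
  by have := cardsD1 i s; rewrite is_ (card_cone fan sc); lia.
have := subset_leq_card (subsetIl (s :\ i) A); rewrite s2.
have <- : (#|(s :\ i) :&: A| == 2) = (s :\ i \subset A).
  by rewrite -s2; apply/eqP/setIidPl => [/eqP h|->//]; apply/eqP; rewrite eqEcard subsetIl leq_eqVlt eq_sym h.
by case: #|_| => [|[|[]]].
Qed.

(** The faces of the difference contain [i] and are counted by the empty face, the [V] vertices
    ([e2]) and the [E] edges ([e3]) of the link inside [A]; hence [V - E = 1]. Every link vertex has
    two edges, so [2 V = mixed + 2 E]. *)
Lemma mixed_echi i (A : {set 'I_n}) : i \notin A -> echi cones A = 0 -> echi cones (i |: A) = 0 -> mixed cones i A = 2%N.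
Proof.
move=> iA eA; rewrite /echi (bigID (fun J : {set 'I_n} => i \in J)) /=.
rewrite [X in _ + X = _](_ : _ = 0) ?addr0; last first.
  rewrite -[RHS]eA; apply: eq_bigl => J; rewrite -!andbA; congr (_ && _).
  apply/andP/idP => [[/subsetP JA iJ]|JA].
    by apply/subsetP => j jJ; have := JA j jJ; rewrite !inE => /orP[/eqP e|//]; rewrite -e jJ in iJ.
  split; first exact: subset_trans JA (subsetUr _ _).
  by apply: contra iA => /(subsetP JA).
rewrite (bigID (fun J : {set 'I_n} => #|J| == 1%N)) /= (bigD1 [set i]) /=; last first.
  have [s sc is_] := cone_at fan i.
  rewrite cards1 eqxx set11 subsetUl !andbT; apply/facesetP; by exists s; rewrite // sub1set.
rewrite big1 ?addr0 => [|J]; last first.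
  by case/andP => /andP[/andP[_ iJ] /cards1P[x e]] Ji; move: iJ Ji; rewrite e inE => /eqP->; rewrite eqxx.
rewrite cards1 expr1 (bigID (fun J : {set 'I_n} => #|J| == 2%N)) /=.
set X2 := \sum_(_ | _) _; set X3 := \sum_(_ | _) _ => e.
pose e2 := #|[set J in faceset cones | [&& #|J| == 2, i \in J & J \subset i |: A]]|.
pose e3 := (\sum_(s in cones | i \in s) (s :\ i \subset A))%N.
have X2E : X2 = e2%:Z.
  rewrite /X2 (eq_bigr (fun=> 1)) => [|J /andP[_ /eqP->]]; last by rewrite expr2 mulN1r opprK.
  rewrite sumr_const -[RHS]natz; congr (_ *+ _); apply: eq_card => J; rewrite [in RHS]inE [LHS]/in_mem /=.
  by case: (J \in _) => //=; case: (#|J| == 2) / eqP => [->|_]; rewrite ?andbF //= ?andbT andbC.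
have X3E : X3 = - e3%:Z.
  rewrite /X3 -[X in _ = - X]natz natr_sum -sumrN big_mkcond [RHS]big_mkcond /=.
  apply: eq_bigr => J _; rewrite -faceset3.
  have [Jf|] //= := boolP (J \in _); have [iJ|] //= := boolP (i \in J); rewrite ?andbF // !andbT.
  have sub : (J \subset i |: A) = (J :\ i \subset A) by rewrite subDset.
  rewrite sub; have := card_face_le Jf.
  have : (0 < #|J|)%N by apply/card_gt0P; exists i.
  case cJ : #|J| => [|[|[|[]]]] //= _ _; rewrite ?andbF ?andbT //.
  by case: ifP => _; rewrite ?oppr0 // -signr_odd.
have e23 : (2 * e2 = mixed cones i A + 2 * e3)%N.
  rewrite -mixedE // mulnC -sum_nat_const.
  rewrite (eq_bigr (fun J : {set 'I_n} => \sum_(s in cones | J \subset s) 1)%N); last first.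
    by move=> J; rewrite inE => /and3P[Jf /eqP J2 _]; rewrite wall_two.
  rewrite (exchange_big_dep (fun s => (s \in cones) && (i \in s))) /=; last first.
    by move=> J s; rewrite inE => /and4P[_ _ iJ _] /andP[-> /subsetP/(_ i iJ)].
  apply: eq_bigr => s /andP[sc is_]; rewrite sum1_card -(card_pairs (i := i)); last by rewrite !inE eqxx.
  apply: eq_card => J; rewrite [in RHS]inE [LHS]/in_mem /= inE sc /=.
  case: (#|J| == 2); rewrite ?andbF //=; have [iJ|] /= := boolP (i \in J); rewrite ?andbF //=.
  have -> : i |: ((s :\ i) :&: A) = s :&: (i |: A).
    by rewrite setUIr setD1K.
  rewrite subsetI andbC; have [Js|//] /= := boolP (J \subset s).
  by rewrite (_ : J \in faceset cones) //; apply/facesetP; exists s.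
move: e; rewrite X2E X3E; lia.
Qed.

End Fan3.

(** * Walls, and sign changes around a vertex *)

Definition wall (n : nat) (cones : {set {set 'I_n}}) (i j k k' : 'I_n) :=
  [/\ [set i; j; k] \in cones, [set i; j; k'] \in cones & uniq [:: i; j; k; k']].

Definition link (n : nat) (cones : {set {set 'I_n}}) (i m : 'I_n) : bool :=
  (m != i) && [exists s in cones, (i \in s) && (m \in s)].

(** No other generator on the line of [v_i], in either direction: what makes it possible to isolate
    the sign at [i] from all others. *)
Definition ordinary (n : nat) (v : 'I_n -> 'rV[int]_3) (i : 'I_n) :=
  forall m, m != i -> forall c : rat, realize rat (v m) != c *: realize rat (v i).

Section Wall.
Variables (F : realFieldType) (n : nat) (v : 'I_n -> 'rV[int]_3) (cones : {set {set 'I_n}}).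
Hypothesis fan : complete_simplicial_stacky_fan F v cones.
Variable b : {set 'I_n} -> 'I_n -> 'rV[F]_3.
Hypothesis bP : dual_basis v cones b.

Local Notation vF k := (realize F (v k)).

Lemma linkP i m : reflect (m != i /\ exists s, [/\ s \in cones, i \in s & m \in s]) (link cones i m).
Proof.
apply: (iffP andP) => [[mi /exists_inP[s sc /andP[is_ ms]]]|[mi [s [sc is_ ms]]]].
  by split=> //; exists s.
by split=> //; apply/exists_inP; exists s; rewrite ?is_.
Qed.

Lemma wallC i j k k' : wall cones i j k k' -> wall cones i j k' k.
Proof. by case=> h1 h2 u; split=> //; move: u; rewrite /= !inE (eq_sym k' k); do !case: eqP. Qed.

Lemma wallCl i j k k' : wall cones i j k k' -> wall cones j i k k'.
Proof.
by case=> h1 h2 u; split; rewrite 1?(setUC [set j] [set i]) //; move: u; rewrite /= !inE (eq_sym j i); do !case: eqP.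
Qed.

Lemma cone_wall s i j : s \in cones -> i \in s -> j \in s -> i != j ->
  exists k k', wall cones i j k k' /\ s = [set i; j; k].
Proof.
move=> sc is_ js ij; have [k [ks ki kj se]] := cone_thirds fan sc is_ js ij.
have {}se : s = [set i; j; k] by rewrite se -setUA setUC.
have [t [tc ts st _]] := opposite fan bP sc ks.
have [kt [m [mt ms tm _]]] := wall_third fan sc tc ts ks st.
exists k, m; split=> //.
have te : t = [set i; j; m].
  have -> : t = m |: (s :\ k) by rewrite -tm setD1K.
  have -> : s :\ k = [set i; j].
    by rewrite se setUC setU1K // !inE negb_or ki.
  by rewrite setUC.
split; rewrite -?se -?te //=.
move: ms; rewrite se !inE !negb_or -andbA => /and3P[mi mj mk].
by rewrite ij /= (eq_sym i k) (eq_sym j k) (eq_sym i m) (eq_sym j m) (eq_sym k m) ki kj mi mj mk.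
Qed.

Lemma wall_cones i j k k' u : wall cones i j k k' -> u \in cones -> i \in u -> j \in u ->
  u = [set i; j; k] \/ u = [set i; j; k'].
Proof.
case=> sc tc; rewrite /= !inE !negb_or andbT => /and3P[/and3P[ij ik ik'] /andP[jk jk'] kk'] uc iu ju.
have J2 : #|[set i; j]| = 2 by rewrite cards2 ij.
have Jf : [set i; j] \in faceset cones by apply/facesetP; exists [set i; j; k] => //; apply: subsetUl.
have := wall_two fan bP Jf J2.
rewrite (bigD1 [set i; j; k]) ?sc ?subsetUl //= (bigD1 [set i; j; k']) ?tc ?subsetUl //=; last first.
  by apply/eqP => /setP/(_ k'); rewrite !inE eqxx orbT ![k' == _]eq_sym (negbTE ik') (negbTE jk') (negbTE kk').
have [->|us] := eqVneq u [set i; j; k]; first by left.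
have [->|ut] := eqVneq u [set i; j; k']; first by right.
rewrite (bigD1 u) ?uc ?subUset ?sub1set ?iu ?ju ?us ?ut //=; lia.
Qed.

Lemma wall_side i j k k' : wall cones i j k k' -> dotp (vF k') (b [set i; j; k] k) < 0.
Proof.
case=> sc tc; rewrite /= !inE !negb_or andbT => /and3P[/and3P[ij ik ik'] /andP[jk jk'] kk'].
apply: (side fan bP sc tc); rewrite ?inE ?eqxx ?orbT //.
- by rewrite !negb_or ![k == _]eq_sym ik jk eq_sym.
- apply/subsetP => p; rewrite !inE => /andP[/negbTE->]; by rewrite orbF => ->.
- by rewrite !negb_or ![k' == _]eq_sym ik' jk' kk'.
Qed.

Lemma card_link2 s i j k (A : {set 'I_n}) : s = [set i; j; k] -> uniq [:: i; j; k] ->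
  #|(s :\ i) :&: A| = ((j \in A) + (k \in A))%N.
Proof.
move=> ->; rewrite /= !inE negb_or andbT => /andP[/andP[ij ik] jk].
have -> : [set i; j; k] :\ i = [set j; k].
  apply/setP => p; rewrite !inE; have [->|//] := eqVneq p i.
  by rewrite (negbTE ij) (negbTE ik).
have -> : #|[set j; k] :&: A| = (\sum_(x in [set j; k]) (x \in A))%N.
  by rewrite -sum1_card big_mkcond [RHS]big_mkcond; apply: eq_bigr => x _; rewrite !inE; case: (_ || _); case: (x \in A).
by rewrite big_setU1 ?inE //= big_set1.
Qed.

End Wall.

Section Mixed.
Variables (F : realFieldType) (n : nat) (v : 'I_n -> 'rV[int]_3) (cones : {set {set 'I_n}}).
Hypothesis fan : complete_simplicial_stacky_fan F v cones.
Variable b : {set 'I_n} -> 'I_n -> 'rV[F]_3.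
Hypothesis bP : dual_basis v cones b.
Implicit Types A B : {set 'I_n}.

Lemma mixed_congr i A B : (forall m, link cones i m -> (m \in A) = (m \in B)) ->
  mixed cones i A = mixed cones i B.
Proof.
move=> AB; apply: eq_bigr => s /andP[sc is_]; congr (nat_of_bool (_ == _)).
apply: eq_card => m; rewrite !inE; have [->|mi] //= := eqVneq m i.
have [ms|//] /= := boolP (m \in s); apply: AB.
by apply/linkP; split=> //; exists s.
Qed.

(** Only the link edges from [j] to [k] and to [k'] are affected; each becomes mixed or ceases to be
    so according to its other end. The terms are arranged to avoid subtraction in [nat]. *)
Lemma mixed_flip i j k k' A : wall cones i j k k' -> j \notin A ->
  (mixed cones i (j |: A) + 2 * (k \in A) + 2 * (k' \in A) = mixed cones i A + 2)%N.
Proof.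
move=> w jA; have [sc tc u] := w.
move: u; rewrite /= !inE !negb_or andbT => /and3P[/and3P[ij ik ik'] /andP[jk jk'] kk'].
have st : [set i; j; k'] != [set i; j; k].
  apply/eqP => /setP/(_ k'); rewrite !inE eqxx orbT (eq_sym k' i) (eq_sym k' j) (eq_sym k' k).
  by rewrite (negbTE ik') (negbTE jk') (negbTE kk').
have us : uniq [:: i; j; k] by rewrite /= !inE negb_or ij ik jk.
have ut : uniq [:: i; j; k'] by rewrite /= !inE negb_or ij ik' jk'.
have is_ : i \in [set i; j; k] by rewrite !inE eqxx.
have it : i \in [set i; j; k'] by rewrite !inE eqxx.
have kj : (k == j) = false by rewrite eq_sym (negbTE jk).
have k'j : (k' == j) = false by rewrite eq_sym (negbTE jk').
rewrite /mixed (bigD1 [set i; j; k]) ?sc //= (bigD1 [set i; j; k']) ?tc ?it //=.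
rewrite [X in _ = (X + _)%N](bigD1 [set i; j; k]) ?sc //= [X in _ = (_ + X + _)%N](bigD1 [set i; j; k']) ?tc ?it //=.
rewrite !(card_link2 _ (erefl [set i; j; k]) us) !(card_link2 _ (erefl [set i; j; k']) ut).
rewrite !inE eqxx (negbTE jA) kj k'j /=.
rewrite [X in (_ + (_ + X) + _ + _)%N](_ : _ = \sum_(i0 in cones | [&& i \in i0, i0 != [set i; j; k] & i0 != [set i; j; k']])
   (#|(i0 :\ i) :&: A| == 1))%N; last first.
  apply: eq_big => [s|s /andP[/andP[/andP[sc' is'] s1] s2]]; first by rewrite !andbA.
  congr (nat_of_bool (_ == _)); apply: eq_card => m; rewrite !inE.
  have [->|//] := eqVneq m j; have [js|//] := boolP (j \in s); last by rewrite !andbF.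
  by case: (wall_cones fan bP w sc' is' js) => e; rewrite e eqxx in s1 s2.
rewrite [X in _ = (_ + (_ + X) + _)%N](_ : _ = \sum_(i0 in cones | [&& i \in i0, i0 != [set i; j; k] & i0 != [set i; j; k']])
   (#|(i0 :\ i) :&: A| == 1))%N; last by apply: eq_bigl => s; rewrite !andbA.
move: (\sum_(_ in _ | _) _)%N (k \in A) (k' \in A); clear => S [] [] /=; lia.
Qed.

(** Without mixed edges membership in [A] is constant along each edge, and the link is connected. *)
Lemma mixed0 i A j m : mixed cones i A = 0%N -> link cones i j -> link cones i m -> j \in A -> m \in A.
Proof.
move=> A0 /linkP[ji [s [sc is_ js]]] /linkP[mi [t [tc it mt]]] jA.
have mono u p q : u \in cones -> i \in u -> p \in u -> q \in u -> p != i -> q != i -> p \in A -> q \in A.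
  move=> uc iu pu qu pi qi pA; have [<-//|pq] := eqVneq p q.
  have [r [ru rp rq ue]] := cone_thirds fan uc pu qu pq.
  have ri : r = i by move: iu; rewrite ue !inE ![i == _]eq_sym (negbTE pi) (negbTE qi) !orbF => /eqP.
  have /= := @card_link2 _ u r p q A ue; rewrite ri !inE negb_or ![i == _]eq_sym pi qi pq => /(_ isT).
  move: A0; rewrite /mixed (bigD1 u) ?uc //= => /eqP; rewrite addn_eq0 => /andP[h _] e.
  move: h; rewrite e pA; by case: (q \in A).
have /(_ _ _ sc tc is_ it) : forall s t, s \in cones -> t \in cones -> i \in s -> i \in t ->
    (s :\ i \subset A) -> (t :\ i \subset A).
  apply: (link_connected fan bP (i := i) (Q := fun u : {set 'I_n} => u :\ i \subset A)).
  move=> s' t' k sc' tc' is' it' ts' ks' ki' sub sA.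
  have [p [ps pi' pk se]] := cone_thirds fan sc' is' ks' (etrans (congr1 negb (eq_sym _ _)) ki').
  have pt : p \in t' by apply: (subsetP sub); rewrite !inE pk.
  have pA : p \in A by apply: (subsetP sA); rewrite !inE pi'.
  by apply/subsetP => q /setD1P[qi qt]; apply: (mono t' p q).
have sA : s :\ i \subset A by apply/subsetP => q /setD1P[qi qs]; apply: (mono s j q).
by move=> /(_ sA)/subsetP; apply; rewrite !inE mi.
Qed.

End Mixed.

(** A small multiple of [b s k] added to [b s j] still vanishes on [v_i]. A generator killed by the
    sum is killed by both terms, hence lies on the line of [v_i]. *)
Lemma ordinary_generic (n : nat) (v : 'I_n -> 'rV[int]_3) (cones : {set {set 'I_n}}) i :
  complete_simplicial_stacky_fan rat v cones -> ordinary v i ->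
  exists q : 'rV[rat]_3, dotp (realize rat (v i)) q = 0 /\
    forall m, m != i -> dotp (realize rat (v m)) q != 0.
Proof.
move=> fan ord; have [b bP] := exists_dual_basis fan.
have [s sc is_] := cone_at fan i.
have : (1 < #|s|)%N by rewrite (card_cone fan sc).
rewrite (cardsD1 i) is_ ltnS => /card_gt0P[j /setD1P[ji js]].
have [k [ks ki kj se]] : exists k, [/\ k \in s, k != i, k != j & s = [set k; i; j]].
  by apply: (cone_thirds fan sc is_ js); rewrite eq_sym.
have [e e0 he] := small_step (fun m => dotp (realize rat (v m)) (b s j)) (fun m => dotp (realize rat (v m)) (b s k)).
exists (b s j + e *: b s k); split.
  by rewrite !dotpE !(dual_in bP) // ![i == _]eq_sym (negbTE ji) (negbTE ki) mulr0 addr0.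
move=> m mi; rewrite !dotpE; have [mj|mj] := eqVneq (dotp (realize rat (v m)) (b s j)) 0.
  rewrite mj add0r mulf_neq0 ?(gt_eqF e0) //; apply/eqP => mk.
  have jk : j != k by rewrite eq_sym.
  have [p [ps pj pk e1]] := cone_ray fan bP sc js ks jk mj mk.
  have ip : p = i by move: ps; rewrite se !inE (negbTE pj) (negbTE pk) /= orbF => /eqP.
  by have /eqP := ord m mi (dotp (realize rat (v m)) (b s p)); rewrite -ip -e1.
by rewrite -sgr_eq0 he ?sgr_eq0 // ltW.
Qed.

(** * Local structure of the limit function *)

Lemma realize_ratr (K : realFieldType) (u : 'rV[int]_3) :
  map_mx ratr (realize rat u) = realize K u.
Proof. by apply/rowP => k; rewrite !mxE ratr_int. Qed.

Section Local.
Variables (n : nat) (v : 'I_n -> 'rV[int]_3) (cones : {set {set 'I_n}}).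
Hypothesis fan : complete_simplicial_stacky_fan rat v cones.
Variable b : {set 'I_n} -> 'I_n -> 'rV[rat]_3.
Hypothesis bP : dual_basis v cones b.
Variables (K : realFieldType) (y : 'I_n -> K).

Local Notation vQ k := (realize rat (v k)).
Local Notation vK k := (realize K (v k)).
Local Notation toK := (map_mx (@ratr K)).

(** The gradient on [s] of the piecewise linear function with values [y]. Only the values are in
    [K]; the dual basis remains rational. *)
Definition grad (s : {set 'I_n}) : 'rV[K]_3 := \sum_(k in s) y k *: toK (b s k).

Lemma dotp_toK m (x : 'rV[rat]_3) : dotp (vK m) (toK x) = ratr (dotp (vQ m) x).
Proof. by rewrite -(realize_ratr K) dotp_map. Qed.

Lemma dotp_grad s m : s \in cones -> m \in s -> dotp (vK m) (grad s) = y m.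
Proof.
move=> sc ms; rewrite /grad dotp_sumr (bigD1 m) //= big1 ?addr0 => [|k /andP[ks km]];
  rewrite dotpZr dotp_toK (dual_in bP) //; first by rewrite eqxx rmorph1 mulr1.
by rewrite eq_sym (negbTE km) rmorph0 mulr0.
Qed.

Lemma decompK s m : s \in cones -> vK m = \sum_(k in s) ratr (dotp (vQ m) (b s k)) *: vK k.
Proof.
move=> sc; rewrite -(realize_ratr K) {1}(decomp bP (vQ m) sc) (raddf_sum (map_mx ratr)).
by apply: eq_bigr => k _; rewrite /= map_mxZ realize_ratr.
Qed.

Lemma dotp_decompK s m z : s \in cones ->
  dotp (vK m) z = \sum_(k in s) ratr (dotp (vQ m) (b s k)) * dotp (vK k) z.
Proof. by move=> sc; rewrite {1}(decompK m sc) dotp_suml; apply: eq_bigr => k _; rewrite dotpZl. Qed.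

Hypothesis acyc : forall w : 'rV[K]_3, (forall k, y k != dotp (vK k) w) ->
  echi cones [set k | dotp (vK k) w < y k] = 0.

Lemma mixed_sign i (A : {set 'I_n}) w : ordinary v i -> dotp (vK i) w = y i ->
  (forall m, link cones i m -> y m != dotp (vK m) w /\ (m \in A) = (dotp (vK m) w < y m)) ->
  mixed cones i A = 2%N.
Proof.
move=> ord wi hA.
have [q [qi qm]] := ordinary_generic fan ord.
(* The perturbed function [w1] still equals [y] at [i], but at no other generator, and keeps all
   nonzero signs. *)
have [e1 e10 he1] := small_step (fun m => y m - dotp (vK m) w) (fun m => - dotp (vK m) (toK q)).
pose w1 := w + e1 *: toK q.
have w1E m : y m - dotp (vK m) w1 = y m - dotp (vK m) w + e1 * - dotp (vK m) (toK q).
  by rewrite /w1 !dotpE; ring.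
clearbody w1.
have w1i : y i - dotp (vK i) w1 = 0 by rewrite w1E wi subrr dotp_toK qi rmorph0 oppr0 mulr0 addr0.
have w1sg m : y m - dotp (vK m) w != 0 -> Num.sg (y m - dotp (vK m) w1) = Num.sg (y m - dotp (vK m) w).
  by move=> h; rewrite w1E he1 // ltW.
have w1m m : m != i -> y m - dotp (vK m) w1 != 0.
  move=> mi; have [wm|wm] := eqVneq (y m - dotp (vK m) w) 0.
    rewrite w1E wm add0r mulf_neq0 ?(gt_eqF e10) // oppr_eq0 dotp_toK fmorph_eq0; exact: qm.
  by rewrite -sgr_eq0 w1sg // sgr_eq0.
have [s sc is_] := cone_at fan i.
pose p := toK (b s i).
have pi : dotp (vK i) p = 1 by rewrite dotp_toK (dual_in bP) // eqxx rmorph1.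
pose A1 := [set m | (m != i) && (dotp (vK m) w1 < y m)].
have iA1 : i \notin A1 by rewrite inE eqxx.
(* Moving [w1] slightly up or down along [p] alters the sign at [i] only, so that [A1] and [i |: A1]
   are both sign sets of generic functions. *)
have flip (sg : K) : `|sg| = 1 -> exists2 e, 0 < e & forall m, m != i ->
    (dotp (vK m) (w1 + (e * sg) *: p) != y m) /\
    (dotp (vK m) (w1 + (e * sg) *: p) < y m) = (dotp (vK m) w1 < y m).
  move=> sg1; have [e e0 he] := small_step (fun m => y m - dotp (vK m) w1) (fun m => - sg * dotp (vK m) p).
  exists e => // m mi; have := he e (ltW e0) (lexx e) m (w1m m mi).
  have -> : y m - dotp (vK m) w1 + e * (- sg * dotp (vK m) p) = y m - dotp (vK m) (w1 + (e * sg) *: p).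
    by rewrite !dotpE; ring.
  move=> h; split; last by rewrite -subr_gt0 -[RHS]subr_gt0 -sgr_gt0 h sgr_gt0.
  by rewrite eq_sym -subr_eq0 -sgr_eq0 h sgr_eq0 w1m.
have E1 : echi cones A1 = 0.
  have [|e e0 he] := flip 1; rewrite ?normr1 //.
  rewrite -(acyc (w := w1 + (e * 1) *: p)) => [|k].
    congr (echi _ _); apply/setP => m; rewrite !inE; have [->|mi] /= := eqVneq m i.
      rewrite !dotpE pi; move/eqP: w1i; rewrite subr_eq0 => /eqP->.
      by rewrite !mulr1 gtrDl ltNge (ltW e0).
    by have [_ ->] := he m mi.
  have [->|ki] := eqVneq k i; last by rewrite eq_sym; have [] := he k ki.
  rewrite !dotpE pi; move/eqP: w1i; rewrite subr_eq0 => /eqP->.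
  by rewrite !mulr1 eq_sym -subr_eq0 addrAC subrr add0r gt_eqF.
have E2 : echi cones (i |: A1) = 0.
  have [|e e0 he] := flip (-1); rewrite ?normrN1 //.
  rewrite -(acyc (w := w1 + (e * -1) *: p)) => [|k].
    congr (echi _ _); apply/setP => m; rewrite !inE; have [->|mi] /= := eqVneq m i.
      rewrite !dotpE pi; move/eqP: w1i; rewrite subr_eq0 => /eqP->.
      by rewrite !mulr1 mulrN1 gtrDl oppr_lt0 e0.
    by have [_ ->] := he m mi.
  have [->|ki] := eqVneq k i; last by rewrite eq_sym; have [] := he k ki.
  rewrite !dotpE pi; move/eqP: w1i; rewrite subr_eq0 => /eqP->.
  by rewrite !mulr1 mulrN1 eq_sym -subr_eq0 addrAC subrr add0r oppr_eq0 gt_eqF.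
rewrite -(mixed_echi fan bP iA1 E1 E2); apply: mixed_congr => m lm.
have [wm ->] := hA m lm; have /linkP[mi _] := lm.
have wm' : y m - dotp (vK m) w != 0 by rewrite subr_eq0.
by rewrite inE mi /= -subr_gt0 -[RHS]subr_gt0 -sgr_gt0 -w1sg // sgr_gt0.
Qed.

(* The two neighbours [k], [k'] lie on the same side of [w], which is impossible
   for an isolated zero at [j]; hence a second zero [j'] opposite to [j], and then
   every other vertex of the link lies on that same side as well. *)
Lemma broken_opposite i j k k' : ordinary v i -> wall cones i j k k' ->
  y k' != dotp (vK k') (grad [set i; j; k]) ->
  exists (j' : 'I_n) (w : 'rV[K]_3) (e : K), [/\ link cones i j',
   exists al be : rat, be < 0 /\ vQ j' = al *: vQ i + be *: vQ j,
   [/\ dotp (vK i) w = y i, dotp (vK j) w = y j & dotp (vK j') w = y j'],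
   e = 1 \/ e = -1 &
   forall m, link cones i m -> m != j -> m != j' -> 0 < e * (y m - dotp (vK m) w)].
Proof.
move=> ord W; have [sc tc] := W; rewrite /= !inE !negb_or andbT => /and3P[/and3P[ij ik ik'] /andP[jk jk'] kk'].
set s := [set i; j; k] in sc *; set l := grad s => br.
have is_ : i \in s by rewrite !inE eqxx.
have js : j \in s by rewrite !inE eqxx orbT.
have ks : k \in s by rewrite !inE eqxx !orbT.
have ki : (k == i) = false by rewrite eq_sym (negbTE ik).
have ji : (j == i) = false by rewrite eq_sym (negbTE ij).
pose D := y k' - dotp (vK k') l.
have D0 : D != 0 by rewrite subr_eq0.
pose nn := toK (b s k).
have ni : dotp (vK i) nn = 0 by rewrite dotp_toK (dual_in bP) // (negbTE ik) rmorph0.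
have nj : dotp (vK j) nn = 0 by rewrite dotp_toK (dual_in bP) // (negbTE jk) rmorph0.
have nk : dotp (vK k) nn = 1 by rewrite dotp_toK (dual_in bP) // eqxx rmorph1.
have nk' : dotp (vK k') nn < 0 by rewrite dotp_toK -(rmorph0 (@ratr K)) ltr_rat; apply: (wall_side fan bP W).
pose sg := Num.sg D.
have sg1 : sg = 1 \/ sg = -1 by rewrite /sg; case: sgrP D0 => //; [left|right].
(* Tilting [l] about the wall lifts [k] off zero to the side given by the sign of [D]; the step is
   too small for [k'] to leave that side. *)
have [e e0 he] := small_step (fun m => y m - dotp (vK m) l) (fun m => sg * dotp (vK m) nn).
pose w := l - (e * sg) *: nn.
have wE m : y m - dotp (vK m) w = y m - dotp (vK m) l + e * (sg * dotp (vK m) nn).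
  by rewrite /w !dotpE; ring.
clearbody w.
have ws m : m \in s -> y m - dotp (vK m) w = e * (sg * dotp (vK m) nn).
  by move=> ms; rewrite wE dotp_grad // subrr add0r.
have wi : dotp (vK i) w = y i by apply/esym/eqP; rewrite -subr_eq0 ws // ni !mulr0.
have wj : dotp (vK j) w = y j by apply/esym/eqP; rewrite -subr_eq0 ws // nj !mulr0.
have sgD x : Num.sg x = sg -> 0 < sg * x.
  move=> sx; rewrite -sx -normrEsg normr_gt0 -sgr_eq0 sx.
  by case: sg1 => ->; rewrite ?oppr_eq0 oner_eq0.
pose f m := y m - dotp (vK m) w.
have fk : 0 < sg * f k.
  rewrite /f ws // nk mulr1 mulrCA -expr2; case: sg1 => ->; by rewrite ?sqrrN expr1n mulr1.
have fk' : 0 < sg * f k'.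
  by apply: sgD; rewrite /f wE he // ltW.
have lnk u m : u \in cones -> i \in u -> m \in u -> m != i -> link cones i m.
  by move=> uc iu mu mi; apply/linkP; split=> //; exists u.
have lj : link cones i j by apply: (lnk s); rewrite // ji.
(* By the choice of [e], a zero of [f] on the link is a zero of [y - l] and of [nn], so it lies in
   the plane of the wall. A positive [be] would give [j] back, and [be = 0] is excluded by
   ordinariness. *)
have zero m : link cones i m -> f m = 0 -> m != j -> exists al be : rat, be < 0 /\ vQ m = al *: vQ i + be *: vQ j.
  move=> /linkP[mi [u [uc iu mu]]] fm mj.
  have am : y m - dotp (vK m) l = 0.
    have [//|am] := eqVneq (y m - dotp (vK m) l) 0.
    have := he e (ltW e0) (lexx e) m am; rewrite -wE -/(f m) fm sgr0 => /esym/eqP.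
    by rewrite sgr_eq0 (negbTE am).
  have nm : dotp (vQ m) (b s k) = 0.
    move: fm; rewrite /f wE am add0r => /eqP; rewrite !mulf_eq0 (gt_eqF e0) /= dotp_toK fmorph_eq0.
    by case: sg1 => ->; rewrite ?oppr_eq0 oner_eq0 => /eqP.
  have vm : vQ m = dotp (vQ m) (b s i) *: vQ i + dotp (vQ m) (b s j) *: vQ j.
    have sumS (g : 'I_n -> 'rV[rat]_3) : \sum_(q in s) g q = g k + (g i + g j).
      rewrite /s setUC big_setU1 /=; last by rewrite !inE ki eq_sym (negbTE jk).
      by rewrite big_setU1 ?inE //= big_set1.
    by rewrite {1}(decomp bP (vQ m) sc) sumS nm scale0r add0r.
  exists (dotp (vQ m) (b s i)), (dotp (vQ m) (b s j)); split=> //.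
  rewrite ltNge; apply/negP; rewrite le_eqVlt => /orP[/eqP be0|be0].
    move: vm; rewrite -be0 scale0r addr0 => vm.
    by have /eqP := ord m mi (dotp (vQ m) (b s i)); rewrite -vm.
  by have := link_ray_inj fan bP sc uc is_ iu js mu mi vm be0; move/eqP; rewrite (negbTE mj).
(* Turning about [v_i] along [p] separates [j] from an opposite zero: [p] is 1 at [v_j], 0 at [v_i]
   and negative on the other side. Both directions of turning are used. *)
pose p := toK (b s j).
have pj : dotp (vK j) p = 1 by rewrite dotp_toK (dual_in bP) // eqxx rmorph1.
have pi : dotp (vK i) p = 0 by rewrite dotp_toK (dual_in bP) // (negbTE ij) rmorph0.
pose A := [set m | (m != i) && (0 < f m)].
have kA : (k \in A) = (sg == 1).
  rewrite inE ki /=; case: sg1 fk => ->; first by rewrite mul1r eqxx.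
  by rewrite mulN1r oppr_gt0 => fk; rewrite ltNge (ltW fk) /= eq_sym -subr_eq0 opprK (eqr_nat K 2 0).
have k'i : (k' == i) = false by rewrite eq_sym (negbTE ik').
have k'A : (k' \in A) = (sg == 1).
  rewrite inE k'i /=; case: sg1 fk' => ->; first by rewrite mul1r eqxx.
  by rewrite mulN1r oppr_gt0 => fk'; rewrite ltNge (ltW fk') /= eq_sym -subr_eq0 opprK (eqr_nat K 2 0).
have jA : j \notin A by rewrite inE /f wj subrr ltxx andbF.
have pert (sgn : K) (B : {set 'I_n}) : `|sgn| = 1 ->
    (forall m, link cones i m -> f m != 0 -> (m \in B) = (m \in A)) ->
    (forall m, link cones i m -> f m = 0 -> dotp (vK m) p != 0 /\ (m \in B) = (0 < sgn * dotp (vK m) p)) ->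
    mixed cones i B = 2%N.
  move=> sgn1 hB hB0.
  have [e2 e20 he2] := small_step f (fun m => sgn * dotp (vK m) p).
  pose w2 := w - (e2 * sgn) *: p.
  have w2E m : y m - dotp (vK m) w2 = f m + e2 * (sgn * dotp (vK m) p).
    by rewrite /w2 /f !dotpE; ring.
  have sn0 : sgn != 0 by rewrite -normr_eq0 sgn1 oner_eq0.
  apply: (mixed_sign (w := w2) ord) => [|m lm].
    by apply/esym/eqP; rewrite -subr_eq0 w2E pi /f wi subrr !mulr0 addr0.
  rewrite -subr_eq0 -subr_gt0 w2E; have [fm|fm] := eqVneq (f m) 0.
    have [pm ->] := hB0 m lm fm; rewrite fm add0r (pmulr_rgt0 _ e20); split=> //.
    by rewrite mulf_neq0 ?(gt_eqF e20) // mulf_neq0.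
  have h := he2 e2 (ltW e20) (lexx e2) m fm.
  rewrite -sgr_eq0 h sgr_eq0 fm -sgr_gt0 h sgr_gt0 hB //; split=> //.
  by rewrite inE; have /linkP[-> _] := lm.
have fj : f j = 0 by rewrite /f wj subrr.
have Nn1 : `|-1 : K| = 1 by rewrite normrN1.
have [j' /and3P[lj' j'j /eqP fj']|noj'] := pickP (fun m => [&& link cones i m, m != j & f m == 0]); last first.
  have only m : link cones i m -> f m = 0 -> m = j.
    by move=> lm fm; apply/eqP; have := noj' m; rewrite lm fm eqxx andbT /= => /negbFE.
  have M1 : mixed cones i A = 2%N.
    apply: (pert (-1)) => // m lm /(only _ lm) ->; rewrite pj oner_eq0 (negbTE jA); split=> //.
    by rewrite mulr1 oppr_gt0 ltNge ler01.
  have M2 : mixed cones i (j |: A) = 2%N.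
    apply: (pert 1); rewrite ?normr1 // => m lm fm.
      by rewrite !inE; have [mj|//] := eqVneq m j; move: fm; rewrite mj fj eqxx.
    by rewrite (only _ lm fm) pj oner_eq0 !inE eqxx mulr1 ltr01.
  have := mixed_flip fan bP W jA; rewrite M1 M2 kA k'A; by case: (sg == 1).
have [al [be [be0 vj']]] := zero j' lj' fj' j'j.
have vKj' : vK j' = ratr al *: vK i + ratr be *: vK j.
  by rewrite -!(realize_ratr K) vj' raddfD /= !map_mxZ.
have pj' : dotp (vK j') p = ratr be by rewrite vKj' !dotpE pi pj mulr0 add0r mulr1.
have be0K : ratr be < 0 :> K by rewrite -(rmorph0 (@ratr K)) ltr_rat.
have only m : link cones i m -> f m = 0 -> m = j \/ m = j'.
  move=> lm fm; have [|mj] := eqVneq m j; [by left|right].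
  have [al' [be' [be'0 vm]]] := zero m lm fm mj.
  have /linkP[mi [u [uc iu mu]]] := lm; have /linkP[_ [u' [u'c iu' ju']]] := lj'.
  apply: (link_ray_inj fan bP (i := i) (al := al' - be' / be * al) (be := be' / be) u'c uc) => //.
    rewrite vm vj' scalerDr !scalerA scalerBl addrA divfK ?lt_eqF // subrK //.
  by rewrite nmulr_rgt0 // invr_lt0.
have j'A : j' \notin A by rewrite inE fj' ltxx andbF.
have M1 : mixed cones i (j' |: A) = 2%N.
  apply: (pert (-1)) => // m lm fm.
    by rewrite !inE; have [mj|//] := eqVneq m j'; move: fm; rewrite mj fj' eqxx.
  case: (only m lm fm) => ->.
    by rewrite pj oner_eq0 !inE eq_sym (negbTE j'j) fj ltxx andbF mulr1 oppr_gt0 ltNge ler01.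
  by rewrite pj' lt_eqF // !inE eqxx mulN1r oppr_gt0 be0K.
have M2 : mixed cones i (j |: A) = 2%N.
  apply: (pert 1); rewrite ?normr1 // => m lm fm.
    by rewrite !inE; have [mj|//] := eqVneq m j; move: fm; rewrite mj fj eqxx.
  case: (only m lm fm) => ->.
    by rewrite pj oner_eq0 !inE eqxx mulr1 ltr01.
  by rewrite pj' lt_eqF // !inE (negbTE j'j) fj' ltxx andbF mul1r ltNge (ltW be0K).
have M3 := mixed_flip fan bP W jA.
have /linkP[j'i [u [uc iu j'u]]] := lj'.
have ij' : i != j' by rewrite eq_sym.
have [k1 [k1' [W1 ue]]] := cone_wall fan bP uc iu j'u ij'.
have M4 := mixed_flip fan bP W1 j'A.
have j'jA : j' \notin j |: A by rewrite !inE negb_or j'j fj' ltxx andbF.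
have M5 := mixed_flip fan bP W1 j'jA.
have lk : link cones i k by apply: (lnk s); rewrite // ki.
(* For [sg = 1] the counts force 4 sign changes for [A] and none after [j] and [j'] are both added;
   for [sg = -1] they force none for [A] itself. *)
have fin m : link cones i m -> m != j -> m != j' -> (m \in A) = (sg == 1).
  move=> lm mj mj'; case: sg1 => sE; move: M2 M3 M4 M5; rewrite M1 kA k'A sE.
    rewrite eqxx => -> M3 M4 M5.
    have M0 : mixed cones i (j' |: (j |: A)) = 0%N.
      have e1 : ((k1 \in A) + (k1' \in A) = 2)%N.
        move: M3 M4; move: (mixed cones i A) (k1 \in A) (k1' \in A); clear => a [] [] /=; lia.
      have [k1A k1'A] : k1 \in A /\ k1' \in A by move: e1; case: (k1 \in A); case: (k1' \in A).
      move: M5; rewrite !in_setU1 k1A k1'A !orbT; clear; lia.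
    have := mixed0 fan bP M0 lj lm; by rewrite !in_setU1 eqxx orbT (negbTE mj) (negbTE mj') /= => /(_ isT) ->.
  have -> : (-1 == 1 :> K) = false by rewrite eq_sym -subr_eq0 opprK (eqr_nat K 2 0).
  move=> -> M3 _ _; have M0 : mixed cones i A = 0%N by move: M3; move: (mixed cones i A); clear => a /=; lia.
  apply/negP => mA; move: (mixed0 fan bP M0 lm lj mA); by rewrite (negbTE jA).
exists j', w, sg; split=> //.
- by exists al, be.
- by split=> //; apply/esym/eqP; rewrite -subr_eq0 -/(f j') fj'.
move=> m lm mj mj'; have := fin m lm mj mj'; have /linkP[mi _] := lm; rewrite inE mi /=.
have fm0 : f m != 0 by apply/eqP => /(only m lm)[] e1; rewrite e1 eqxx in mj mj'.
rewrite -/(f m); case: sg1 => ->; first by rewrite eqxx mul1r.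
rewrite mulN1r oppr_gt0 eq_sym -subr_eq0 opprK (eqr_nat K 2 0) => h.
by rewrite lt_neqAle fm0 leNgt h.
Qed.

End Local.

Lemma sum_set3 (V : nmodType) (T : finType) (i j k : T) (f : T -> V) : uniq [:: i; j; k] ->
  \sum_(q in [set i; j; k]) f q = f i + f j + f k.
Proof.
rewrite /= !inE negb_or andbT => /andP[/andP[ij ik] jk].
rewrite setUC big_setU1 /=; last by rewrite !inE negb_or ![k == _]eq_sym ik jk.
by rewrite big_setU1 ?inE //= big_set1 addrC.
Qed.

(** * Broken walls at an ordinary vertex *)

Section Broken.
Variables (n : nat) (v : 'I_n -> 'rV[int]_3) (cones : {set {set 'I_n}}).
Hypothesis fan : complete_simplicial_stacky_fan rat v cones.
Variable b : {set 'I_n} -> 'I_n -> 'rV[rat]_3.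
Hypothesis bP : dual_basis v cones b.
Variables (K : realFieldType) (y : 'I_n -> K).

Local Notation vQ k := (realize rat (v k)).
Local Notation vK k := (realize K (v k)).
Local Notation toK := (map_mx (@ratr K)).
Local Notation grad := (grad b y).

Hypothesis acyc : forall w : 'rV[K]_3, (forall k, y k != dotp (vK k) w) ->
  echi cones [set k | dotp (vK k) w < y k] = 0.

Definition broken (w : 'I_n * 'I_n * 'I_n * 'I_n) : bool :=
  let: (i, j, k, k') := w in
  [&& [set i; j; k] \in cones, [set i; j; k'] \in cones, uniq [:: i; j; k; k'] &
      y k' != dotp (vK k') (grad [set i; j; k])].

Lemma brokenP i j k k' : reflect (wall cones i j k k' /\ y k' != dotp (vK k') (grad [set i; j; k]))
  (broken (i, j, k, k')).
Proof. by apply: (iffP and4P) => [[]|[[]]]. Qed.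

Lemma broken_sym i j k k' : broken (i, j, k, k') -> broken (j, i, k, k').
Proof. by move=> /brokenP[/wallCl w h]; apply/brokenP; split=> //; rewrite (setUC [set j]). Qed.

Lemma wall_uniq i j k k' : wall cones i j k k' -> uniq [:: i; j; k].
Proof.
case=> _ _; rewrite /= !inE !negb_or andbT => /and3P[/and3P[ij ik ik'] /andP[jk jk'] kk'].
by rewrite ij ik jk.
Qed.

Lemma decomp3 i j k k' (x : 'rV[rat]_3) : wall cones i j k k' ->
  x = dotp x (b [set i; j; k] i) *: vQ i + dotp x (b [set i; j; k] j) *: vQ j +
      dotp x (b [set i; j; k] k) *: vQ k.
Proof. by move=> w; have [sc _ _] := w; rewrite {1}(decomp bP x sc) sum_set3 // (wall_uniq w). Qed.

Lemma dotp3 i j k k' (m : 'I_n) (z : 'rV[K]_3) : wall cones i j k k' ->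
  dotp (vK m) z = ratr (dotp (vQ m) (b [set i; j; k] i)) * dotp (vK i) z +
      ratr (dotp (vQ m) (b [set i; j; k] j)) * dotp (vK j) z +
      ratr (dotp (vQ m) (b [set i; j; k] k)) * dotp (vK k) z.
Proof. by move=> w; have [sc _ _] := w; rewrite {1}(dotp_decompK bP m z sc) sum_set3 // (wall_uniq w). Qed.

Lemma wall_dual i j k k' : wall cones i j k k' -> let s := [set i; j; k] in
  [/\ dotp (vQ i) (b s k) = 0, dotp (vQ j) (b s k) = 0 & dotp (vQ k) (b s k) = 1] /\
  [/\ dotp (vQ i) (b s i) = 1, dotp (vQ i) (b s j) = 0, dotp (vQ j) (b s i) = 0 & dotp (vQ j) (b s j) = 1].
Proof.
move=> w s; have [sc _ _] := w; have := wall_uniq w; rewrite /= !inE negb_or andbT => /andP[/andP[ij ik] jk].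
rewrite !(dual_in bP) // ?inE ?eqxx ?orbT //.
by rewrite (negbTE ik) (negbTE jk) (negbTE ij) eq_sym (negbTE ij).
Qed.

Lemma plane_eq i j k k' h : wall cones i j k k' -> dotp (vQ i) h = 0 -> dotp (vQ j) h = 0 ->
  h = dotp (vQ k) h *: b [set i; j; k] k.
Proof.
move=> w hi hj; apply/eqP; rewrite -subr_eq0; apply/eqP; apply: dotp_eq0 => x.
have [[ik jk kk] _] := wall_dual w.
rewrite (decomp3 x w) !dotpE ik jk kk hi hj; ring.
Qed.

Lemma link_wall i j k k' : wall cones i j k k' -> link cones i j.
Proof.
move=> w; have [sc _ _] := w; have := wall_uniq w; rewrite /= !inE negb_or andbT => /andP[/andP[ij ik] jk].
by apply/linkP; rewrite eq_sym; split=> //; exists [set i; j; k]; rewrite !inE !eqxx ?orbT.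
Qed.

Lemma link_same_ray i j m (al be : rat) : link cones i j -> link cones i m ->
  vQ m = al *: vQ i + be *: vQ j -> 0 < be -> m = j.
Proof.
move=> /linkP[ji [s [sc is_ js]]] /linkP[mi [t [tc it mt]]]; exact: (link_ray_inj fan bP sc tc).
Qed.

(** Both neighbours of [j'] lie strictly on one side of [w], which touches [y] at [i] and [j'].
    Linearity across the wall would put them on opposite sides. *)
Lemma broken_opp_wall i j k k' : ordinary v i -> broken (i, j, k, k') ->
  exists (j' k1 k1' : 'I_n) (al be : rat),
    [/\ broken (i, j', k1, k1'), be < 0 & vQ j' = al *: vQ i + be *: vQ j].
Proof.
move=> ord /brokenP[W br].
have [j' [w [e [lj' [al [be [be0 vj']]] [wi wj wj'] e1 he]]]] := broken_opposite fan bP acyc ord W br.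
have /linkP[j'i [u [uc iu j'u]]] := lj'.
have ij' : i != j' by rewrite eq_sym.
have [k1 [k1' [W1 ue]]] := cone_wall fan bP uc iu j'u ij'.
exists j', k1, k1', al, be; split=> //; apply/brokenP; split=> //.
have [s1c t1c] := W1; rewrite /= !inE !negb_or andbT => /and3P[/and3P[_ ik1 ik1'] /andP[j'k1 j'k1'] kk1].
have W1' := wallC W1.
have jn q q' : wall cones i j' q q' -> q != j.
  move=> Wq; apply/eqP => qj; have [[a1 a2 a3] _] := wall_dual Wq.
  move/(congr1 (fun x => dotp x (b [set i; j'; q] q))): vj'.
  rewrite !dotpE a1 a2 -qj a3 mulr0 add0r mulr1 => /esym/eqP; by rewrite (lt_eqF be0).
have lk q q' : wall cones i j' q q' -> q != i -> link cones i q.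
  by move=> [qc _ _] qi; apply/linkP; split=> //; exists [set i; j'; q]; rewrite !inE !eqxx ?orbT.
have h1 : 0 < e * (y k1 - dotp (vK k1) w).
  by apply: he; rewrite ?(jn _ _ W1) ?(lk _ _ W1) // eq_sym.
have h1' : 0 < e * (y k1' - dotp (vK k1') w).
  by apply: he; rewrite ?(jn _ _ W1') ?(lk _ _ W1') // eq_sym.
apply/eqP => eqy; move: h1'.
have -> : y k1' - dotp (vK k1') w = ratr (dotp (vQ k1') (b [set i; j'; k1] k1)) * (y k1 - dotp (vK k1) w).
  have gi m : m \in [set i; j'; k1] -> dotp (vK m) (grad [set i; j'; k1]) = y m by exact: (dotp_grad bP).
  rewrite eqy (dotp3 k1' (grad _) W1) (dotp3 k1' w W1) !gi ?inE ?eqxx ?orbT // wi wj'; ring.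
rewrite mulrCA ltNge nmulr_rle0 ?(ltW h1) //.
by rewrite -(rmorph0 (@ratr K)) ltr_rat; apply: (wall_side fan bP W1).
Qed.

(** Each wall yields a linear function touching [y] on the link at one opposite pair only, and the
    two pairs are disjoint. If both lie on the same side of [y], their mean has a strict constant
    sign on the link, against the two sign changes. If not, [w' - w] vanishes at [v_i] and has one
    strict sign on the link, which is impossible as [- v_j] is a nonnegative combination of link
    generators modulo [v_i]. *)
Lemma broken_unique i j k k' q r r' : ordinary v i -> broken (i, j, k, k') -> broken (i, q, r, r') ->
  exists al be : rat, vQ q = al *: vQ i + be *: vQ j.
Proof.
move=> ord /brokenP[W br] /brokenP[W' br'].
have [j' [w [e [lj' [al [be [be0 vj']]] [wi wj wj'] e1 he]]]] := broken_opposite fan bP acyc ord W br.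
have [q' [w' [e' [lq' [al' [be' [be'0 vq']]] [wi' wq wq'] e1' he']]]] := broken_opposite fan bP acyc ord W' br'.
have [->|qj] := eqVneq q j; first by exists 0, 1; rewrite scale0r add0r scale1r.
have [->|qj'] := eqVneq q j'; first by exists al, be.
exfalso.
have lj := link_wall W; have lq := link_wall W'.
have vq : vQ q = (- (al' / be')) *: vQ i + be'^-1 *: vQ q'.
  by rewrite vq' scalerDr !scalerA mulVf ?lt_eqF // scale1r addrA -scalerDl mulrC addNr scale0r add0r.
have q'j : q' != j.
  apply/eqP => e2; case/eqP: qj'.
  have vj : vQ j = (- (al / be)) *: vQ i + be^-1 *: vQ j'.
    by rewrite vj' scalerDr !scalerA mulVf ?lt_eqF // scale1r addrA -scalerDl mulrC addNr scale0r add0r.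
  apply: (link_same_ray (i := i) (al := - (al' / be') - be'^-1 * (al / be)) (be := be'^-1 * be^-1)) => //.
    by rewrite vq e2 vj scalerDr !scalerA addrA -scalerDl mulrN.
  by rewrite nmulr_rgt0 invr_lt0.
have q'j' : q' != j'.
  apply/eqP => e2; case/eqP: qj.
  apply: (link_same_ray (i := i) (al := - (al' / be') + be'^-1 * al) (be := be'^-1 * be)) => //.
    by rewrite vq e2 vj' scalerDr !scalerA addrA -scalerDl.
  by rewrite nmulr_rgt0 ?invr_lt0.
pose f m := e * (y m - dotp (vK m) w).
pose f' m := e' * (y m - dotp (vK m) w').
have f0 m : link cones i m -> 0 <= f m.
  rewrite /f => lm; have [->|mj] := eqVneq m j; first by rewrite wj subrr mulr0.
  have [->|mj'] := eqVneq m j'; first by rewrite wj' subrr mulr0.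
  exact/ltW/he.
have f'0 m : link cones i m -> 0 <= f' m.
  rewrite /f' => lm; have [->|mj] := eqVneq m q; first by rewrite wq subrr mulr0.
  have [->|mj'] := eqVneq m q'; first by rewrite wq' subrr mulr0.
  exact/ltW/he'.
have ff m : link cones i m -> 0 < f m + f' m.
  move=> lm; have [mj|mj] := eqVneq m j.
    by apply: ltr_wpDl; [exact: f0|apply: he'; rewrite // mj eq_sym].
  have [mj'|mj'] := eqVneq m j'.
    by apply: ltr_wpDl; [exact: f0|apply: he'; rewrite // mj' eq_sym].
  by apply: ltr_pwDl; [exact: he|exact: f'0].
have [ee|ee] : e' = e \/ e' = - e.
  by case: e1 e1' => -> [] ->; rewrite ?opprK; [left|right|right|left].
  pose w2 := 2^-1 *: (w + w').
  have w2E m : e * (y m - dotp (vK m) w2) = 2^-1 * (f m + f' m).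
    by rewrite /f /f' ee /w2 !dotpE; field.
  have w2pos m : link cones i m -> 0 < e * (y m - dotp (vK m) w2).
    by move=> lm; rewrite w2E mulr_gt0 ?ff // invr_gt0 ltr0n.
  pose A := [set m : 'I_n | e == 1].
  have N1 : (-1 == 1 :> K) = false by rewrite eq_sym -subr_eq0 opprK (eqr_nat K 2 0).
  have : mixed cones i A = 2%N.
    apply: (mixed_sign fan bP acyc (w := w2)) => // [|m lm].
      by rewrite /w2 !dotpE wi wi'; field.
    rewrite inE -subr_gt0 -subr_eq0; have := w2pos m lm; case: e1 => ->.
      by rewrite mul1r eqxx => h; rewrite gt_eqF h.
    by rewrite mulN1r oppr_gt0 N1 => h; rewrite lt_eqF // ltNge ltW.
  suff -> : mixed cones i A = 0%N by [].
  apply: big1 => s /andP[sc is_].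
  have s2 : #|s :\ i| = 2%N.
    have := cardsD1 i s; rewrite is_ (card_cone fan sc) add1n => -[]; by [].
  have [->|->] : A = setT \/ A = set0.
    by case: e1 => ee1; [left|right]; apply/setP => m; rewrite !inE ee1 ?eqxx ?N1.
    by rewrite setIT s2.
  by rewrite setI0 cards0.
have eta m : link cones i m -> 0 < e * dotp (vK m) (w' - w).
  by move=> /ff; rewrite /f /f' ee !dotpE; apply: etrans; congr (_ < _); ring.
have etai : dotp (vK i) (w' - w) = 0 by rewrite !dotpE wi wi' subrr.
have [t /andP[tc it] ht] := link_cover fan bP i (- vQ j).
have : dotp (- vK j) (w' - w) = \sum_(m in t) ratr (dotp (- vQ j) (b t m)) * dotp (vK m) (w' - w).
  rewrite dotpNl (dotp_decompK bP j _ tc) -sumrN; apply: eq_bigr => m _.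
  by rewrite dotpNl rmorphN mulNr.
move/(congr1 ( *%R e)); rewrite dotpNl mulr_sumr => eq1.
have : 0 <= e * - dotp (vK j) (w' - w).
  rewrite eq1; apply: sumr_ge0 => m mt; have [->|mi] := eqVneq m i.
    by rewrite etai !mulr0.
  rewrite mulrCA mulr_ge0 //.
    by rewrite -(rmorph0 (@ratr K)) ler_rat; have := ht m; rewrite /link_dual (negbTE mi).
  by apply/ltW/eta/linkP; split=> //; exists t.
by rewrite mulrN oppr_ge0 leNgt eta.
Qed.

End Broken.

(** * Propagation of broken walls *)

Section Trace.
Variables (n : nat) (v : 'I_n -> 'rV[int]_3) (cones : {set {set 'I_n}}).
Hypothesis fan : complete_simplicial_stacky_fan rat v cones.
Variable b : {set 'I_n} -> 'I_n -> 'rV[rat]_3.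
Hypothesis bP : dual_basis v cones b.
Variables (K : realFieldType) (y : 'I_n -> K).

Local Notation vQ k := (realize rat (v k)).
Local Notation vK k := (realize K (v k)).
Local Notation toK := (map_mx (@ratr K)).
Local Notation grad := (grad b y).
Local Notation broken := (broken v cones b y).

Hypothesis acyc : forall w : 'rV[K]_3, (forall k, y k != dotp (vK k) w) ->
  echi cones [set k | dotp (vK k) w < y k] = 0.

(** To be the exceptional collinear pair, or empty if there is none. *)
Variable S : {set 'I_n}.
Hypothesis ordS : forall m, m \notin S -> ordinary v m.
Hypothesis parS : forall m m', m \in S -> m' \in S -> exists c : rat, vQ m' = c *: vQ m.

Definition on_wall i j (x : 'rV[rat]_3) := exists c1 c2 : rat, [/\ 0 <= c1, 0 <= c2 & x = c1 *: vQ i + c2 *: vQ j].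

Lemma coord_agree s t x p : s \in cones -> t \in cones ->
  (forall q, 0 <= dotp x (b s q)) -> (forall q, 0 <= dotp x (b t q)) -> p \in t ->
  dotp x (b s p) = dotp x (b t p).
Proof.
move=> sc tc xs xt pt; rewrite (dotp_decomp bP x (b s p) tc) (bigD1 p) //= big1 ?addr0.
  have [->|pq] := eqVneq (dotp x (b t p)) 0; first by rewrite mul0r.
  by rewrite (dual_in bP) ?eqxx ?mulr1 // (cone_supp fan bP tc sc xt xs pq).
move=> q /andP[qt qp]; have [->|xq] := eqVneq (dotp x (b t q)) 0; first by rewrite mul0r.
by rewrite (dual_in bP) ?(negbTE qp) ?mulr0 // (cone_supp fan bP tc sc xt xs xq).
Qed.

Lemma on_wallC i j x : on_wall i j x -> on_wall j i x.
Proof. by move=> [c1 [c2 [h1 h2 ->]]]; exists c2, c1; split=> //; rewrite addrC. Qed.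

(** A wall is described by weak inequalities alone, the coordinate at [k] being squeezed to zero, so
    that walls can serve as pieces in [last_point]. *)
Lemma on_wall_dual i j k k' x : wall cones i j k k' ->
  on_wall i j x <-> (forall q, 0 <= dotp x (b [set i; j; k] q)) /\ dotp x (b [set i; j; k] k) <= 0.
Proof.
move=> w; have [[ik jk kk] [ii ij ji jj]] := wall_dual bP w; have [sc _ _] := w.
split=> [[c1 [c2 [c10 c20 ->]]]|[h0 hk]].
  split; last by rewrite !dotpE ik jk !mulr0 addr0.
  by move=> q; rewrite !dotpE addr_ge0 ?mulr_ge0 // (vF_inC bP) // !inE eqxx ?orbT.
exists (dotp x (b [set i; j; k] i)), (dotp x (b [set i; j; k] j)); split=> //.
rewrite {1}(decomp3 bP x w); have -> : dotp x (b [set i; j; k] k) = 0 by apply/le_anti; rewrite hk h0.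
by rewrite scale0r addr0.
Qed.

Definition in_plane (h : 'rV[rat]_3) i j := (dotp (vQ i) h == 0) && (dotp (vQ j) h == 0).

Lemma decomp2 i j k k' h d : wall cones i j k k' -> h != 0 -> in_plane h i j -> dotp d h = 0 ->
  d = dotp d (b [set i; j; k] i) *: vQ i + dotp d (b [set i; j; k] j) *: vQ j.
Proof.
move=> w h0 /andP[/eqP hi /eqP hj] dh.
have he := plane_eq bP w hi hj.
have hk : dotp (vQ k) h != 0 by apply: contraNneq h0 => hk; rewrite he hk scale0r.
have dk : dotp d (b [set i; j; k] k) = 0.
  by move: dh; rewrite he dotpZr => /eqP; rewrite mulf_eq0 (negbTE hk) => /eqP.
by rewrite {1}(decomp3 bP d w) dk scale0r addr0.
Qed.

Lemma cone2_step i j (c1 c2 e1 e2 : rat) : 0 < c1 -> 0 <= c2 -> (c2 = 0 -> 0 <= e2) ->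
  exists2 e, 0 < e & forall t, 0 <= t -> t <= e ->
    on_wall i j (c1 *: vQ i + c2 *: vQ j + t *: (e1 *: vQ i + e2 *: vQ j)).
Proof.
move=> c10 c20 h.
have [e e0 he] := @small_step rat bool (fun x => if x then c1 else c2) (fun x => if x then e1 else e2).
exists e => // t t0 te; exists (c1 + t * e1), (c2 + t * e2); split.
- have := he t t0 te true; rewrite gt_eqF // => /(_ isT) /= h1.
  by rewrite -sgr_ge0 h1 sgr_ge0 ltW.
- have := he t t0 te false; have [c2z _|c2z] := eqVneq c2 0.
    by rewrite c2z add0r mulr_ge0 // h.
  by move=> /(_ isT) /= h1; rewrite -sgr_ge0 h1 sgr_ge0.
by rewrite scalerDr !scalerA !scalerDl addrACA.
Qed.

(** Within the plane one can stay on the same wall, except at the end [v_i] when [d] points away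
    from [v_j]; there the opposite broken wall takes over. *)
Lemma trace_step h i j k k' d c1 c2 : broken (i, j, k, k') -> h != 0 -> in_plane h i j -> dotp d h = 0 ->
  0 < c1 -> 0 <= c2 -> (c2 = 0 -> ordinary v i) ->
  exists (i1 j1 k1 k1' : 'I_n), [/\ broken (i1, j1, k1, k1'), in_plane h i1 j1 &
    exists2 e, 0 < e & forall t, 0 <= t -> t <= e -> on_wall i1 j1 (c1 *: vQ i + c2 *: vQ j + t *: d)].
Proof.
move=> br h0 hij dh c10 c20 ord; have /brokenP[w _] := br.
rewrite (decomp2 w h0 hij dh); set e1 := dotp d (b _ i); set e2 := dotp d (b _ j); clearbody e1 e2.
have [he2|he2] := boolP ((c2 != 0) || (0 <= e2)).
  exists i, j, k, k'; split=> //; apply: cone2_step => // c2z.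
  by move: he2; rewrite c2z eqxx /=.
move: he2; rewrite negb_or negbK -ltNge => /andP[/eqP c2z e20].
have [j' [k1 [k1' [al [be [br' be0 vj']]]]]] := broken_opp_wall fan bP acyc (ord c2z) br.
exists i, j', k1, k1'; split=> //.
  by move: hij; rewrite /in_plane vj' !dotpE => /andP[/eqP-> /eqP->]; rewrite !mulr0 addr0 eqxx.
have -> : e1 *: vQ i + e2 *: vQ j = (e1 - e2 / be * al) *: vQ i + (e2 / be) *: vQ j'.
  by rewrite vj' scalerDr !scalerA addrA scalerBl subrK divfK // lt_eqF.
rewrite c2z scale0r -(scale0r (vQ j')); apply: cone2_step => // _.
by rewrite ltW // nmulr_rgt0 // invr_lt0.
Qed.

(** The pieces covering the segment are the broken walls in the plane of [h]; no cyclic order on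
    them is required. *)
Lemma trace h x d : h != 0 -> dotp x h = 0 -> dotp d h = 0 ->
  (forall t, 0 <= t -> t <= 1 -> x + t *: d != 0) ->
  (forall t m c, 0 <= t -> t <= 1 -> x + t *: d = c *: vQ m -> ordinary v m) ->
  (exists i j k k', [/\ broken (i, j, k, k'), in_plane h i j & on_wall i j x]) ->
  exists i j k k', [/\ broken (i, j, k, k'), in_plane h i j & on_wall i j (x + d)].
Proof.
move=> h0 xh dh n0 ord [i [j [k [k' [br hij xw]]]]].
(* The Boolean tags the reversed inequality, which is imposed at [k] and is the trivial [0 <= 0]
   elsewhere. *)
pose a z (w : 'I_n * 'I_n * 'I_n * 'I_n) (q : 'I_n * bool) : rat :=
  let: (i, j, k, k') := w in
  if q.2 then (if q.1 == k then - dotp z (b [set i; j; k] k) else 0) else dotp z (b [set i; j; k] q.1).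
pose B := [pred w : 'I_n * 'I_n * 'I_n * 'I_n | broken w & in_plane h w.1.1.1 w.1.1.2].
have aE i1 j1 k1 k1' t : broken (i1, j1, k1, k1') ->
    (forall q, 0 <= a x (i1, j1, k1, k1') q + t * a d (i1, j1, k1, k1') q) <-> on_wall i1 j1 (x + t *: d).
  move=> /brokenP[w _]; split=> [hq|/(on_wall_dual _ w)[w1 w2] [q []] /=].
  - apply/(on_wall_dual _ w); split=> [q|].
      by rewrite !dotpE; apply: (hq (q, false)).
    by have := hq (k1, true); rewrite /= eqxx mulrN -opprD oppr_ge0 !dotpE.
  - case: eqP => [_|_]; last by rewrite mulr0 addr0.
    by rewrite mulrN -opprD oppr_ge0 -dotpZl -dotpDl.
  - by rewrite -dotpZl -dotpDl.
have := @last_point rat _ _ B (a x) (a d); case.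
- exists (i, j, k, k'); first by apply/andP.
  by apply/aE => //; rewrite scale0r addr0.
- move=> t t0 t1 [[[[i1 j1] k1] k1'] /andP[br1 hij1] /(aE _ _ _ _ _ br1)[c1 [c2 [c10 c20 e]]]].
  suff [i2 [j2 [k2 [k2' [br2 hij2 [e' e'0 he']]]]]] : exists i2 j2 k2 k2',
      [/\ broken (i2, j2, k2, k2'), in_plane h i2 j2 &
       exists2 e, 0 < e & forall r, 0 <= r -> r <= e -> on_wall i2 j2 (x + t *: d + r *: d)].
    pose r := Order.min e' (1 - t).
    have r0 : 0 < r by rewrite lt_min e'0 subr_gt0.
    exists (t + r); split; first by rewrite ltrDl.
      by have : r <= 1 - t; [rewrite ge_min lexx orbT|lra].
    exists (i2, j2, k2, k2'); first by apply/andP.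
    apply/aE => //; rewrite scalerDl addrA; apply: he'; first exact: ltW.
    by rewrite ge_min lexx.
  have [c1z|c1z] := eqVneq c1 0.
    have c2z : 0 < c2.
      rewrite lt_neqAle c20 andbT; apply/eqP => c2z.
      by have := n0 t t0 (ltW t1); rewrite e c1z -c2z !scale0r addr0 eqxx.
    rewrite e (addrC (c1 *: _)); apply: (trace_step (k := k1) (k' := k1')) => //.
    - exact: broken_sym.
    - by move: hij1; rewrite /in_plane andbC.
    - by move=> _; apply: (ord t j1 c2 t0 (ltW t1)); rewrite e c1z scale0r add0r.
  have {}c1z : 0 < c1 by rewrite lt_neqAle eq_sym c1z.
  rewrite e; apply: (trace_step br1) => // c2z.
  by apply: (ord t i1 c1 t0 (ltW t1)); rewrite e c2z scale0r addr0.
- move=> [[[i1 j1] k1] k1'] /andP[br1 hij1] /(aE _ _ _ _ _ br1); rewrite scale1r => w1.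
  by exists i1, j1, k1, k1'.
Qed.

(* The functional [g] stays positive along the segment from the wall to [u], so the
   segment misses the origin and the special lines. *)
Lemma reach_pos h g i j k k' x u : h != 0 -> broken (i, j, k, k') -> in_plane h i j ->
  on_wall i j x -> dotp u h = 0 ->
  (forall m, m \in S -> dotp (vQ m) h != 0 \/ dotp (vQ m) g = 0) ->
  0 < dotp x g * dotp u g ->
  exists i j k k', [/\ broken (i, j, k, k'), in_plane h i j & on_wall i j u].
Proof.
move=> h0 br hij xw uh hS xu.
have xh : dotp x h = 0.
  by case: xw => c1 [c2 [_ _ ->]]; move: hij; rewrite !dotpE => /andP[/eqP-> /eqP->]; rewrite !mulr0 addr0.
have gt t : 0 <= t -> t <= 1 -> dotp (x + t *: (u - x)) g != 0.
  move=> t0 t1; have -> : dotp (x + t *: (u - x)) g = (1 - t) * dotp x g + t * dotp u g.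
    by rewrite !dotpE; ring.
  apply/eqP => e.
  have x0 : dotp x g != 0 by apply/eqP => z; rewrite z mul0r ltxx in xu.
  have : 0 < ((1 - t) * dotp x g + t * dotp u g) * dotp x g.
    rewrite mulrDl -!mulrA [dotp u g * _]mulrC.
    have x2 : 0 < dotp x g * dotp x g by rewrite -expr2 exprn_even_gt0.
    have [->|tn] := eqVneq t 0; first by rewrite subr0 mul1r mul0r addr0.
    apply: ltr_wpDl; first by rewrite mulr_ge0 ?subr_ge0 // ltW.
    by rewrite mulr_gt0 // lt_neqAle eq_sym tn.
  by rewrite e mul0r ltxx.
have ux : u = x + (u - x) by rewrite addrC subrK.
rewrite ux; apply: (trace h0 xh); rewrite ?dotpDl ?dotpNl ?uh ?xh ?subr0 //.
- move=> t t0 t1; apply: contraNneq (gt t t0 t1) => ->; by rewrite dotp0l.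
- move=> t m c t0 t1 e; apply: ordS; apply/negP => mS.
  have g0 := gt t t0 t1; case: (hS m mS) => hm; last by rewrite e dotpZl hm mulr0 eqxx in g0.
  have : dotp (x + t *: (u - x)) h = 0 by rewrite !dotpE uh xh subr0 mulr0 addr0.
  rewrite e dotpZl => /eqP; rewrite mulf_eq0 (negbTE hm) orbF => /eqP c0.
  by rewrite e c0 scale0r dotp0l eqxx in g0.
- by exists i, j, k, k'.
Qed.

Definition reachable h u := exists i j k k', [/\ broken (i, j, k, k'), in_plane h i j & on_wall i j u].

Lemma on_wall_l i j : on_wall i j (vQ i).
Proof. by exists 1, 0; rewrite scale1r scale0r addr0. Qed.

Lemma on_wall_r i j : on_wall i j (vQ j).
Proof. by apply: on_wallC; apply: on_wall_l. Qed.

(** Without special rays in the plane, any open half-plane may be crossed. An end of the wall not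
    collinear with [u] is selected, and [g] is built to equal 1 at this end and at [u]. *)
Lemma reach_free h i j k k' u : broken (i, j, k, k') -> h != 0 -> in_plane h i j -> dotp u h = 0 -> u != 0 ->
  (forall m, m \in S -> dotp (vQ m) h != 0) -> reachable h u.
Proof.
move=> br h0 hij uh u0 hS; have /brokenP[w _] := br.
have [_ [ii ij ji jj]] := wall_dual bP w.
have ue := decomp2 w h0 hij uh.
set ui := dotp u (b _ i) in ue; set uj := dotp u (b _ j) in ue.
have hS' g m : m \in S -> dotp (vQ m) h != 0 \/ dotp (vQ m) g = 0 by move=> /hS; left.
have [uj0|uj0] := eqVneq uj 0.
  have ui0 : ui != 0 by apply: contraNneq u0 => z; rewrite ue z uj0 !scale0r addr0.
  apply: (reach_pos (g := b [set i; j; k] j + ((1 - uj) / ui) *: b [set i; j; k] i) h0 br hij (on_wall_r i j) uh (hS' _)).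
  by rewrite !dotpE jj ji -/ui -/uj divfK // mulr0 addr0 mul1r addrC subrK.
apply: (reach_pos (g := b [set i; j; k] i + ((1 - ui) / uj) *: b [set i; j; k] j) h0 br hij (on_wall_l i j) uh (hS' _)).
by rewrite !dotpE ii ij -/ui -/uj divfK // mulr0 addr0 mul1r addrC subrK.
Qed.

(** The line of [v_m] cuts the plane into two halves. Some end of the wall is off this line, and its
    half contains [u] or [- u]. *)
Lemma reach_special h i j k k' u m : broken (i, j, k, k') -> h != 0 -> in_plane h i j -> dotp u h = 0 ->
  m \in S -> dotp (vQ m) h = 0 -> (forall c, u != c *: vQ m) -> reachable h u \/ reachable h (- u).
Proof.
move=> br h0 hij uh mS mh um; have /brokenP[w _] := br.
have [_ [ii ij ji jj]] := wall_dual bP w.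
have ue := decomp2 w h0 hij uh; have me := decomp2 w h0 hij mh.
set ui := dotp u (b _ i) in ue; set uj := dotp u (b _ j) in ue.
set mi := dotp _ (b _ i) in me; set mj := dotp _ (b _ j) in me.
(* The determinant with [v_m] in the basis [v_i], [v_j] of the plane. *)
pose g := mj *: b [set i; j; k] i - mi *: b [set i; j; k] j.
have mg : dotp (vQ m) g = 0 by rewrite /g !dotpE -/mi -/mj mulrC subrr.
have gi : dotp (vQ i) g = mj by rewrite /g !dotpE ii ij mulr1 mulr0 subr0.
have gj : dotp (vQ j) g = - mi by rewrite /g !dotpE jj ji mulr1 mulr0 sub0r.
have ug : dotp u g = mj * ui - mi * uj by rewrite /g !dotpE.
have hS g' : g' = g -> forall m', m' \in S -> dotp (vQ m') h != 0 \/ dotp (vQ m') g' = 0.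
  by move=> -> m' m'S; right; have [c ->] := parS mS m'S; rewrite dotpZl mg mulr0.
have uNh : dotp (- u) h = 0 by rewrite dotpNl uh oppr0.
have go x : on_wall i j x -> dotp x g != 0 -> dotp u g != 0 -> reachable h u \/ reachable h (- u).
  move=> xw xg ug0; have [p|p] := ltP 0 (dotp x g * dotp u g).
    by left; apply: (reach_pos h0 br hij xw uh (hS g _) p).
  right; apply: (reach_pos h0 br hij xw uNh (hS g _)) => //.
  by rewrite dotpNl mulrN oppr_gt0 lt_neqAle mulf_neq0.
have [mj0|mj0] := eqVneq mj 0.
  have mi0 : mi != 0.
    apply/eqP => mi0; have := vF_neq0 fan bP m.
    by rewrite me mi0 mj0 !scale0r addr0 eqxx.
  apply: (go _ (on_wall_r i j)); first by rewrite gj oppr_eq0.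
  rewrite ug mj0 mul0r sub0r oppr_eq0 mulf_neq0 //; apply: contraNneq (um (ui / mi)) => uj0.
  by rewrite ue me uj0 mj0 !scale0r !addr0 scalerA divfK.
apply: (go _ (on_wall_l i j)); first by rewrite gi.
rewrite ug subr_eq0; apply: contraNneq (um (uj / mj)) => e.
rewrite ue me scalerDr !scalerA divfK //; apply/eqP; congr (_ *: _ + _).
by apply: (mulfI mj0); rewrite e; field.
Qed.

(** The smallest face containing [q] belongs to both walls. If it is two-dimensional the walls
    coincide; if it is a ray, that ray is ordinary and [broken_unique] applies. *)
Lemma common_plane h h' q i j k k' i2 j2 k2 k2' : h != 0 -> h' != 0 ->
  broken (i, j, k, k') -> in_plane h i j -> broken (i2, j2, k2, k2') -> in_plane h' i2 j2 ->
  on_wall i j q -> on_wall i2 j2 q -> q != 0 -> (forall m c, m \in S -> q != c *: vQ m) ->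
  exists c, h' = c *: h.
Proof.
move=> h0 h'0.
have same i1 j1 k1 k1' : wall cones i1 j1 k1 k1' -> in_plane h i1 j1 -> in_plane h' i1 j1 -> exists c, h' = c *: h.
  move=> w /andP[/eqP hi /eqP hj] /andP[/eqP hi' /eqP hj'].
  have e := plane_eq bP w hi hj; have e' := plane_eq bP w hi' hj'.
  set c := dotp _ h in e; set c' := dotp _ h' in e'.
  have c0 : c != 0 by apply: contraNneq h0 => z; rewrite e z scale0r.
  by exists (c' / c); rewrite e e' scalerA divfK.
move=> br hij br2 hij2 [c1 [c2 [c10 c20 e]]] q2 q0 qS.
wlog c1p : i j k k' c1 c2 c10 c20 e br hij / 0 < c1.
  move=> wl; have [|c1z] := boolP (0 < c1); first exact: (wl i j k k' c1 c2).
  have c2p : 0 < c2.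
    move: c1z; rewrite lt_neqAle c10 andbT negbK => /eqP c1z.
    by rewrite lt_neqAle c20 andbT; apply: contraNneq q0 => c2z; rewrite e -c1z -c2z !scale0r addr0.
  apply: (wl j i k k' c2 c1) => //; [by rewrite addrC|exact: broken_sym|by rewrite /in_plane andbC].
have /brokenP[w _] := br; have /brokenP[w2 _] := br2.
have [sc _ _] := w; have [sc2 _ _] := w2.
have [[ik jk kk] [ii ij ji jj]] := wall_dual bP w.
have [q1s _] := (on_wall_dual q w).1 (ex_intro _ c1 (ex_intro _ c2 (And3 c10 c20 e))).
have [q2s q2k] := (on_wall_dual q w2).1 q2.
have {q2k} q2k : dotp q (b [set i2; j2; k2] k2) = 0 by apply/le_anti; rewrite q2k q2s.
have onw p : p \in [set i; j; k] -> dotp q (b [set i; j; k] p) != 0 -> p = i2 \/ p = j2.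
  move=> ps pq; have p2 := cone_supp fan bP sc sc2 q1s q2s pq.
  have p1 : dotp q (b [set i2; j2; k2] p) != 0 by rewrite -(coord_agree sc sc2).
  move: p2; rewrite !inE -orbA => /or3P[/eqP->|/eqP->|/eqP pk]; [by left|by right|].
  by rewrite pk q2k eqxx in p1.
have is_ : i \in [set i; j; k] by rewrite !inE eqxx.
have js : j \in [set i; j; k] by rewrite !inE eqxx orbT.
have qi : dotp q (b [set i; j; k] i) = c1 by rewrite e !dotpE ii ji mulr1 mulr0 addr0.
have qj : dotp q (b [set i; j; k] j) = c2 by rewrite e !dotpE ij jj mulr1 mulr0 add0r.
have i2' := onw i is_; rewrite qi gt_eqF // in i2'; have {i2'} i2' := i2' isT.
have hi2 : dotp (vQ i) h' == 0 by case: i2' => ->; case/andP: hij2.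
have [c2z|c2z] := eqVneq c2 0; last first.
  have j2' := onw j js; rewrite qj c2z in j2'; have {j2'} j2' := j2' isT.
  have hj2 : dotp (vQ j) h' == 0 by case: j2' => ->; case/andP: hij2.
  by apply: (same _ _ _ _ w hij); rewrite /in_plane hi2.
have ord : ordinary v i.
  by apply: ordS; apply/negP => iS; have := qS i c1 iS; rewrite e c2z scale0r addr0 eqxx.
have [i3 [k3 [k3' [br3 hij3]]]] : exists j3 k3 k3', broken (i, j3, k3, k3') /\ in_plane h' i j3.
  case: i2' => e2; first by exists j2, k2, k2'; rewrite e2.
  exists i2, k2, k2'; rewrite e2; split; first exact: broken_sym.
  by rewrite /in_plane andbC.
have [al [be vj3]] := broken_unique fan bP acyc ord br br3.
have /brokenP[w3 _] := br3; apply: (same _ _ _ _ w3) => //.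
case/andP: hij => hi hj; rewrite /in_plane hi vj3 !dotpE (eqP hi) (eqP hj).
by rewrite !mulr0 addr0 eqxx.
Qed.

Lemma nonzero_dual i j k k' : wall cones i j k k' ->
  b [set i; j; k] k != 0 /\ in_plane (b [set i; j; k] k) i j.
Proof.
move=> w; have [[ik jk kk] _] := wall_dual bP w; rewrite /in_plane ik jk eqxx; split=> //.
by apply/eqP => z; move: kk; rewrite z dotp0r => /eqP; rewrite eq_sym oner_eq0.
Qed.

(* Both walls propagate within their planes up to the common line of these planes, and
   no point off the special rays lies on two broken walls of different planes. *)
Lemma crossing i j k k' i2 j2 k2 k2' : broken (i, j, k, k') -> broken (i2, j2, k2, k2') ->
  let h := b [set i; j; k] k in let h' := b [set i2; j2; k2] k2 in
  (exists c, h' = c *: h) \/ exists2 m, m \in S & dotp (vQ m) h = 0 /\ dotp (vQ m) h' = 0.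
Proof.
move=> br br2 h h'; have /brokenP[w _] := br; have /brokenP[w2 _] := br2.
have [h0 hij] := nonzero_dual w; have [h'0 hij2] := nonzero_dual w2.
have [m /and3P[mS /eqP mh /eqP mh']|none] :=
  pickP (fun m => [&& m \in S, dotp (vQ m) h == 0 & dotp (vQ m) h' == 0]).
  by right; exists m.
left; have [u [u0 hu hu']] := perp2 h h'.
have uh : dotp u h = 0 by rewrite dotpC.
have uh' : dotp u h' = 0 by rewrite dotpC.
have uS m c : m \in S -> u != c *: vQ m.
  move=> mS; apply/eqP => ue; have c0 : c != 0 by apply: contraNneq u0 => c0; rewrite ue c0 scale0r.
  have := none m; rewrite mS /=; move: uh uh'; rewrite ue !dotpZl => /eqP + /eqP.
  by rewrite !mulf_eq0 (negbTE c0) /= => -> ->.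
have NuS m c : m \in S -> - u != c *: vQ m.
  by move=> mS; rewrite -eqr_opp opprK -scaleNr uS.
have Nu0 : - u != 0 by rewrite oppr_eq0.
have Nuh : dotp (- u) h = 0 by rewrite dotpNl uh oppr0.
have Nuh' : dotp (- u) h' = 0 by rewrite dotpNl uh' oppr0.
have fin q : q != 0 -> (forall m c, m \in S -> q != c *: vQ m) -> reachable h q -> reachable h' q ->
    exists c, h' = c *: h.
  move=> q0 qS [a1 [a2 [a3 [a4 [bra ha qa]]]]] [d1 [d2 [d3 [d4 [brd hd qd]]]]].
  exact: (common_plane h0 h'0 bra ha brd hd qa qd).
(* Special rays share one line, which does not lie in both planes. The plane avoiding it reaches
   both [u] and [- u], so it suffices that the other one reaches either. *)
have [m0 /andP[m0S /eqP m0h]|free] := pickP (fun m => (m \in S) && (dotp (vQ m) h == 0)); last first.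
  have free' m : m \in S -> dotp (vQ m) h != 0 by move=> mS; have := free m; rewrite mS /= => /negbT.
  have [m0 /andP[m0S /eqP m0h']|free2] := pickP (fun m => (m \in S) && (dotp (vQ m) h' == 0)).
    case: (reach_special br2 h'0 hij2 uh' m0S m0h' (fun c => uS m0 c m0S)) => r'.
      by apply: (fin u) => //; apply: (reach_free br).
    by apply: (fin (- u)) => //; apply: (reach_free br).
  have free2' m : m \in S -> dotp (vQ m) h' != 0 by move=> mS; have := free2 m; rewrite mS /= => /negbT.
  by apply: (fin u) => //; [apply: (reach_free br)|apply: (reach_free br2)].
have free2 m : m \in S -> dotp (vQ m) h' != 0.
  move=> mS; have [c e] := parS mS m0S.
  have := none m0; rewrite m0S m0h eqxx /= => /negbT; apply: contraNneq => z.
  by rewrite e dotpZl z mulr0.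
case: (reach_special br h0 hij uh m0S m0h (fun c => uS m0 c m0S)) => r'.
  by apply: (fin u) => //; apply: (reach_free br2).
by apply: (fin (- u)) => //; apply: (reach_free br2).
Qed.

(** Either all planes contain the [v_i] of a first broken wall, or some plane does not. Then
    [crossing] gives a special ray in both; a further plane equals the first one or contains a
    special ray too, necessarily on the same line. *)
Lemma common_direction : exists2 u : 'rV[rat]_3, u != 0 &
  forall i j k k', broken (i, j, k, k') -> dotp u (b [set i; j; k] k) = 0.
Proof.
have [[[[i j] k] k'] br|nobr] := pickP broken; last first.
  exists (const_mx 1); last by move=> i j k k'; rewrite nobr.
  by apply/eqP => /rowP/(_ 0); rewrite !mxE => /eqP; rewrite oner_eq0.
have /brokenP[w _] := br; have [h0 hij] := nonzero_dual w.
set h := b _ k in h0 hij.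
pose indep (x : 'I_n * 'I_n * 'I_n * 'I_n) :=
  broken x && (dotp (vQ i) (b [set x.1.1.1; x.1.1.2; x.1.2] x.1.2) != 0).
have [[[[i2 j2] k2] k2'] /andP[br2 /= ind]|allsame] := pickP indep; last first.
  exists (vQ i); first exact: (vF_neq0 fan bP).
  move=> i3 j3 k3 k3' br3; have := allsame (i3, j3, k3, k3').
  by rewrite /indep br3 /= => /negbFE/eqP.
set h2 := b _ k2 in ind.
case: (crossing br br2) => [[c e]|[m mS [mh mh2]]].
  by move: ind; rewrite /h2 e dotpZr; case/andP: hij => /eqP-> _; rewrite mulr0 eqxx.
exists (vQ m); first exact: (vF_neq0 fan bP).
move=> i3 j3 k3 k3' br3.
case: (crossing br br3) => [[c ->]|[m' m'S [m'h m'h3]]]; first by rewrite dotpZr mh mulr0.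
by have [c ->] := parS m'S mS; rewrite dotpZl m'h3 mulr0.
Qed.

(** Adjacent gradients agree on the plane of their wall, which contains [u] if the wall is broken;
    they are equal if it is not. All maximal cones are linked by such steps. *)
Lemma grad_direction : exists2 u : 'rV[rat]_3, u != 0 &
  forall s t, s \in cones -> t \in cones -> dotp (toK u) (grad s) = dotp (toK u) (grad t).
Proof.
have [u u0 hu] := common_direction; exists u => // s t sc tc.
apply/eqP; rewrite eq_sym.
apply: (dual_connected fan bP (Q := fun t => dotp (toK u) (grad t) == dotp (toK u) (grad s))) sc tc (eqxx _).
move=> s1 t1 k s1c t1c ts ks st /eqP <-.
have [kt [m [mt ms tm _]]] := wall_third fan s1c t1c ts ks st.
have [j js] : exists j, j \in s1 :\ k.
  by apply/set0Pn; rewrite -card_gt0; have := cardsD1 k s1; rewrite ks (card_cone fan s1c) add1n => -[<-].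
have /setD1P[jk js1] := js.
have jt : j \in t1 by apply: (subsetP st).
have [i [is1 ij ik se]] := cone_thirds fan s1c js1 ks jk.
have it : i \in t1 by apply: (subsetP st); rewrite !inE ik.
have te : t1 = [set i; j; m].
  apply/eqP; rewrite eq_sym eqEcard (card_cone fan t1c) !subUset !sub1set it jt mt /=.
  rewrite -setUA cardsU1 cards2 !inE negb_or ij.
  have -> : i != m by apply: contraNneq ms => <-.
  by have -> : j != m by apply: contraNneq ms => <-.
have W : wall cones i j k m.
  split; rewrite -?se -?te //= !inE !negb_or ij ik jk /=.
  have -> : i != m by apply: contraNneq ms => <-.
  have -> : j != m by apply: contraNneq ms => <-.
  by have -> : k != m by apply: contraNneq ms => <-.
have gs p : p \in s1 -> dotp (vK p) (grad s1) = y p by apply: (dotp_grad bP).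
have gt p : p \in t1 -> dotp (vK p) (grad t1) = y p by apply: (dotp_grad bP).
have ud z : dotp (toK u) z = ratr (dotp u (b s1 i)) * dotp (vK i) z +
    ratr (dotp u (b s1 j)) * dotp (vK j) z + ratr (dotp u (b s1 k)) * dotp (vK k) z.
  rewrite {1}(decomp3 bP u W) -!se !raddfD /= !map_mxZ !(realize_ratr K) !dotpE; by [].
have gsm : dotp (vK m) (grad s1) = ratr (dotp (vQ m) (b s1 i)) * y i + ratr (dotp (vQ m) (b s1 j)) * y j +
    ratr (dotp (vQ m) (b s1 k)) * y k by rewrite (dotp3 bP m _ W) -!se !gs.
have [br|nbr] := boolP (broken (i, j, k, m)).
  by rewrite !ud; have := hu _ _ _ _ br; rewrite -se => ->; rewrite rmorph0 !mul0r !gs // !gt.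
have ym : y m = dotp (vK m) (grad s1).
  by apply/eqP; apply: contraNT nbr => nbr; apply/brokenP; rewrite -se.
suff -> : grad t1 = grad s1 by [].
apply/eqP; rewrite -subr_eq0; apply/eqP.
have z p : p \in t1 -> dotp (vK p) (grad t1 - grad s1) = 0.
  move=> pt; rewrite dotpDr dotpNr gt //; have := pt; rewrite {1}te !inE.
  by move=> /orP[/orP[]|] /eqP->; rewrite -?ym ?gs ?subrr.
have full p : dotp (vK p) (grad t1 - grad s1) = 0.
  by rewrite (dotp_decompK bP p _ t1c) big1 // => q /z->; rewrite mulr0.
apply/rowP => a; rewrite [RHS]mxE.
have : dotp (toK (delta_mx 0 a)) (grad t1 - grad s1) = 0.
  rewrite (decomp bP (delta_mx 0 a) t1c) (raddf_sum (map_mx ratr)) dotp_suml big1 // => q _.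
  by rewrite /= map_mxZ (realize_ratr K) dotpZl full mulr0.
rewrite map_delta_mx /dotp (bigD1 a) //= big1 ?addr0 => [|q /negbTE qa]; rewrite mxE eqxx ?eqxx ?mul1r //.
by rewrite eq_sym in qa *; rewrite ?qa ?mul0r // eq_sym qa mul0r.
Qed.

End Trace.

(** * Reduced simplicial homology *)

Section Homology.
Variables (F : numFieldType) (n : nat).
Implicit Types (J G I : {set 'I_n}) (K : {set {set 'I_n}}).

Definition below J (x : 'I_n) : nat := #|[set y in J | (y < x)%N]|.

Lemma bcoefE J I : bcoef F J I = \sum_(x in J | J :\ x == I) (-1) ^+ below J x.
Proof.
rewrite /bcoef; case: ifPn => [/andP[IJ /eqP c]|h].
  apply: eq_bigl => x; rewrite inE andbC; have [xJ|//] /= := boolP (x \in J).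
  apply/idP/eqP => [xI|<-]; last by rewrite !inE eqxx.
  apply/eqP; rewrite eq_sym eqEcard; apply/andP; split.
    by apply/subsetP => p pI; rewrite !inE (subsetP IJ) // andbT; apply: contraNneq xI => <-.
  by have := cardsD1 x J; rewrite xJ c; lia.
rewrite big1 // => x /andP[xJ /eqP e]; move: h; rewrite -e subsetDl /=.
by rewrite (cardsD1 x J) xJ eqxx.
Qed.

Lemma bcoef_neq0 J I : I \subset J -> #|J| = #|I|.+1 -> bcoef F J I != 0.
Proof.
move=> IJ c; rewrite /bcoef IJ c eqxx /=.
have : #|J :\: I| == 1%N by rewrite cardsD (setIidPr IJ) c; apply/eqP; lia.
by case/cards1P => x ->; rewrite big_set1 signr_eq0.
Qed.

Lemma sum_faces (V : nmodType) K s (f : {set 'I_n} -> V) :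
  \sum_(k < size (faces K s)) f (nth set0 (faces K s) k) = \sum_(G in K | #|G| == s) f G.
Proof.
transitivity (\sum_(G <- faces K s) f G); first by rewrite (big_nth set0) big_mkord.
by rewrite big_filter big_enum_cond.
Qed.

Lemma size_faces K s : size (faces K s) = (\sum_(G in K | #|G| == s) 1)%N.
Proof. by rewrite -sum_faces sum_nat_const card_ord muln1. Qed.

Lemma nth_faces K s (k : 'I_(size (faces K s))) :
  (nth set0 (faces K s) k \in K) /\ #|nth set0 (faces K s) k| = s.
Proof.
have := mem_nth set0 (ltn_ord k); rewrite mem_filter mem_enum => /andP[/eqP]; by [].
Qed.

Lemma faces_uniq K s (k k' : 'I_(size (faces K s))) :
  (nth set0 (faces K s) k == nth set0 (faces K s) k') = (val k == val k').
Proof. by rewrite nth_uniq // filter_uniq // enum_uniq. Qed.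

Lemma faces_nth K J : J \in K -> exists k : 'I_(size (faces K #|J|)), nth set0 (faces K #|J|) k = J.
Proof.
move=> JK; have h : J \in faces K #|J| by rewrite mem_filter eqxx mem_enum.
have i : (index J (faces K #|J|) < size (faces K #|J|))%N by rewrite index_mem.
by exists (Ordinal i); rewrite nth_index.
Qed.

Definition down_closed K := forall J I, J \in K -> I \subset J -> I \in K.

Lemma sum_bcoef K s J (f : {set 'I_n} -> F) : down_closed K -> J \in K -> #|J| = s.+1 ->
  \sum_(G in K | #|G| == s) bcoef F J G * f G = \sum_(x in J) (-1) ^+ below J x * f (J :\ x).
Proof.
move=> dK JK Js.
under eq_bigr do rewrite bcoefE mulr_suml.
rewrite (exchange_big_dep (mem J)) /=; last by move=> G x _ /andP[].
apply: eq_bigr => x xJ; rewrite (bigD1 (J :\ x)) /=; last first.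
  have Jx : #|J :\ x| = s by have := cardsD1 x J; rewrite xJ Js add1n => -[].
  by rewrite (dK J) ?subsetDl // xJ Jx !eqxx.
rewrite big1 ?addr0 // => G /andP[/andP[_ /andP[_ /eqP ->]]]; by rewrite eqxx.
Qed.

Lemma below_anti J x y : x \in J -> y \in J -> x != y ->
  (-1) ^+ below J x * (-1) ^+ below (J :\ x) y = - ((-1) ^+ below J y * (-1) ^+ below (J :\ y) x) :> F.
Proof.
wlog xy : x y / (x < y)%N.
  move=> wl xJ yJ xy; have [h|h|h] := ltngtP x y; first exact: wl.
    by rewrite (wl y x h) ?opprK // eq_sym.
  by case/eqP: xy; apply: val_inj.
move=> xJ yJ _.
have -> : below (J :\ y) x = below J x.
  apply: eq_card => z; rewrite !inE; have [->|//] := eqVneq z y.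
  by rewrite [(y < x)%N]ltnNge (ltnW xy) !andbF.
have -> : below J y = (below (J :\ x) y).+1.
  rewrite /below (cardsD1 x) !inE xJ xy add1n; congr _.+1.
  by apply: eq_card => z; rewrite !inE andbA.
by rewrite exprS mulN1r mulNr opprK mulrC.
Qed.

Lemma bdry_bdry K s : down_closed K -> bdry F K s.+2 *m bdry F K s.+1 = 0.
Proof.
move=> dK; apply/matrixP => i j; rewrite !mxE.
set J := nth set0 (faces K s.+2) i; set I := nth set0 (faces K s.+1.-1) j.
have [JK Js] := nth_faces i; rewrite -/J in JK Js.
transitivity (\sum_(G in K | #|G| == s.+1) bcoef F J G * bcoef F G I).
  by rewrite -sum_faces; apply: eq_bigr => k _; rewrite !mxE.
rewrite (sum_bcoef _ dK JK Js).
under eq_bigr do rewrite bcoefE mulr_sumr.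
set T := \sum_(_ in J) _.
(* Deleting [x] then [y] and deleting [y] then [x] carry opposite signs; characteristic zero turns
   [T = - T] into [T = 0]. *)
suff TN : T = - T.
  by apply/eqP; move/eqP: TN; rewrite -addr_eq0 -mulr2n mulrn_eq0.
have -> : T = \sum_(x in J) \sum_(y in J | (y != x) && (J :\ x :\ y == I))
    (-1) ^+ below J x * (-1) ^+ below (J :\ x) y.
  by apply: eq_bigr => x xJ; apply: eq_bigl => y; rewrite !inE; case: (y \in J); rewrite ?andbT ?andbF.
rewrite {1}(exchange_big_dep (mem J)) /=; last by move=> x y _ /andP[].
rewrite -sumrN; apply: eq_bigr => x xJ; rewrite -sumrN.
apply: eq_big => [y|y /and4P[yJ _ xy _]]; last by apply: below_anti; rewrite // eq_sym.
have -> : J :\ y :\ x = J :\ x :\ y by rewrite !setDDl setUC.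
by rewrite xJ /= [x == y]eq_sym.
Qed.

(** As [0.-1] is [0], the columns are indexed by the empty face too, and the cardinality test in
    [bcoef] makes the matrix zero. *)
Lemma rank_bdry0 K : \rank (bdry F K 0) = 0%N.
Proof.
apply/eqP; rewrite mxrank_eq0; apply/eqP/matrixP => i j; rewrite !mxE /bcoef.
have [_ ->] := nth_faces i; have [_ /= h] := nth_faces j; by rewrite h andbF.
Qed.

Lemma rank_bdry_le K s : down_closed K -> (\rank (bdry F K s) + \rank (bdry F K s.+1) <= size (faces K s))%N.
Proof.
move=> dK; case: s => [|s]; first by rewrite rank_bdry0 rank_leq_col.
by rewrite addnC; apply: mulmx0_rank_max; apply: bdry_bdry.
Qed.

Lemma faces_big K s : (forall J, J \in K -> (#|J| <= 3)%N) -> (3 < s)%N -> size (faces K s) = 0%N.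
Proof.
move=> c3 s3; rewrite size_faces big1 // => G /andP[/c3 h /eqP e]; by rewrite e leqNgt s3 in h.
Qed.

(** The truncated subtraction in [rbetti_s] gives only one inequality between face numbers and
    ranks; [rank_bdry_le] gives the other. The ranks then cancel in the alternating sum. *)
Lemma euler_of_acyclic K : down_closed K -> (forall J, J \in K -> (#|J| <= 3)%N) ->
  (forall s, (s <= 3)%N -> rbetti_s F K s = 0%N) ->
  (size (faces K 0) + size (faces K 2) = size (faces K 1) + size (faces K 3))%N.
Proof.
move=> dK c3 b0.
have e s : (s <= 3)%N -> size (faces K s) = (\rank (bdry F K s) + \rank (bdry F K s.+1))%N.
  move=> s3; apply/eqP; rewrite eqn_leq rank_bdry_le // andbT.
  by move/eqP: (b0 s s3); rewrite /rbetti_s -subnDA subn_eq0.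
have r4 : \rank (bdry F K 4) = 0%N.
  by apply/eqP; rewrite -leqn0; apply: leq_trans (rank_leq_row _) _; rewrite faces_big.
move: (e 0%N isT) (e 1%N isT) (e 2%N isT) (e 3%N isT); rewrite rank_bdry0 r4.
move: (\rank (bdry F K 1)) (\rank (bdry F K 2)) (\rank (bdry F K 3)) => r1 r2 r3.
move: (size _) (size _) (size _) (size _) => f0 f1 f2 f3; clear; lia.
Qed.

(** A vertex gives rank at least 1 in degree 1, connectedness bounds the rank in degree 2 from
    below, and absence of 2-cycles makes degree 3 injective. The Euler relation then settles the
    remaining middle homology. *)
Lemma rbetti_eq0 K : down_closed K -> (forall J, J \in K -> (#|J| <= 3)%N) ->
  set0 \in K -> (exists a, [set a] \in K) ->
  (forall z : 'I_n -> F, (forall a b, a != b -> [set a; b] \in K -> z a = z b) ->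
     forall a b, [set a] \in K -> [set b] \in K -> z a = z b) ->
  (forall z : {set 'I_n} -> F,
     (forall G, G \in K -> #|G| = 2%N -> \sum_(J in K | #|J| == 3%N) z J * bcoef F J G = 0) ->
     forall J, J \in K -> #|J| = 3%N -> z J = 0) ->
  (size (faces K 0) + size (faces K 2) = size (faces K 1) + size (faces K 3))%N ->
  forall d, rbetti F K d = 0%N.
Proof.
move=> dK c3 K0 [a0 a0K] conn cyc eul d.
rewrite /rbetti; case: ifP => // _; move: (absz _) => s {d}.
have f0 : size (faces K 0) = 1%N.
  rewrite size_faces (bigD1 set0) /=; last by rewrite K0 cards0.
  by rewrite big1 // => G /andP[/andP[_]]; rewrite cards_eq0 => ->.
have r1 : (0 < \rank (bdry F K 1))%N.
  rewrite lt0n mxrank_eq0; apply/eqP => /matrixP.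
  have [i hi] := faces_nth a0K; have [j hj] := faces_nth K0.
  rewrite cards1 in i hi; rewrite cards0 in j hj.
  move=> /(_ i j); rewrite !mxE /= hi hj => /eqP; apply/negP; apply: bcoef_neq0; rewrite ?sub0set //.
  by rewrite cards1 cards0.
have r2 : (size (faces K 1) <= (\rank (bdry F K 2)).+1)%N.
  have rk := mxrank_ker (bdry F K 2)^T; rewrite mxrank_tr /= in rk.
  rewrite -[X in (_ <= X)%N]addn1 -leq_subLR -rk.
  suff h : (kermx (bdry F K 2)^T <= (const_mx 1 : 'rV_(size (faces K 2.-1))))%MS.
    exact: leq_trans (mxrankS h) (rank_leq_row _).
  apply/rV_subP => z /sub_kermxP hz.
  (* Row vectors are indexed by the enumeration of faces; [zz] reads them as functions of vertices,
     with default 0 off the complex. *)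
  pose zz (a : 'I_n) : F := if [pick k : 'I_(size (faces K 1)) | nth set0 (faces K 1) k == [set a]] is Some k then z 0 k else 0.
  have zzE (k : 'I_(size (faces K 1))) a : nth set0 (faces K 1) k = [set a] -> zz a = z 0 k.
    move=> ka; rewrite /zz; case: pickP => [k' /eqP k'a|/(_ k)]; last by rewrite ka eqxx.
    congr (z 0 _); apply: val_inj; apply/eqP.
    by rewrite -(faces_uniq k' k) k'a ka.
  have zc : forall a b, [set a] \in K -> [set b] \in K -> zz a = zz b.
    apply: conn => a b ab abK.
    have [e he] := faces_nth abK; have ab2 : #|[set a; b]| = 2%N by rewrite cards2 ab.
    rewrite ab2 in e he.
    have h0 := congr1 (fun M : 'rV_ _ => M 0 e) hz; rewrite !mxE in h0.
    pose f (G : {set 'I_n}) : F := if [pick x in G] is Some x then zz x else 0.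
    have fE x : f [set x] = zz x.
      by rewrite /f; case: pickP => [y /set1P->//|/(_ x)]; rewrite set11.
    have : \sum_(G in K | #|G| == 1%N) bcoef F [set a; b] G * f G = 0.
      rewrite -[RHS]h0 -sum_faces; apply: eq_bigr => k _; rewrite !mxE he mulrC; congr (_ * _).
      have [_ /eqP/cards1P[x hx]] := nth_faces k.
      by rewrite hx fE (zzE k).
    rewrite (sum_bcoef _ dK abK ab2) big_setU1 ?inE //= big_set1.
    have -> : [set a; b] :\ a = [set b] by rewrite setU1K // inE.
    have -> : [set a; b] :\ b = [set a] by rewrite setUC setU1K // inE eq_sym.
    have := below_anti (J := [set a; b]) (x := a) (y := b).
    rewrite !inE !eqxx orbT => /(_ isT isT ab).
    have -> : [set a; b] :\ a = [set b] by rewrite setU1K // inE.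
    have -> : [set a; b] :\ b = [set a] by rewrite setUC setU1K // inE eq_sym.
    have bx x : below [set x] x = 0%N.
      by apply: eq_card0 => q; rewrite !inE; case: eqP => // ->; rewrite ltnn.
    rewrite !bx !mulr1 !fE => ->; rewrite mulNr addrC -mulrBr => /eqP.
    by rewrite mulf_eq0 signr_eq0 /= subr_eq0 => /eqP.
  apply/sub_rVP; exists (zz a0); apply/rowP => k; rewrite !mxE mulr1.
  have [kK /eqP/cards1P[x hx]] := nth_faces k.
  by rewrite -(zzE k x hx); apply: zc; rewrite // -hx.
have r3 : \rank (bdry F K 3) = size (faces K 3).
  apply/eqP; rewrite -/(row_free _) -kermx_eq0; apply/rowV0P => z /sub_kermxP hz.
  pose zz (J : {set 'I_n}) : F := if [pick k : 'I_(size (faces K 3)) | nth set0 (faces K 3) k == J] is Some k then z 0 k else 0.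
  have zzE (k : 'I_(size (faces K 3))) : zz (nth set0 (faces K 3) k) = z 0 k.
    rewrite /zz; case: pickP => [k' /eqP k'a|/(_ k)]; last by rewrite eqxx.
    congr (z 0 _); apply: val_inj; apply/eqP.
    by rewrite -(faces_uniq k' k) k'a.
  apply/rowP => k; rewrite [RHS]mxE -zzE; have [kK k3] := nth_faces k.
  apply: cyc => // G GK G2; have [g hg] := faces_nth GK; rewrite G2 in g hg.
  have h0 := congr1 (fun M : 'rV_ _ => M 0 g) hz; rewrite !mxE in h0.
  rewrite -[RHS]h0 -sum_faces; apply: eq_bigr => k1 _; by rewrite zzE mxE hg.
apply/eqP; rewrite /rbetti_s -subnDA subn_eq0.
case: s => [|[|[|[|s]]]].
- by apply: leq_trans (_ : (1 <= _)%N); [rewrite f0|apply: leq_trans r1 (leq_addl _ _)].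
- by apply: leq_trans r2 _; rewrite -add1n leq_add2r.
- move: eul r2 f0; rewrite r3; move: (\rank (bdry F K 2)).
  move: (size (faces K 0)) (size (faces K 1)) (size (faces K 2)) (size (faces K 3)); clear; lia.
- by rewrite r3 leq_addr.
- by rewrite (leq_trans (_ : _ <= 0)%N) // faces_big.
Qed.

End Homology.

(** * Acyclicity of invariant sign sets *)

Lemma sum_sign_sizes n (K : {set {set 'I_n}}) : (forall J, J \in K -> (#|J| <= 3)%N) ->
  \sum_(J in K) (-1) ^+ #|J| =
  (size (faces K 0))%:Z - (size (faces K 1))%:Z + (size (faces K 2))%:Z - (size (faces K 3))%:Z.
Proof.
move=> c3.
have -> : \sum_(J in K) (-1) ^+ #|J| = \sum_(s < 4) (size (faces K s))%:Z * (-1) ^+ s :> int.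
  rewrite (partition_big (fun J : {set 'I_n} => inord #|J| : 'I_4) xpredT) //=.
  apply: eq_bigr => s _; rewrite size_faces -[(\sum_(_ in _ | _) _)%:Z]natz natr_sum mulr_suml.
  apply: eq_big => [J|J /andP[JK /eqP <-]]; last by rewrite inordK ?mul1r // ltnS c3.
  have [JK|//] /= := boolP (J \in K).
  apply/eqP/eqP => [<-|e]; first by rewrite inordK // ltnS c3.
  by apply: val_inj; rewrite /= inordK e.
rewrite !big_ord_recr big_ord0 /=; ring.
Qed.

(** Adding or removing [k] is a sign-reversing involution of the interval. *)
Lemma interval_sum0 (T : finType) (N Y : {set T}) k : k \in Y -> k \notin N ->
  \sum_(J : {set T} | (N \subset J) && (J \subset Y)) (-1) ^+ #|J| = 0 :> int.
Proof.
move=> kY kN; set S := \sum_(_ | _) _.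
suff : S = - S by lia.
pose h (J : {set T}) := if k \in J then J :\ k else k |: J.
have hK : involutive h.
  move=> J; rewrite /h; have [kJ|kJ] := boolP (k \in J); first by rewrite setD11 setD1K.
  by rewrite setU11 setU1K.
rewrite {1}/S (reindex_inj (inv_inj hK)) -sumrN; apply: eq_big => [J|J _]; rewrite /h.
  have [kJ|kJ] := boolP (k \in J).
    rewrite subsetD1 kN andbT -[in RHS](setD1K kJ) [in RHS]subUset sub1set kY /=.
    by rewrite setD1K.
  rewrite subUset sub1set kY /=; congr (_ && _); apply/idP/idP => [/subsetP h1|h1].
    apply/subsetP => x xN; have := h1 x xN; rewrite !inE => /orP[/eqP e|//].
    by rewrite -e xN in kN.
  exact: subset_trans h1 (subsetUr _ _).
have [kJ|kJ] := boolP (k \in J).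
  by rewrite [in RHS](cardsD1 k) kJ exprS mulN1r opprK.
by rewrite cardsU1 kJ exprS mulN1r.
Qed.

Section Acyclic.
Variables (F : realFieldType) (n : nat) (v : 'I_n -> 'rV[int]_3) (cones : {set {set 'I_n}}).
Hypothesis fan : complete_simplicial_stacky_fan F v cones.
Variable b : {set 'I_n} -> 'I_n -> 'rV[F]_3.
Hypothesis bP : dual_basis v cones b.

Local Notation vF k := (realize F (v k)).
Local Notation "x \inC s" := (forall k, 0 <= dotp x (b s k)) (at level 70).

(* Moving from the relative interior of a face [J] in a generic direction [d] leads into
   the interior of exactly one maximal cone. *)
Lemma unique_entered_cone d J : (forall s k, s \in cones -> k \in s -> dotp d (b s k) != 0) ->
  J \in faceset cones ->
  (\sum_(s in cones | ([set k in s | (dotp d (b s k) < 0)%R] \subset J) && (J \subset s)) 1 = 1)%N.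
Proof.
move=> dn /facesetP[s0 s0c Js0].
have [s sc [e e0 [hk he]]] := eventual_at fan bP d s0c (sum_in_cone bP s0c Js0).
have Js : J \subset s.
  by apply/subsetP => p pJ; apply: hk; rewrite (dotp_sum_sub bP) // pJ oner_eq0.
have Ns : [set k in s | dotp d (b s k) < 0] \subset J.
  apply/subsetP => p; rewrite inE => /andP[ps dp]; apply: contraLR dp => pJ; rewrite -leNgt.
  have := he e (ltW e0) (lexx e) p; rewrite !dotpE (dotp_sum_sub bP) // (negbTE pJ) add0r.
  by rewrite pmulr_rge0.
rewrite (bigD1 s) ?sc ?Ns //= big1 // => t /andP[/andP[tc /andP[Nt Jt]] ts]; exfalso.
have inn u : u \in cones -> J \subset u -> [set k in u | dotp d (b u k) < 0] \subset J ->
    exists2 e, 0 < e & forall r, 0 < r -> r <= e -> forall k, k \in u -> 0 < dotp (\sum_(k in J) vF k + r *: d) (b u k).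
  move=> uc Ju Nu.
  have [e1 e10 he1] := small_step (fun k => (k \in J)%:R : F) (fun k => dotp d (b u k)).
  exists e1 => // r r0 re k ku; rewrite !dotpE (dotp_sum_sub bP) //.
  have [kJ|kJ] := boolP (k \in J).
    have := he1 r (ltW r0) re k; rewrite kJ oner_eq0 sgr1 => /(_ isT) h.
    by rewrite -sgr_gt0 h ltr01.
  rewrite add0r mulr_gt0 // lt_neqAle eq_sym dn //= leNgt; apply: contra kJ => h.
  by apply: (subsetP Nu); rewrite inE ku.
have [e1 e10 h1] := inn s sc Js Ns; have [e2 e20 h2] := inn t tc Jt Nt.
pose r := Order.min e1 e2.
have r0 : 0 < r by rewrite lt_min e10.
have re1 : r <= e1 by rewrite ge_min lexx.
have re2 : r <= e2 by rewrite ge_min lexx orbT.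
have {}h1 := h1 r r0 re1; have {}h2 := h2 r r0 re2.
have inu u : u \in cones -> (forall k, k \in u -> 0 < dotp (\sum_(k in J) vF k + r *: d) (b u k)) ->
    (\sum_(k in J) vF k + r *: d) \inC u.
  move=> uc hu k; have [/hu/ltW//|ku] := boolP (k \in u).
  by rewrite (dual_out bP) // dotp0r.
case/eqP: ts; apply/eqP; rewrite eq_sym eqEcard !(card_cone fan) // leqnn andbT.
apply/subsetP => k ks; apply: (cone_supp fan bP sc tc (inu s sc h1) (inu t tc h2)).
by rewrite gt_eqF // h1.
Qed.

(** The faces in [X] charged to [s] form the Boolean interval from the negative set of [d] to
    [s :&: X]. Its alternating sum is zero unless both ends coincide. *)
Lemma echi_generic d (X : {set 'I_n}) : (forall s k, s \in cones -> k \in s -> dotp d (b s k) != 0) ->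
  (forall s, s \in cones -> [set k in s | dotp d (b s k) < 0] != s :&: X) -> echi cones X = 0.
Proof.
move=> dn hX; rewrite /echi.
rewrite (eq_bigr (fun J : {set 'I_n} => \sum_(s in cones |
    ([set k in s | dotp d (b s k) < 0] \subset J) && (J \subset s)) (-1) ^+ #|J|)); last first.
  move=> J /andP[Jf _]; rewrite sumr_const -[LHS]mulr1n; congr (_ *+ _).
  by rewrite -sum1_card; rewrite -[LHS](unique_entered_cone dn Jf); apply: eq_bigl => s.
rewrite (exchange_big_dep (mem cones)) /=; last by move=> J s _ /andP[].
apply: big1 => s sc.
rewrite (eq_bigl (fun J : {set 'I_n} => ([set k in s | dotp d (b s k) < 0] \subset J) && (J \subset s :&: X))); last first.
  move=> J; rewrite sc /= subsetI; have [Js|] := boolP (J \subset s); last by rewrite !andbF.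
  have -> : J \in faceset cones by apply/facesetP; exists s.
  by rewrite andbT andbC.
have [sub|nsub] := boolP ([set k in s | dotp d (b s k) < 0] \subset s :&: X).
  have /subsetPn[k kY kN] : ~~ (s :&: X \subset [set k in s | dotp d (b s k) < 0]).
    by apply: contra (hX s sc) => h; rewrite eqEsubset sub.
  exact: interval_sum0 kY kN.
by apply: big_pred0 => J; apply: contraNF nsub => /andP[]; apply: subset_trans.
Qed.

Variables (y : 'I_n -> F) (l : {set 'I_n} -> 'rV[F]_3).
Hypothesis ly : forall s k, s \in cones -> k \in s -> dotp (vF k) (l s) = y k.

Lemma pl_agree s t x : s \in cones -> t \in cones -> x \inC s -> x \inC t ->
  dotp x (l s) = dotp x (l t).
Proof.
move=> sc tc xs xt; rewrite (dotp_decomp bP x (l t) sc) (dotp_decomp bP x (l s) sc).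
apply: eq_bigr => k ks; have [->|k0] := eqVneq (dotp x (b s k)) 0; first by rewrite !mul0r.
by rewrite !ly // (cone_supp fan bP sc tc xs xt k0).
Qed.

Lemma pl_pos s x : s \in cones -> x \inC s -> 0 < dotp x (l s) ->
  exists k, [/\ k \in s, 0 < dotp x (b s k) & 0 < y k].
Proof.
move=> sc xs; rewrite (dotp_decomp bP x (l s) sc) => h.
have [k /and3P[ks xk yk]|none] := pickP (fun k => [&& k \in s, 0 < dotp x (b s k) & 0 < y k]); first by exists k.
move: h; rewrite ltNge; case/negP; apply: sumr_le0 => k ks; rewrite ly //.
have := none k; rewrite ks /=; have := xs k; rewrite le_eqVlt => /orP[/eqP<- _|xk]; first by rewrite mul0r.
rewrite xk /= => /negbT; rewrite -leNgt => yk; exact: mulr_ge0_le0 (ltW xk) yk.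
Qed.

Variables (i : 'I_n) (c : F).
Hypothesis c0 : c != 0.
Hypothesis lc : forall s, s \in cones -> dotp (vF i) (l s) = c.

Let X := [set k | 0 <= y k].
(** The sign makes the piecewise linear function grow along [e] at the same rate [|c|] in every
    cone. *)
Let e := Num.sg c *: vF i.

Let le_e s : s \in cones -> dotp e (l s) = `|c|.
Proof. by move=> sc; rewrite dotpZl lc // -normrEsg. Qed.

Let c_gt0 : 0 < `|c|. Proof. by rewrite normr_gt0. Qed.

(** For a generic [d] near [e] every gradient is positive on [d]. If the negative coordinates of [d]
    in [s] were exactly those with [0 <= y k], all products of coordinate and value would be at most
    0. *)
Lemma echi_invariant : echi cones X = 0.
Proof.
have [s0 s0c _] := cone_at fan i.
pose h (p : {set 'I_n} * 'I_n) := if (p.1 \in cones) && (p.2 \in p.1) then b p.1 p.2 else vF i.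
have h0 p : h p != 0.
  rewrite /h; case: ifP => [/andP[sc ks]|_]; last exact: (vF_neq0 fan bP).
  apply/eqP => z; have := dual_in bP p.2 sc ks; rewrite z dotp0r eqxx => /eqP.
  by rewrite eq_sym oner_eq0.
have [d' [_ hd']] := generic_point bP s0c h0.
have [e1 e10 he1] := small_step (fun p => dotp e (h p)) (fun p => dotp d' (h p)).
have [e2 e20 he2] := small_step (fun s => dotp e (l s)) (fun s => dotp d' (l s)).
pose r := Order.min e1 e2.
have r0 : 0 < r by rewrite lt_min e10.
have r1 : r <= e1 by rewrite ge_min lexx.
have r2 : r <= e2 by rewrite ge_min lexx orbT.
pose d := e + r *: d'.
have dn s k : s \in cones -> k \in s -> dotp d (b s k) != 0.
  move=> sc ks; have hE : h (s, k) = b s k by rewrite /h sc ks.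
  rewrite /d dotpDl (dotpZl r d') -hE; have [->|ek] := eqVneq (dotp e (h (s, k))) 0.
    by rewrite add0r mulf_neq0 ?hd' // gt_eqF.
  by rewrite -sgr_eq0 (he1 r (ltW r0) r1) ?sgr_eq0.
apply: (echi_generic dn) => s sc; apply/eqP => /setP eN.
have : 0 < dotp d (l s).
  rewrite /d dotpDl (dotpZl r d') -sgr_gt0 (he2 r (ltW r0) r2 s) le_e ?sgr_gt0 //.
  by rewrite gt_eqF.
rewrite ltNge; case/negP; rewrite (dotp_decomp bP d (l s) sc); apply: sumr_le0 => k ks.
rewrite ly //; have := eN k; rewrite !inE ks /=; have [yk dk|yk dk] := leP 0 (y k).
  exact: mulr_le0_ge0 (ltW dk) yk.
by rewrite mulr_ge0_le0 ?(ltW yk) // leNgt dk.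
Qed.

Let face_in (J : {set 'I_n}) := (J \in faceset cones) && (J \subset X).

(** From [a] one moves along [e]: the function only grows, so each face passed has a vertex in [X].
    The journey ends in a cone around [e], and all such cones share a vertex of positive value. *)
Lemma connected_invariant (T : eqType) (z : 'I_n -> T) :
  (forall a a', a != a' -> face_in [set a; a'] -> z a = z a') ->
  forall a a', a \in X -> a' \in X -> z a = z a'.
Proof.
move=> edge.
have same s a a' : s \in cones -> a \in s -> a' \in s -> a \in X -> a' \in X -> z a = z a'.
  move=> sc as_ a's aX a'X; have [->//|aa'] := eqVneq a a'.
  apply: edge => //; rewrite /face_in subUset !sub1set aX a'X !andbT.
  by apply/facesetP; exists s; rewrite // subUset !sub1set as_.
have key a : a \in X -> exists s, [/\ s \in cones, e \inC s & exists2 m, m \in s :&: X & z m = z a].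
  move=> aX; have ya : 0 <= y a by rewrite inE in aX.
  have [s0 s0c as0] := cone_at fan a.
  (* The cone entered from [e] towards [v_a] contains [e + r v_a], hence its multiple
     [v_a + r^-1 e], the end of the path. *)
  have [s sc [r r0 hr]] := eventual_cone fan bP e (vF a).
  have es : e \inC s by have := hr 0 (lexx 0) (ltW r0); rewrite scale0r addr0.
  exists s; split=> //.
  (* The first conjunct, that the gradient of [u] takes the value [y a] at [v_a], yields the value
     along the path: [y a] plus a nonnegative multiple of [|c|]. *)
  pose Q (u : {set 'I_n}) := (dotp (vF a) (l u) == y a) && [exists m in u :&: X, z m == z a].
  suff /andP[_ /exists_inP[m ms /eqP mz]] : Q s by exists m.
  apply: (path_cover (cones_cover fan bP) (x := vF a) (d := r^-1 *: e) _ s0c _ _ sc).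
  - move=> t u u' t0 t1 uc u'c xu xu' /andP[/eqP ua /exists_inP[m]].
    rewrite inE => /andP[mu mX] /eqP mz.
    set x := vF a + t *: (r^-1 *: e) in xu xu'.
    have xE w : w \in cones -> dotp x (l w) = dotp (vF a) (l w) + t * r^-1 * `|c|.
      by move=> wc; rewrite /x dotpDl (dotpZl t) (dotpZl r^-1) le_e // mulrA.
    have u'a : dotp (vF a) (l u') = y a.
      have := pl_agree uc u'c xu xu'; rewrite !xE // ua => /addIr; by [].
    apply/andP; split; first exact/eqP.
    have x0 : x != 0.
      apply: contra_neq (vF_neq0 fan bP a) => x0.
      have /eqP := xE u uc; rewrite x0 dotp0l ua eq_sym paddr_eq0 //; last by rewrite !mulr_ge0 // invr_ge0 ltW.
      case/andP => _; rewrite !mulf_eq0 invr_eq0 (gt_eqF r0) (gt_eqF c_gt0) !orbF => /eqP tz.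
      by move: x0; rewrite /x tz scale0r addr0.
    have [k [ku xk yk]] : exists k, [/\ k \in u, 0 < dotp x (b u k) & 0 <= y k].
      have [k /and3P[ku xk yk]|none] := pickP (fun k => [&& k \in u, 0 < dotp x (b u k) & 0 <= y k]); first by exists k.
      have [k ku xk] := cone_in bP uc xu x0.
      have neg q : q \in u -> 0 < dotp x (b u q) -> y q < 0.
        by move=> qu xq; rewrite ltNge; apply/negP => yq; have := none q; rewrite qu xq yq.
      have : 0 <= dotp x (l u) by rewrite xE // ua addr_ge0 // !mulr_ge0 // invr_ge0 ltW.
      rewrite (dotp_decomp bP x (l u) uc) leNgt (bigD1 k) //= => /negP[].
      apply: ltr_nwDl; first by rewrite ly // pmulr_rlt0 // neg.
      apply: sumr_le0 => q /andP[qu _]; rewrite ly //.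
      have := xu q; rewrite le_eqVlt => /orP[/eqP <-|xq]; first by rewrite mul0r.
      by rewrite pmulr_rle0 // ltW // neg.
    have ku' : k \in u' by apply: (cone_supp fan bP uc u'c xu xu'); rewrite gt_eqF.
    have kX : k \in X by rewrite inE.
    by apply/exists_inP; exists k; rewrite ?inE ?ku' // -mz; apply/eqP/(same u).
  - rewrite /Q ly // eqxx; apply/exists_inP; exists a; rewrite ?inE ?as0 //.
  - exact: (vF_inC bP).
  - move=> k; have := hr r (ltW r0) (lexx r) k; rewrite !dotpDl (dotpZl r) (dotpZl r^-1) => h.
    have -> : dotp (vF a) (b s k) + r^-1 * dotp e (b s k) = r^-1 * (dotp e (b s k) + r * dotp (vF a) (b s k)).
      by field; rewrite gt_eqF.
    by rewrite mulr_ge0 // invr_ge0 ltW.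
move=> a a' /key[s [sc es [m /setIP[ms mX] <-]]] /key[s' [s'c es' [m' /setIP[ms' mX'] <-]]].
have [|k [ks ek yk]] := pl_pos sc es; first by rewrite le_e.
have ks' : k \in s' by apply: (cone_supp fan bP sc s'c es es'); rewrite gt_eqF.
have kX : k \in X by rewrite inE ltW.
by rewrite (same s m k) // (same s' m' k).
Qed.

Lemma betti_invariant (E : numFieldType) d :
  rbetti E [set J in faceset cones | J \subset X] d = 0%N.
Proof.
set K := [set J in _ | _].
have KE J : (J \in K) = face_in J by rewrite inE.
have dK : down_closed K.
  move=> J I; rewrite !KE => /andP[/facesetP[s sc Js] JX] IJ; apply/andP; split.
    by apply/facesetP; exists s; rewrite // (subset_trans IJ).
  exact: subset_trans IJ JX.
have c3 J : J \in K -> (#|J| <= 3)%N by rewrite KE => /andP[/(card_face_le fan)].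
have [s0 s0c es0] := cones_cover fan bP e.
have [|a0 [a0s _ ya0]] := pl_pos s0c es0; first by rewrite le_e.
have K1 a : ([set a] \in K) = (a \in X).
  rewrite KE /face_in sub1set andbC; have [aX|//] /= := boolP (a \in X).
  have [s sc as_] := cone_at fan a; apply/facesetP; exists s => //; by rewrite sub1set.
apply: rbetti_eq0 => //.
- by rewrite KE /face_in sub0set andbT; apply/facesetP; exists s0; rewrite ?sub0set.
- by exists a0; rewrite K1 inE ltW.
- move=> z hz a a'; rewrite !K1; apply: connected_invariant => x x' xx' h; apply: hz => //.
  by rewrite KE.
- move=> z hz.
  (* A 2-cycle that is nonzero on one triangle is nonzero on its neighbours, hence on every maximal
     cone; but a cone containing [- e] has a vertex of negative value. *)
  have [s1 s1c es1] := cones_cover fan bP (- e).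
  have [k ks yk] : exists2 k, k \in s1 & y k < 0.
    have [k /andP[ks yk]|none] := pickP (fun k => (k \in s1) && (y k < 0)); first by exists k.
    have : dotp (- e) (l s1) < 0 by rewrite dotpNl le_e // oppr_lt0.
    rewrite ltNge (dotp_decomp bP _ (l s1) s1c); case/negP; apply: sumr_ge0 => k ks.
    by rewrite ly // mulr_ge0 // leNgt; have := none k; rewrite ks /= => ->.
  have s1K : s1 \notin K.
    rewrite KE negb_and; apply/orP; right; apply/subsetPn; exists k => //.
    by rewrite inE -ltNge.
  pose Q (t : {set 'I_n}) := (t \in K) && (z t != 0).
  have tr s t q : s \in cones -> t \in cones -> t != s -> q \in s -> s :\ q \subset t -> Q s -> Q t.
    move=> sc tc ts qs st /andP[sK zs]; apply: contraT => nQ.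
    have GK : s :\ q \in K by apply: dK sK (subsetDl _ _).
    have s3 := card_cone fan sc.
    have G2 : #|s :\ q| = 2%N by have := cardsD1 q s; rewrite qs s3 add1n => -[].
    have := hz _ GK G2; rewrite (bigD1 s) /=; last by rewrite sK s3.
    rewrite big1 ?addr0.
      move/eqP; rewrite mulf_eq0 (negbTE zs) /=; apply: contraLR => _.
      by apply: bcoef_neq0; rewrite ?subsetDl // s3 G2.
    move=> J /andP[/andP[JK J3] Js].
    have Jc : J \in cones by rewrite -(faceset3 fan) J3 andbT; move: JK; rewrite KE => /andP[].
    have [GJ|GJ] := boolP (s :\ q \subset J); last by rewrite /bcoef (negbTE GJ) mulr0.
    have [t0 [_ _ _ ut]] := opposite fan bP sc qs.
    have Jt : J = t.
      case: (ut J Jc GJ) => e1; first by rewrite e1 eqxx in Js.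
      by case: (ut t tc st) => e2; [rewrite e2 eqxx in ts|rewrite e1 e2].
    move: nQ; rewrite /Q -Jt JK /= negbK => /eqP->; by rewrite mul0r.
  move=> J JK J3; apply/eqP; apply: contraT => zJ.
  have Jc : J \in cones by rewrite -(faceset3 fan) J3 eqxx andbT; move: JK; rewrite KE => /andP[].
  have QJ : Q J by rewrite /Q JK.
  by have /andP[h _] := dual_connected fan bP tr Jc s1c QJ; rewrite h in s1K.
have := sum_sign_sizes c3; rewrite (_ : \sum_(J in K) _ = 0); first by lia.
by apply: etrans echi_invariant; apply: eq_bigl => J; rewrite KE.
Qed.

End Acyclic.

(** * Change of field *)

Section FanRat.
Variables (R : realFieldType) (n : nat) (v : 'I_n -> 'rV[int]_3) (cones : {set {set 'I_n}}).

Lemma map_comb (c : 'I_n -> rat) : map_mx ratr (\sum_i c i *: realize rat (v i)) =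
  \sum_i ratr (c i) *: realize R (v i).
Proof.
rewrite (raddf_sum (map_mx ratr)); apply: eq_bigr => i _.
by rewrite /= map_mxZ (realize_ratr R).
Qed.

Lemma coef_unique s (c c' : 'I_n -> R) : lin_indep R v s ->
  (forall i, i \notin s -> c i = 0) -> (forall i, i \notin s -> c' i = 0) ->
  \sum_i c i *: realize R (v i) = \sum_i c' i *: realize R (v i) -> forall i, c i = c' i.
Proof.
move=> ind c0 c'0 e i; apply/eqP; rewrite -subr_eq0; apply/eqP.
apply: (ind (fun i => c i - c' i)) => [j js|]; first by rewrite c0 // c'0 // subrr.
under eq_bigr do rewrite scalerBl.
by rewrite sumrB e subrr.
Qed.

(** Coordinates of a rational point in a cone are unique over [R], so they are the images of its
    rational coordinates, and signs and supports descend. *)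
Lemma fan_rat : complete_simplicial_stacky_fan R v cones -> complete_simplicial_stacky_fan rat v cones.
Proof.
move=> [h1 h2 h3 h4].
have ind s : s \in cones -> lin_indep rat v s.
  move=> sc c c0 sum0 i; have [_ ind] := h1 s sc.
  have := ind (fun i => ratr (c i)); rewrite -map_comb sum0 map_mx0 => /(_ _ erefl i) h.
  apply: (fmorph_inj (@ratr R)); rewrite rmorph0; apply: h => j js; by rewrite c0 // rmorph0.
split=> //.
- by move=> s sc; have [s3 _] := h1 s sc; split=> //; apply: ind.
- move=> s t sc tc x [c [c0 c1 xs]] [c' [c'0 c'1 xt]].
  have [_ indR] := h1 s sc.
  have xsR : in_cone v s (map_mx ratr x : 'rV[R]_3).
    exists (fun i => ratr (c i)); split=> [i|i /c1->|]; rewrite ?ler0q ?rmorph0 //.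
    by rewrite xs map_comb.
  have xtR : in_cone v t (map_mx ratr x : 'rV[R]_3).
    exists (fun i => ratr (c' i)); split=> [i|i /c'1->|]; rewrite ?ler0q ?rmorph0 //.
    by rewrite xt map_comb.
  have [d [d0 d1 dx]] := h2 s t sc tc _ xsR xtR.
  exists c; split=> // i ist; apply: (fmorph_inj (@ratr R)); rewrite rmorph0 -(d1 i ist).
  apply: (coef_unique indR (c := fun i => ratr (c i)) (c' := d)) => [j /c1->|j js|]; rewrite ?rmorph0 //.
    by apply: d1; rewrite inE (negbTE js).
  by rewrite -dx xs map_comb.
- move=> x; have [s sc [d [d0 d1 dx]]] := h3 (map_mx ratr x); exists s => //.
  have [s3 indR] := h1 s sc; have [b [b1 b2 b3]] := dual_basis_cone s3 (ind s sc).
  pose c i := dotp x (b i).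
  have c0 i : i \notin s -> c i = 0 by move=> is_; rewrite /c b2 // dotp0r.
  have xc : x = \sum_i c i *: realize rat (v i).
    by rewrite {1}(b3 x) (sum_supp (s := s)) // => i is_; rewrite -/(c i) c0 ?scale0r.
  exists c; split=> // i; rewrite -(ler0q R).
  suff -> : ratr (c i) = d i by [].
  apply: (coef_unique indR (c := fun i => ratr (c i)) (c' := d)) => [j js||] //; first by rewrite c0 // rmorph0.
  by rewrite -map_comb -xc.
Qed.

End FanRat.

(* If [u] lies in the relative interior of a cone containing the ray of [v_i], then far in the
   direction [u] one is inside the star of [v_i], so that invariance of the piecewise linear
   function under [u] entails invariance under [v_i]. *)
Lemma invariant_ray (F : realFieldType) (n : nat) (v : 'I_n -> 'rV[int]_3) (cones : {set {set 'I_n}})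
    (y : 'I_n -> F) (l : {set 'I_n} -> 'rV[F]_3) (u : 'rV[F]_3) :
  complete_simplicial_stacky_fan F v cones ->
  (forall s k, s \in cones -> k \in s -> dotp (realize F (v k)) (l s) = y k) ->
  u != 0 -> (forall s t, s \in cones -> t \in cones -> dotp u (l s) = dotp u (l t)) ->
  exists i, forall s, s \in cones -> dotp (realize F (v i)) (l s) = y i.
Proof.
move=> fan ly u0 hu; have [b bP] := exists_dual_basis fan.
have [s0 s0c us0] := cones_cover fan bP u.
have [i is0 ui] := cone_in bP s0c us0 u0.
exists i => s sc; set vi := realize F (v i).
pose x := \sum_(k in s) realize F (v k).
have xs k : k \in s -> dotp x (b s k) = 1 by move=> ks; rewrite (dotp_sum_sub bP) // ks.
have [e e0 he] := small_step (fun k => dotp x (b s k)) (fun k => dotp vi (b s k)).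
have xes : forall k, 0 <= dotp (x + e *: vi) (b s k).
  move=> k; have [ks|ks] := boolP (k \in s); last by rewrite (dual_out bP) // dotp0r.
  have := he e (ltW e0) (lexx e) k; rewrite xs // oner_eq0 sgr1 => /(_ isT) h.
  by rewrite !dotpE xs // -sgr_ge0 h ler01.
have [t tc [r r0 [ht hr]]] := eventual_at fan bP x s0c us0.
have it : i \in t by apply: ht; rewrite gt_eqF.
have xt : forall k, 0 <= dotp (x + r^-1 *: u) (b t k).
  move=> k; have := hr r (ltW r0) (lexx r) k; rewrite !dotpE => h.
  have -> : dotp x (b t k) + r^-1 * dotp u (b t k) = r^-1 * (dotp u (b t k) + r * dotp x (b t k)).
    by field; rewrite gt_eqF.
  by rewrite mulr_ge0 // invr_ge0 ltW.
have xet : forall k, 0 <= dotp (x + e *: vi + r^-1 *: u) (b t k).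
  move=> k; rewrite addrAC dotpDl addr_ge0 // dotpZl mulr_ge0 ?(ltW e0) //.
  exact: (vF_inC bP).
(* Consecutive cones on the segment agree at a shared point and their gradients agree on [u], so
   they agree at [z]. Subtracting the cases [z = x] and [z = x + e v_i] isolates [v_i]. *)
have key z : (forall k, 0 <= dotp z (b s k)) -> (forall k, 0 <= dotp (z + r^-1 *: u) (b t k)) ->
    dotp z (l t) = dotp z (l s).
  move=> zs zt; apply/eqP.
  apply: (path_cover (cones_cover fan bP) (Q := fun w => dotp z (l w) == dotp z (l s))
    (x := z) (d := r^-1 *: u) _ sc (eqxx _) zs tc zt).
  move=> q w w' q0 q1 wc w'c zw zw' /eqP <-.
  have := pl_agree fan bP ly wc w'c zw zw'.
  by rewrite !dotpE (hu w w') // => /addIr ->.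
have xs' : forall k, 0 <= dotp x (b s k) by apply: (sum_in_cone bP).
have := key _ xes xet; rewrite !dotpDl !dotpZl (key x xs' xt) => /addrI /(mulfI (lt0r_neq0 e0)) <-.
exact: ly.
Qed.

Lemma common_denominator (m : nat) (z : 'I_m -> rat) :
  exists2 D : int, D != 0 & exists y : 'I_m -> int, forall k, (y k)%:~R = D%:~R * z k.
Proof.
exists (\prod_k denq (z k)); first by apply/prodf_neq0 => k _; apply: denq_neq0.
exists (fun k => numq (z k) * \prod_(j | j != k) denq (z j)) => k.
rewrite [in RHS](bigD1 k) //= !intrM [RHS]mulrAC; congr (_ * _).
by rewrite -{3}(divq_num_den (z k)) mulrC divfK // intr_eq0 denq_neq0.
Qed.

(* The condition is a homogeneous linear system with rational coefficients, so a nonlinear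
   solution over [K] forces a nonlinear rational one. *)
Lemma rational_solution (K : realFieldType) (n : nat) (v : 'I_n -> 'rV[int]_3) (cones : {set {set 'I_n}})
    (b : {set 'I_n} -> 'I_n -> 'rV[rat]_3) (y : 'I_n -> K) (u : 'rV[rat]_3) :
  (exists s, s \in cones) ->
  (forall s t, s \in cones -> t \in cones ->
     dotp (map_mx ratr u) (grad b y s) = dotp (map_mx ratr u) (grad b y t)) ->
  (forall w : 'rV[K]_3, ~ forall k, y k = dotp (realize K (v k)) w) ->
  exists y' : 'I_n -> int,
    (forall w : 'rV[rat]_3, ~ forall k, (y' k)%:~R = dotp (realize rat (v k)) w) /\
    (forall s t, s \in cones -> t \in cones ->
     dotp u (\sum_(k in s) (y' k)%:~R *: b s k) = dotp u (\sum_(k in t) (y' k)%:~R *: b t k)).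
Proof.
move=> [s0 s0c] hy nl.
pose co (s : {set 'I_n}) (k : 'I_n) : rat := if k \in s then dotp u (b s k) else 0.
pose A : 'M[rat]_(n, #|{set 'I_n}|) := \matrix_(k, j)
  if enum_val j \in cones then co (enum_val j) k - co s0 k else 0.
pose W : 'M[rat]_(3, n) := \matrix_(a, k) realize rat (v k) 0 a.
pose Y : 'rV[K]_n := \row_k y k.
have coE (s : {set 'I_n}) (z : 'I_n -> rat) : dotp u (\sum_(k in s) z k *: b s k) = \sum_k z k * co s k.
  rewrite dotp_sumr big_mkcond; apply: eq_bigr => k _; rewrite /co dotpZr.
  by case: ifP => _; rewrite ?mulr0.
have coEK (s : {set 'I_n}) : dotp (map_mx ratr u) (grad b y s) = \sum_k y k * ratr (co s k).
  rewrite dotp_sumr big_mkcond; apply: eq_bigr => k _; rewrite /co dotpZr dotp_map.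
  by case: ifP => _; rewrite ?rmorph0 ?mulr0.
have YA : Y *m map_mx ratr A = 0.
  apply/rowP => j; rewrite !mxE.
  have [jc|jc] := boolP (enum_val j \in cones); last first.
    by rewrite big1 // => k _; rewrite !mxE (negbTE jc) rmorph0 mulr0.
  under eq_bigr do rewrite !mxE jc rmorphB mulrBr.
  by rewrite sumrB -!coEK (hy _ s0) // subrr.
(* The rows generated by [W] are the value vectors of linear functions. Kernels and inclusions of
   row spaces commute with field extension, so an inclusion here would make [Y] linear over [K]. *)
have : ~~ (kermx A <= W)%MS.
  apply/negP => sub.
  have : (Y <= map_mx ratr W)%MS.
    apply: submx_trans (_ : (map_mx ratr (kermx A) <= _)%MS); last by rewrite map_submx.
    by rewrite map_kermx; apply/sub_kermxP.
  case/submxP => w e; apply: (nl w) => k.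
  have := congr1 (fun M : 'rV_ _ => M 0 k) e; rewrite !mxE => ->.
  by apply: eq_bigr => a _; rewrite !mxE mulrC ratr_int.
case/row_subPn => r nr.
pose z k := row r (kermx A) 0 k.
have zA : row r (kermx A) *m A = 0 by rewrite -row_mul mulmx_ker row0.
have [D D0 [y' hy']] := common_denominator z.
have DQ : D%:~R != 0 :> rat by rewrite intr_eq0.
exists y'; split=> [w hw|s t sc tc].
  case/negP: nr; apply/submxP; exists (D%:~R^-1 *: w); apply/rowP => k.
  rewrite -/(z k) -scalemxAl [RHS]mxE; apply: (mulfI DQ); rewrite -hy' hw mulrA mulfV // mul1r.
  by rewrite mxE; apply: eq_bigr => a _; rewrite !mxE mulrC.
have eqs s1 : s1 \in cones -> \sum_k z k * co s1 k = \sum_k z k * co s0 k.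
  move=> s1c; apply/eqP; rewrite -subr_eq0 -sumrB; apply/eqP.
  have : (row r (kermx A) *m A) 0 (enum_rank s1) = \sum_k z k * A k (enum_rank s1) by rewrite mxE.
  rewrite zA mxE => e1; apply: etrans (esym e1); apply: eq_bigr => k _.
  by rewrite [A _ _]mxE enum_rankK s1c mulrBr.
rewrite !coE; under eq_bigr do rewrite hy' -mulrA; under [RHS]eq_bigr do rewrite hy' -mulrA.
by rewrite -!mulr_sumr !eqs.
Qed.

(** * From piecewise linear functions to line bundles *)

Lemma hull_direction (F : fieldType) (S : seq 'rV[F]_3) :
  (hull_dim S < 3)%N <-> exists2 u : 'rV[F]_3, u != 0 & forall i, (i < size S)%N -> dotp u S`_i = dotp u S`_0.
Proof.
rewrite /hull_dim; set M := \matrix_(i < _) _.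
have uM (u : 'rV_3) (i : 'I_(size S)) : (u *m M^T) 0 i = dotp u S`_i - dotp u S`_0.
  by rewrite mxE -dotpNr -dotpDr; apply: eq_bigr => k _; rewrite !mxE.
have kM : \rank (kermx M^T) = (3 - \rank M)%N by rewrite mxrank_ker mxrank_tr.
split=> [h|[u u0 hu]].
  have /rowV0Pn[u /sub_kermxP hu u0] : kermx M^T != 0 by rewrite -mxrank_eq0 kM -lt0n subn_gt0.
  exists u => // i iS; apply/eqP; rewrite -subr_eq0 -(uM u (Ordinal iS)) hu mxE //.
rewrite -subn_gt0 -kM lt0n mxrank_eq0; apply/rowV0Pn; exists u => //.
by apply/sub_kermxP/rowP => i; rewrite uM hu // subrr mxE.
Qed.

Lemma dotp_realize (R : realFieldType) (x z : 'rV[int]_3) :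
  dotp (realize R x) (realize R z) = (dotp x z)%:~R.
Proof. by rewrite /dotp rmorph_sum; apply: eq_bigr => k _; rewrite !mxE rmorphM. Qed.

Lemma Supp_faceset n (cones : {set {set 'I_n}}) (r : 'I_n -> int) :
  Supp cones r = [set J in faceset cones | J \subset [set k | 0 <= r k]].
Proof.
apply/setP => J; rewrite !inE andbC; congr (_ && _).
by apply/forall_inP/subsetP => h k /h; rewrite inE.
Qed.

Lemma down_closed_Supp n (cones : {set {set 'I_n}}) (r : 'I_n -> int) : down_closed (Supp cones r).
Proof.
move=> J I; rewrite Supp_faceset !inE => /andP[/exists_inP[s sc Js] JX] IJ.
rewrite (subset_trans IJ JX) andbT; apply/exists_inP; exists s => //; exact: subset_trans IJ Js.
Qed.

Lemma Htrivial_echi n (v : 'I_n -> 'rV[int]_3) (cones : {set {set 'I_n}}) (r : 'I_n -> int) (w : 'rV[int]_3) :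
  complete_simplicial_stacky_fan rat v cones -> Htrivial v cones r ->
  echi cones [set k | 0 <= r k + dotp w (v k)] = 0.
Proof.
move=> fan triv; pose r' k := r k + dotp w (v k).
have iso : lb_iso v r r' by exists w => k; rewrite /r' addrC addKr.
have c3 J : J \in Supp cones r' -> (#|J| <= 3)%N.
  by rewrite Supp_faceset inE => /andP[/(card_face_le fan)].
have b0 s : (s <= 3)%N -> rbetti_s algC (Supp cones r') s = 0%N.
  (* Cohomological degree [3 - s] corresponds to homological degree [s - 1], that is, to faces with
     [s] vertices. *)
  move=> s3; have := triv (3 - s)%N r' iso; rewrite /rbetti.
  have -> : 3%:Z - (3 - s)%N%:Z - 1 = s%:Z - 1 by lia.
  by rewrite subrK lerBrDr addNr /=.
have e := euler_of_acyclic (@down_closed_Supp _ _ _) c3 b0.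
have := sum_sign_sizes c3.
have -> : echi cones [set k | 0 <= r k + dotp w (v k)] = \sum_(J in Supp cones r') (-1) ^+ #|J|.
  by apply: eq_bigl => J; rewrite Supp_faceset [RHS]in_set.
move=> ->; move: e; lia.
Qed.

Section Backward.
Variables (n : nat) (v : 'I_n -> 'rV[int]_3) (cones : {set {set 'I_n}}).
Hypothesis fan : complete_simplicial_stacky_fan rat v cones.
Variable b : {set 'I_n} -> 'I_n -> 'rV[rat]_3.
Hypothesis bP : dual_basis v cones b.
Variables (y : 'I_n -> int) (i : 'I_n).

Local Notation vQ k := (realize rat (v k)).
Let g (s : {set 'I_n}) : 'rV[rat]_3 := \sum_(k in s) (y k)%:~R *: b s k.

Lemma dotp_int_grad s k : s \in cones -> k \in s -> dotp (vQ k) (g s) = (y k)%:~R.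
Proof.
move=> sc ks; rewrite /g dotp_sumr (bigD1 k) //= big1 ?addr0 => [|m /andP[ms mk]];
  rewrite dotpZr (dual_in bP) //; first by rewrite eqxx mulr1.
by rewrite eq_sym (negbTE mk) mulr0.
Qed.

Hypothesis inv : forall s, s \in cones -> dotp (vQ i) (g s) = (y i)%:~R.

(* Half a unit in the direction [v i] keeps [f + w] away from [0] at [v i] for all [w]
   in the dual lattice. *)
Lemma Htrivial_family (a : int) : exists2 r : 'I_n -> int,
  Htrivial v cones r & forall k, r k = a * y k + Num.floor (dotp (vQ k) ((2 * dotp (vQ i) (vQ i))^-1 *: vQ i)).
Proof.
set eta := _ *: _.
exists (fun k => a * y k + Num.floor (dotp (vQ k) eta)) => // j r' [w hw].
have vi0 : dotp (vQ i) (vQ i) != 0.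
  apply/eqP => z; case/eqP: (vF_neq0 fan bP i); apply/rowP => k.
  have /eqP := z; rewrite /dotp psumr_eq0 => [/allP/(_ k (mem_index_enum _))|q _]; last by rewrite -expr2 sqr_ge0.
  by rewrite /= mulf_eq0 orbb => /eqP ->; rewrite mxE.
have ei : dotp (vQ i) eta = 2^-1 by rewrite /eta dotpZr invfM -mulrA mulVf // mulr1.
pose f k : rat := (a * y k)%:~R + dotp (vQ k) (eta + realize rat w).
pose l s := a%:~R *: g s + (eta + realize rat w).
pose c : rat := (a * y i)%:~R + dotp (vQ i) (eta + realize rat w).
have c0 : c != 0.
  rewrite /c dotpDr ei dotp_realize addrCA -intrD; set N := a * _ + _.
  apply/eqP => z; have : 1 + (N%:~R + N%:~R) = 0 :> rat by move: z; lra.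
  by rewrite -!intrD -[1]/(1%:~R) -intrD => /eqP; rewrite intr_eq0; lia.
have lf s k : s \in cones -> k \in s -> dotp (vQ k) (l s) = f k.
  by move=> sc ks; rewrite /l dotpDr dotpZr dotp_int_grad // -intrM.
have lc s : s \in cones -> dotp (vQ i) (l s) = c.
  by move=> sc; rewrite /l dotpDr dotpZr inv // -intrM.
rewrite Supp_faceset (_ : [set k | 0 <= r' k] = [set k | 0 <= f k]).
  exact: (betti_invariant fan bP lf c0 lc).
(* The integer [r' k] is the floor of [f k], so both are nonnegative together. *)
apply/setP => k; rewrite !inE.
have -> : r' k = (a * y k + dotp w (v k)) + Num.floor (dotp (vQ k) eta).
  by rewrite -[LHS](subrK (a * y k + Num.floor (dotp (vQ k) eta))) hw; ring.
rewrite -lerBlDl sub0r floor_ge_int /f intrN lerNl -subr_ge0 opprK; congr (0 <= _).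
by rewrite dotpDr dotp_realize intrD [dotp (v k) w]dotpC addrAC addrA addrC; ring.
Qed.

Hypothesis nl : forall w : 'rV[rat]_3, ~ forall k, (y k)%:~R = dotp (vQ k) w.

(** The floor terms do not depend on [a] and cancel in differences, so an isomorphism would make a
    nonzero multiple of [y] linear. *)
Lemma infinite_family : infinitely_many_Htrivial v cones.
Proof.
move=> m; have /fin_all_exists2[rs triv rsE] := fun a : 'I_m => Htrivial_family (val a)%:Z.
exists rs; split=> // a a' aa' [w hw].
pose d : rat := (a'%:Z - a%:Z)%:~R.
have d0 : d != 0 by rewrite intr_eq0 subr_eq0 eqz_nat eq_sym.
apply: (nl (w := d^-1 *: realize rat w)) => k; apply: (mulfI d0).
rewrite dotpZr mulrA mulfV // mul1r dotp_realize [dotp (v k) w]dotpC -hw !rsE -intrM; congr _%:~R.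
by rewrite mulrBl; ring.
Qed.

End Backward.

Lemma infinitely_many_of_PL (R : rcfType) (n : nat) (v : 'I_n -> 'rV[int]_3) (cones : {set {set 'I_n}})
    (psi : 'rV[R]_3 -> R) (l : {set 'I_n} -> 'rV[R]_3) :
  complete_simplicial_stacky_fan R v cones ->
  PL_with v cones psi l -> ~ is_linear_fun psi -> (hull_dim (Lambda_points cones l) < 3)%N ->
  infinitely_many_Htrivial v cones.
Proof.
move=> fan pl nl /hull_direction[u u0 hu].
have fanQ := fan_rat fan; have [b bP] := exists_dual_basis fanQ.
have [bR bRP] := exists_dual_basis fan.
pose y k := psi (realize R (v k)).
have ly s k : s \in cones -> k \in s -> dotp (realize R (v k)) (l s) = y k.
  by move=> sc ks; rewrite /y (pl s sc) //; apply/(in_cone_dual bRP _ sc)/(vF_inC bRP).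
have hu' s : s \in cones -> dotp u (l s) = dotp u (Lambda_points cones l)`_0.
  move=> sc; have si : (index s (enum cones) < size (enum cones))%N by rewrite index_mem mem_enum.
  have := hu (index s (enum cones)); rewrite size_map => /(_ si) <-.
  by rewrite (nth_map s) // nth_index // mem_enum.
have [|i hi] := invariant_ray fan ly u0; first by move=> s t sc tc; rewrite !hu'.
have [s0 s0c is0] := cone_at fan i.
have [||y' [nl' inv']] := @rational_solution R n v cones b y (realize rat (v i)) (ex_intro _ s0 s0c).
- move=> s t sc tc; rewrite realize_ratr.
  suff e u1 : u1 \in cones -> dotp (realize R (v i)) (grad b y u1) = y i by rewrite !e.
  move=> u1c; rewrite -(hi _ u1c) !(dotp_decompK bP i _ u1c); apply: eq_bigr => k ku.
  by rewrite (dotp_grad bP) // ly.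
- move=> w hw; apply: nl; exists w => x; have [s sc [c [c0 c1 xc]]] : exists2 s, s \in cones & in_cone v s x.
    by case: fan.
  rewrite (pl s sc); last by exists c.
  rewrite xc !dotp_suml; apply: eq_bigr => k _; rewrite !dotpZl.
  by have [ks|/c1 ->] := boolP (k \in s); [rewrite ly // hw|rewrite !mul0r].
apply: (infinite_family fanQ bP (y := y') (i := i)) => // s sc.
by rewrite (inv' s s0) // (dotp_int_grad bP).
Qed.

(** * From line bundles to piecewise linear functions *)

Module Cluster.
Import classical_sets topology normedtype reals filter Rstruct.
Import numFieldNormedType.Exports.
Local Open Scope classical_set_scope.

Lemma cluster_point (R : realType) (n : nat) (u : nat -> 'I_n -> R) :
  (forall m k, `|u m k| <= 1) ->
  exists y : 'I_n -> R, forall e, 0 < e -> forall N, exists2 m, (N <= m)%N & forall k, `|u m k - y k| < e.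
Proof.
move=> u1.
pose A := [set x : 'rV[R]_n | forall k, `[-1, 1]%classic (x ord0 k)].
have cA : compact A by apply: (@rV_compact R n (fun=> `[-1, 1]%classic)) => k; apply: segment_compact.
pose w (m : nat) : 'rV[R]_n := \row_k u m k.
have [|y [_ clu]] := cA (w @ \oo) _.
  exists 0%N => // m _ k /=; rewrite mxE in_itv /=; move: (u1 m k); by rewrite ler_norml.
exists (y ord0) => e e0 N.
have [|z []] := clu (w @` [set m | (N <= m)%N]) (ball y e) _ (nbhsx_ballx y e e0).
  by exists N => // m /= Nm; exists m.
move=> [m Nm <-] /= h; exists m => // k.
case: h => _ /(_ ord0 k).
by rewrite mxE /ball /= distrC.
Qed.

(** Hides the real numbers behind the only property needed of them besides being archimedean:
    bounded sequences of vectors have cluster points. *)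
Lemma exists_cluster_field : exists K : archiRealFieldType,
  forall (n : nat) (u : nat -> 'I_n -> K), (forall m k, `|u m k| <= 1) ->
  exists y : 'I_n -> K, forall e, 0 < e -> forall N, exists2 m, (N <= m)%N & forall k, `|u m k - y k| < e.
Proof. exists (Rdefinitions.R : realType); exact: cluster_point. Qed.

End Cluster.

Definition norm1 (u : 'rV[int]_3) : nat := (\sum_j absz (u 0%R j))%N.

Lemma dotp_floor (K : archiRealFieldType) (u : 'rV[int]_3) (z : 'rV[K]_3) :
  `|dotp (realize K u) z - (dotp (\row_j Num.floor (z 0 j)) u)%:~R| <= (norm1 u)%:R.
Proof.
rewrite /dotp rmorph_sum -sumrB natr_sum; apply: le_trans (ler_norm_sum _ _ _) _.
apply: ler_sum => j _; rewrite !mxE rmorphM /= [_ * (u 0 j)%:~R]mulrC -mulrBr normrM.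
have -> : `|(u 0 j)%:~R : K| = (absz (u 0 j))%:R by rewrite -intr_norm -abszE.
rewrite ler_piMr ?ler0n // ger0_norm ?subr_ge0 ?floor_le //.
by rewrite lerBlDl (le_trans (ltW (floorD1_gt _))) // intrD.
Qed.

Section Forward.
Variables (n : nat) (v : 'I_n -> 'rV[int]_3) (cones : {set {set 'I_n}}).
Hypothesis fan : complete_simplicial_stacky_fan rat v cones.
Variable b : {set 'I_n} -> 'I_n -> 'rV[rat]_3.
Hypothesis bP : dual_basis v cones b.

Let C := (\sum_k norm1 (v k))%N.

Lemma norm1_le k : (norm1 (v k) <= C)%N.
Proof. by rewrite /C (bigD1 k) //= leq_addr. Qed.

(** On [s0] the values [r] are those of one rational linear function; subtracting its rounding
    leaves an error of at most [norm1 (v k)]. *)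
Lemma normalize (r : 'I_n -> int) s0 : s0 \in cones ->
  exists w : 'rV[int]_3, forall k, k \in s0 -> (absz (r k + dotp w (v k))%R <= C)%N.
Proof.
move=> s0c; pose l : 'rV[rat]_3 := \sum_(k in s0) (r k)%:~R *: b s0 k.
exists (- \row_j Num.floor (l 0 j)) => k ks.
have lk : dotp (realize rat (v k)) l = (r k)%:~R by apply: (dotp_int_grad bP).
have := dotp_floor (v k) l; rewrite lk -intrB -intr_norm -dotpNl => h.
apply: leq_trans (norm1_le k).
by move: h; rewrite -abszE -[(norm1 _)%:R]/((norm1 _)%:Z%:~R) ler_int.
Qed.

Lemma unbounded_Htrivial s0 B : s0 \in cones -> infinitely_many_Htrivial v cones ->
  exists r : 'I_n -> int, [/\ forall w, echi cones [set k | 0 <= r k + dotp w (v k)] = 0,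
    forall k, k \in s0 -> (absz (r k) <= C)%N & exists k, (B < absz (r k))%N].
Proof.
(* One more than the number of integer vectors with all entries between [- B] and [B]. *)
move=> s0c inf; have [rs [triv niso]] := inf ((B + B).+1 ^ n).+1.
have /fin_all_exists[w hw] := fun a => normalize (rs a) s0c.
pose r a k := rs a k + dotp (w a) (v k).
have [a /existsP[k hk]|small] := pickP (fun a => [exists k, (B < absz (r a k))%N]).
  exists (r a); split=> [w'|k' ks|]; [|exact: hw|by exists k].
  have := Htrivial_echi (w a + w') fan (triv a).
  by congr (echi _ _ = _); apply/setP => k'; rewrite !inE /r dotpDl addrA.
have bd a k : (absz (r a k) <= B)%N.
  by have := small a => /negbT/existsPn/(_ k); rewrite -leqNgt.
pose h a : {ffun 'I_n -> 'I_(B + B).+1} := [ffun k => inord (absz (r a k + B%:Z)%R)].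
have h_inj : injective h.
  move=> a a' e; apply/eqP; apply: contraT => aa'.
  case: (niso a a' aa'); exists (w a - w a') => k.
  have := congr1 (fun f : {ffun 'I_n -> 'I_(B + B).+1} => val (f k)) e; rewrite !ffunE /=.
  have in_range z : (absz z <= B)%N -> (absz (z + B%:Z)%R < (B + B).+1)%N by clear; lia.
  have eq_range z z' : (absz z <= B)%N -> (absz z' <= B)%N ->
    absz (z + B%:Z)%R = absz (z' + B%:Z)%R -> z = z' by clear; lia.
  rewrite !inordK ?in_range ?bd // => /eq_range => /(_ (bd a k) (bd a' k)).
  rewrite /r dotpDl dotpNl => e2; rewrite -[rs a' k](addrK (dotp (w a') (v k))) -e2; ring.
by have := leq_card _ h_inj; rewrite card_ffun !card_ord ltnn.
Qed.

Variable K : archiRealFieldType.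
Hypothesis cluster : forall (m : nat) (u : nat -> 'I_m -> K), (forall i k, `|u i k| <= 1) ->
  exists y : 'I_m -> K, forall e, 0 < e -> forall N, exists2 i, (N <= i)%N & forall k, `|u i k - y k| < e.

(* A cluster point of normalized H-trivial bundles, whose sizes tend to infinity. *)
Lemma limit_function : infinitely_many_Htrivial v cones -> exists y : 'I_n -> K,
  (forall w : 'rV[K]_3, ~ forall k, y k = dotp (realize K (v k)) w) /\
  (forall w : 'rV[K]_3, (forall k, y k != dotp (realize K (v k)) w) ->
     echi cones [set k | dotp (realize K (v k)) w < y k] = 0).
Proof.
move=> inf; have [s0 s0c _] := cones_cover fan bP 0.
have /boolp.choice[r hr] := fun B => unbounded_Htrivial B s0c inf.
pose M B := (\max_k absz (r B k))%N.
have rM B k : (absz (r B k) <= M B)%N by rewrite /M (leq_bigmax k).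
have MB B : (B < M B)%N.
  by have [_ _ [k hk]] := hr B; apply: leq_trans hk (rM B k).
have M0 B : 0 < (M B)%:R :> K by rewrite ltr0n (leq_ltn_trans _ (MB B)).
have attained B : exists k, absz (r B k) = M B.
  have [_ _ [k0 _]] := hr B.
  have n0 : (0 < #|'I_n|)%N by apply/card_gt0P; exists k0.
  by have [k hk] := bigop.eq_bigmax (fun k => absz (r B k)) n0; exists k.
have absK (z : int) : `|z%:~R : K| = (absz z)%:R by rewrite -intr_norm -abszE.
pose u B k : K := (r B k)%:~R / (M B)%:R.
have uE B k : `|u B k| = (absz (r B k))%:R / (M B)%:R.
  by rewrite normrM absK normfV (ger0_norm (ltW (M0 B))).
have u1 B k : `|u B k| <= 1 by rewrite uE ler_pdivrMr // mul1r ler_nat.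
have [y clu] := cluster u1; exists y.
(* Values on [s0] stay below [C] while the scale [M B] grows, so the limit vanishes there. A linear
   function with this property is zero, but some entry of each [u B] has absolute value 1. *)
have y0 k : k \in s0 -> y k = 0.
  move=> ks; apply/eqP; rewrite -normr_eq0; apply: contraT => yk.
  have d0 : 0 < `|y k| by rewrite lt_neqAle eq_sym yk normr_ge0.
  set d := `|y k| in d0.
  have d2 : 0 < d / 2 by lra.
  have [B NB /(_ k) hB] := clu (d / 2) d2 (Num.bound (2 * C%:R / d)).
  have uk : `|u B k| < d / 2.
    rewrite uE ltr_pdivrMr //; have [_ /(_ k ks) rC _] := hr B.
    have c1 : 2 * C%:R / d < (M B)%:R.
      apply: lt_le_trans (archi_boundP _) _; first by rewrite divr_ge0 ?mulr_ge0 ?ler0n // ltW.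
      by rewrite ler_nat (leq_trans NB) // ltnW.
    rewrite ltr_pdivrMr // in c1.
    have c2 : (absz (r B k))%:R <= C%:R :> K by rewrite ler_nat.
    by lra.
  have : d < d / 2 + d / 2.
    have e : y k = u B k - (u B k - y k) by ring.
    by apply: le_lt_trans (ltrD uk hB); rewrite /d {1}e ler_normB.
  by rewrite -splitr ltxx.
have [k1 yk1] : exists k, y k != 0.
  have [B _ hB] := clu 1 ltr01 0%N; have [k hk] := attained B; exists k.
  apply: contraTneq (hB k) => ->; by rewrite subr0 uE hk divff ?ltxx // gt_eqF.
split=> [w hw|w hw].
  case/eqP: yk1; rewrite hw (dotp_decompK bP k1 w s0c) big1 // => m ms.
  by rewrite -hw y0 // mulr0.
pose f k := y k - dotp (realize K (v k)) w.
have f0 k : 0 < `|f k| by rewrite normr_gt0 subr_eq0.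
(* The smallest gap, capped at 1. For [M B] above [2 C / d], the rounding error [C] and the
   deviation [M B * d / 2] of [u B] together stay below [M B * d] and cannot change a sign. *)
pose d := \big[Order.min/1]_k `|f k|.
have d0 : 0 < d by apply: lt_bigmin.
have df k : d <= `|f k| by rewrite /d (bigD1 k) //= ge_min lexx.
have d2 : 0 < d / 2 by lra.
have [B NB hB] := clu (d / 2) d2 (Num.bound (2 * C%:R / d)).
have [ech _ _] := hr B.
rewrite -(ech (- \row_j Num.floor (((M B)%:R *: w) 0 j))); congr (echi _ _).
apply/setP => k; rewrite !inE -subr_gt0 -/(f k) dotpNl.
set q := dotp _ (v k); rewrite -(ler0z K) intrB.
have h1 : `|(M B)%:R * dotp (realize K (v k)) w - q%:~R| <= C%:R.
  have := dotp_floor (v k) ((M B)%:R *: w); rewrite dotpZr => h.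
  by apply: le_trans h _; rewrite ler_nat norm1_le.
have c1 : 2 * C%:R / d < (M B)%:R.
  apply: lt_le_trans (archi_boundP _) _; first by rewrite divr_ge0 ?mulr_ge0 ?ler0n // ltW.
  by rewrite ler_nat (leq_trans NB) // ltnW.
rewrite ltr_pdivrMr // in c1.
have h2 : `|(M B)%:R * (u B k - y k)| <= (M B)%:R * (d / 2).
  by rewrite normrM (ger0_norm (ltW (M0 B))) ler_wpM2l ?(ltW (M0 B)) // ltW.
have rE : (r B k)%:~R = (M B)%:R * u B k by rewrite /u mulrC divfK // gt_eqF.
have -> : (r B k)%:~R - q%:~R = (M B)%:R * f k + (M B)%:R * (u B k - y k) +
    ((M B)%:R * dotp (realize K (v k)) w - q%:~R) by rewrite rE /f; ring.
move: h1 h2; set X := _ - q%:~R; set Y := _ * (u B k - y k); rewrite !ler_norml => /andP[x1 x2] /andP[y1 y2].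
have := df k; have [fk|fk] := ltP 0 (f k).
  rewrite (ger0_norm (ltW fk)) => dk.
  have : (M B)%:R * d <= (M B)%:R * f k by rewrite ler_wpM2l // ltW.
  move=> h; have pos : 0 <= (M B)%:R * f k + Y + X by lra.
  by rewrite pos.
rewrite (ler0_norm fk) => dk.
have : (M B)%:R * d <= (M B)%:R * (- f k) by rewrite ler_wpM2l // ltW.
rewrite mulrN => h; have neg : (M B)%:R * f k + Y + X < 0 by lra.
by rewrite leNgt neg.
Qed.

End Forward.

Lemma collinear_ratr (u w : 'rV[int]_3) (c : rat) : realize rat w = c *: realize rat u -> collinear u w.
Proof.
move=> e; exists (numq c), (- denq c); split; first by right; rewrite oppr_eq0 denq_neq0.
apply/rowP => j; apply: (@intr_inj rat); rewrite !mxE !rmorphD !rmorphM /= rmorphN /=.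
have := congr1 (fun M : 'rV_3 => M 0 j) e; rewrite !mxE => ->.
rewrite mulNr mulrA -[X in _ * X * _](divq_num_den c) [_%:~R * (_ / _)]mulrC divfK ?subrr //.
by rewrite intr_eq0 denq_neq0.
Qed.

(** Members are the generators whose line contains another generator; any two of them belong to the
    same collinear pair. *)
Lemma special_set n (v : 'I_n -> 'rV[int]_3) : at_most_one_collinear_pair v ->
  exists S : {set 'I_n}, (forall m, m \notin S -> ordinary v m) /\
    forall m m', m \in S -> m' \in S -> exists c : rat, realize rat (v m') = c *: realize rat (v m).
Proof.
move=> one; exists [set m | [exists m', (m' != m) && (realize rat (v m') <= realize rat (v m))%MS]]; split.
  move=> m; rewrite inE => /existsPn h m' m'm c; have := h m'; rewrite m'm /=.
  by apply: contraNneq => ->; rewrite scalemx_sub.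
move=> m m'; rewrite !inE => /existsP[p /andP[pm /sub_rVP[c pc]]] /existsP[p' /andP[p'm' /sub_rVP[c' pc']]].
have e : [set m; p] = [set m'; p'].
  by apply: one; [rewrite eq_sym|rewrite eq_sym|exact: collinear_ratr pc|exact: collinear_ratr pc'].
have : m' \in [set m; p] by rewrite e !inE eqxx.
rewrite !inE => /orP[]/eqP->; last by exists c.
by exists 1; rewrite scale1r.
Qed.

Lemma PL_of_infinitely_many (R : rcfType) (n : nat) (v : 'I_n -> 'rV[int]_3) (cones : {set {set 'I_n}}) :
  complete_simplicial_stacky_fan R v cones -> at_most_one_collinear_pair v ->
  infinitely_many_Htrivial v cones ->
  exists (psi : 'rV[R]_3 -> R) (l : {set 'I_n} -> 'rV[R]_3),
     [/\ PL_with v cones psi l, ~ is_linear_fun psi & (hull_dim (Lambda_points cones l) < 3)%N].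
Proof.
move=> fan one inf; have fanQ := fan_rat fan; have [b bP] := exists_dual_basis fanQ.
have [bR bRP] := exists_dual_basis fan.
have [S [ordS parS]] := special_set one.
have [K cluster] := Cluster.exists_cluster_field.
have [y [nl acyc]] := limit_function fanQ bP cluster inf.
have [u u0 hu] := grad_direction fanQ bP acyc ordS parS.
have [s0 s0c _] := cones_cover fan bRP 0.
have [y' [nl' hu']] := rational_solution (ex_intro _ s0 s0c) hu nl.
pose g (s : {set 'I_n}) : 'rV[rat]_3 := \sum_(k in s) (y' k)%:~R *: b s k.
pose l s : 'rV[R]_3 := map_mx ratr (g s).
have lE m s : dotp (realize R (v m)) (l s) = ratr (dotp (realize rat (v m)) (g s)).
  by rewrite -(realize_ratr R) dotp_map.
have ly s k : s \in cones -> k \in s -> dotp (realize R (v k)) (l s) = (y' k)%:~R.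
  by move=> sc ks; rewrite lE (dotp_int_grad bP) // ratr_int.
(* Any cone containing [x] may be picked, since gradients agree on common points; the default 0 is
   never reached, as the fan is complete. *)
pose psi x := if [pick s in cones | [forall k, 0 <= dotp x (bR s k)]] is Some s then dotp x (l s) else 0.
have pl : PL_with v cones psi l.
  move=> s sc x /(in_cone_dual bRP _ sc) xs; rewrite /psi; case: pickP => [t /andP[tc /forallP xt]|/(_ s)].
    exact: (pl_agree fan bRP ly).
  by rewrite sc => /negP[]; apply/forallP.
exists psi, l; split=> //.
- move=> [w hw]; apply: (nl' (g s0)) => k.
  have yk m : (y' m)%:~R = dotp (realize R (v m)) w.
    have [s sc ms] := cone_at fan m.
    by rewrite -(ly s) // -hw (pl s sc) //; apply/(in_cone_dual bRP _ sc)/(vF_inC bRP).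
  apply: (fmorph_inj (@ratr R)); rewrite /= -lE ratr_int yk !(dotp_decompK bP k _ s0c).
  by apply: eq_bigr => m ms; rewrite ly // yk.
apply/hull_direction; exists (map_mx ratr u).
  by rewrite map_mx_eq0.
have lu s : s \in cones -> dotp (map_mx ratr u) (l s) = ratr (dotp u (g s0)).
  by move=> sc; rewrite dotp_map (hu' s s0).
have nthu i : (i < size (Lambda_points cones l))%N -> dotp (map_mx ratr u) (Lambda_points cones l)`_i = ratr (dotp u (g s0)).
  rewrite size_map => ic; rewrite (nth_map set0) //; apply: lu.
  by rewrite -mem_enum mem_nth.
move=> i ic; rewrite !nthu //; exact: leq_ltn_trans ic.
Qed.

Theorem theorem4p12 (R : rcfType) (n : nat) (v : 'I_n -> 'rV[int]_3)
    (cones : {set {set 'I_n}}) :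
  complete_simplicial_stacky_fan R v cones ->
  at_most_one_collinear_pair v ->
  (infinitely_many_Htrivial v cones <->
   exists (psi : 'rV[R]_3 -> R) (l : {set 'I_n} -> 'rV[R]_3),
     [/\ PL_with v cones psi l, ~ is_linear_fun psi &
         (hull_dim (Lambda_points cones l) < 3)%N]).
Proof.
move=> fan one; split=> [|[psi [l [pl nl hd]]]]; first exact: PL_of_infinitely_many.
exact: infinitely_many_of_PL pl nl hd.
Qed.
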